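(* Let $Z=G(U)+\varepsilon$ satisfy conditions (1)--(5) listed in the context, with $U$ and $\varepsilon$ given by polynomial chaos expansions as described there, and let $z\in\mathbb R^d$. Let $(J_n)_{n\in\mathbb N}$ be a monotone and exhaustive sequence of finite subsets of $\mathbb J$ (i.e. $J_m\subset J_n$ for $m\le n$ and $\bigcup_n J_n=\mathbb J$) with $\boldsymbol 0\in J_1$, such that for some $\delta>0$ there exists $C<+\infty$ with $$\mathbb E\left[|G(U_{J_n})|^{2+\delta}\right]\le C\qquad\forall n\in\mathbb N.$$ Then $\|Z-Z_{J_n}\|_{L^2(\mathbb R^d)}\to0$ as $n\to\infty$. Moreover, if $U^a_{J_n}=\sum_{\boldsymbol\alpha\in J_n}u^a_{J_n,\boldsymbol\alpha}P_{\boldsymbol\alpha}(\boldsymbol\xi)$ denotes the random variable generated by the Polynomial Chaos Kalman filter (PCKF) in the analysis step for the subset $J=J_n$, and $U^a$ denotes the analysis variable, then, as $n\to\infty$, $$\|U^a-U^a_{J_n}\|_{L^2(\mathcal X)}\in\mathcal O\left(\|U-U_{J_n}\|_{L^2(\mathcal X)}+\|Z-Z_{J_n}\|_{L^2(\mathbb R^d)}\right),$$ which means in particular that $U^a_{J_n}\to U^a$ in $L^2(\mathcal X)$ as $n\to\infty$.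
   Context: $\mathcal X$ is a separable Hilbert space with norm $\|\cdot\|$; $|\cdot|$ is the Euclidean norm on $\mathbb R^d$. All random variables live on a probability space $(\Omega,\mathcal F,\mathbb P)$; $L^2(\mathcal X)=L^2(\Omega,\mathcal F,\mathbb P;\mathcal X)$ and $L^2(\mathbb R^d)=L^2(\Omega,\mathcal F,\mathbb P;\mathbb R^d)$ are Bochner spaces of square-integrable random variables. $U$ is $\mathcal X$-valued, $\varepsilon$ is $\mathbb R^d$-valued, $G:\mathcal X\to\mathbb R^d$, and $Z=G(U)+\varepsilon$. Conditions: (1) $U\sim\mu_0$, $\varepsilon\sim\nu_\varepsilon$ and $(U,\varepsilon)\sim\mu_0\otimes\nu_\varepsilon$ (independence). (2) $\nu_\varepsilon$ has Lebesgue density $\rho(\varepsilon)=c\,e^{-\ell(\varepsilon)}$ with $c>0$ and $\ell:\mathbb R^d\to[0,\infty)$ measurable. (3) $G$ is continuous. (4) With $\Phi(u;z):=\ell(z-G(u))$, there is a nondecreasing $\psi:[0,\infty)\to[0,\infty)$ with $\lim_{s\to0}\psi(s)=\psi(0)=0$ and $\int_{\mathcal X}|\Phi(u;z_1)-\Phi(u;z_2)|^2\,\mu_0(\mathrm du)\le\psi(|z_1-z_2|)$ for all $z_1,z_2\in\mathbb R^d$. (5) $\int_{\mathcal X}(\|u\|^2+|G(u)|^2)\,\mu_0(\mathrm du)<\infty$ and $\int_{\mathbb R^d}|\varepsilon|^2\,\nu_\varepsilon(\mathrm d\varepsilon)<\infty$. Covariance: for square-integrable Hilbert-space-valued $X,Y$,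 $\mathrm{Cov}(X,Y)=\mathbb E[(X-\mathbb E X)\otimes(Y-\mathbb E Y)]$, $\mathrm{Cov}(X)=\mathrm{Cov}(X,X)$; for $X$ with values in $\mathcal X$ and $Y$ with values in $\mathbb R^d$, $\mathrm{Cov}(X,Y)$ is regarded as the linear operator $\mathbb R^d\to\mathcal X$, $x\mapsto\mathbb E[\langle Y-\mathbb EY,x\rangle\,(X-\mathbb EX)]$. Polynomial chaos setting: $\boldsymbol\xi=(\xi_m)_{m\in\mathbb N}$ are independent real-valued random variables; for each $m$, $\{P^{(m)}_\alpha\}_{\alpha\in\mathbb N_0}$ are univariate polynomials, $P^{(m)}_\alpha$ of degree $\alpha$ with $P^{(m)}_0\equiv1$, forming a complete orthonormal system of $L^2(\mathbb R,\mathcal B(\mathbb R),\mathbb P_{\xi_m};\mathbb R)$, where $\mathbb P_{\xi_m}$ is the distribution of $\xi_m$. $\mathbb J:=\{\boldsymbol\alpha\in\mathbb N_0^{\mathbb N}:\alpha_j\ne0\text{ for only finitely many }j\}$ and $P_{\boldsymbol\alpha}(\boldsymbol\xi)=\prod_{m\ge1}P^{(m)}_{\alpha_m}(\xi_m)$. There are coefficients $u_{\boldsymbol\alpha}\in\mathcal X$, $\varepsilon_{\boldsymbol\alpha}\in\mathbb R^d$ with $\sum_{\boldsymbol\alpha\in\mathbb J}\|u_{\boldsymbol\alpha}\|^2<\infty$, $\sum_{\boldsymbol\alpha\in\mathbb J}|\varepsilon_{\boldsymbol\alpha}|^2<\infty$ and $$U=\sum_{\boldsymbol\alpha\in\mathbb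 J}u_{\boldsymbol\alpha}P_{\boldsymbol\alpha}(\boldsymbol\xi),\qquad \varepsilon=\sum_{\boldsymbol\alpha\in\mathbb J}\varepsilon_{\boldsymbol\alpha}P_{\boldsymbol\alpha}(\boldsymbol\xi),\qquad (U,\varepsilon)\sim\mu_0\otimes\nu_\varepsilon .$$ For $J\subseteq\mathbb J$, $\mathrm P_J$ denotes the truncation (projection) $\mathrm P_J\big(\sum_{\boldsymbol\alpha\in\mathbb J}x_{\boldsymbol\alpha}P_{\boldsymbol\alpha}(\boldsymbol\xi)\big)=\sum_{\boldsymbol\alpha\in J}x_{\boldsymbol\alpha}P_{\boldsymbol\alpha}(\boldsymbol\xi)$, and $$U_J:=\mathrm P_JU,\qquad Z_J:=\mathrm P_J(G(U_J)+\varepsilon).$$ PCKF analysis step for a finite $J\subset\mathbb J$ and data $z\in\mathbb R^d$: with $z_{J,\boldsymbol\alpha}$ ($\boldsymbol\alpha\in J$) the chaos coefficients of $Z_J$ and $K_J:=\mathrm{Cov}(U_J,Z_J)\mathrm{Cov}(Z_J)^{-1}$, put $$u^a_{J,\boldsymbol\alpha}:=u_{\boldsymbol\alpha}+K_J(\delta_{\boldsymbol\alpha\boldsymbol0}z-z_{J,\boldsymbol\alpha}),\quad\boldsymbol\alpha\in J,\qquad U^a_J:=\sum_{\boldsymbol\alpha\in J}u^a_{J,\boldsymbol\alpha}P_{\boldsymbol\alpha}(\boldsymbol\xi),$$ where $\delta_{\boldsymbol\alpha\boldsymbol0}$ is the Kronecker symbol (so $U^a_J=U_J+K_J(z-Z_J)$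 when $\boldsymbol0\in J$). $U^a_{J_n}$ is considered for $n$ large enough that $\mathrm{Cov}(Z_{J_n})$ is invertible. Analysis variable: $U^a:=U+K(z-Z)$ with $K=\mathrm{Cov}(U,Z)\mathrm{Cov}(Z)^{-1}$. *)

(* Defs.v *)
From HB Require Import structures.
From mathcomp Require Import all_boot all_order all_algebra finmap.
From mathcomp Require Import all_classical all_reals all_analysis.
Set Implicit Arguments.
Unset Strict Implicit.
Unset Printing Implicit Defensive.
Import Order.TTheory GRing.Theory Num.Theory numFieldNormedType.Exports.
Local Open Scope classical_set_scope.
Local Open Scope ring_scope.

Notation borel T := (g_sigma_algebraType (@open T)).

Section lebesgue_tupleS.
Context (R : realType) (n : nat).
Variable m :
  {sigma_finite_measure set (n.-tuple (measurableTypeR R)) -> \bar R}.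
Local Notation RxT := (measurableTypeR R * n.-tuple (measurableTypeR R))%type.

Definition tuple_cons (p : RxT) : n.+1.-tuple (measurableTypeR R) :=
  [tuple of p.1 :: p.2].

Lemma measurable_tuple_cons : measurable_fun [set: RxT] tuple_cons.
Proof. exact: measurable_cons. Qed.

Definition lebesgue_tupleS : set (n.+1.-tuple (measurableTypeR R)) -> \bar R :=
  pushforward (@lebesgue_measure R \x m)%E tuple_cons.

Let lebesgue_tupleS0 : lebesgue_tupleS set0 = 0%E.
Proof. by apply: measure0; exact: measurable_tuple_cons. Qed.

Let lebesgue_tupleS_ge0 A : (0 <= lebesgue_tupleS A)%E.
Proof. by apply: measure_ge0; exact: measurable_tuple_cons. Qed.

Let lebesgue_tupleS_sigma_additive : semi_sigma_additive lebesgue_tupleS.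
Proof.
by apply: measure_semi_sigma_additive; exact: measurable_tuple_cons.
Qed.

HB.instance Definition _ := isMeasure.Build _ _ _ lebesgue_tupleS
  lebesgue_tupleS0 lebesgue_tupleS_ge0 lebesgue_tupleS_sigma_additive.

Let lebesgue_tupleS_sigma_finite : sigma_finite setT lebesgue_tupleS.
Proof.
pose g (t : n.+1.-tuple (measurableTypeR R)) : RxT :=
  (thead t, [tuple of behead t]).
have mg : measurable_fun setT g.
  apply/measurable_fun_pair; first exact: measurable_tnth.
  exact: measurable_behead.
have [F TF Ffin] : sigma_finite setT (@lebesgue_measure R \x m)%E.
  have /sigma_finiteP[A [TA ndA Aoo]] := sigma_finiteT (@lebesgue_measure R).
  have /sigma_finiteP[B [TB ndB Boo]] := sigma_finiteT m.
  exists (fun k => A k `*` B k).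
    rewrite -setXTT TA TB predeqE => -[x y]; split.
      move=> [/= [i _ Aix] [j _ Bjy]]; exists (maxn i j) => //; split.
      - by move: x Aix; exact/subsetPset/ndA/leq_maxl.
      - by move: y Bjy; exact/subsetPset/ndB/leq_maxr.
    by move=> [k _ []/= ? ?]; split; exists k.
  move=> k; have [? ?] := Aoo k; have [? ?] := Boo k.
  split; first exact: measurableX.
  by rewrite product_measure1E// lte_mul_pinfty// ge0_fin_numE.
exists (fun k => g @^-1` F k).
  by rewrite -preimage_bigcup -TF preimage_setT.
move=> k; have [mF Foo] := Ffin k; split.
  by rewrite -[X in measurable X]setTI; exact: mg.
rewrite /lebesgue_tupleS /pushforward -comp_preimage.
rewrite (_ : g \o tuple_cons = id) ?preimage_id//.
apply/funext => -[x t] /=; congr pair; exact/val_inj.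
Qed.

HB.instance Definition _ := @Measure_isSigmaFinite.Build _ _ _
  lebesgue_tupleS lebesgue_tupleS_sigma_finite.
End lebesgue_tupleS.

Fixpoint lebesgue_tuple (R : realType) (n : nat) :
    {sigma_finite_measure set (n.-tuple (measurableTypeR R)) -> \bar R} :=
  match n with
  | 0 => \d_([tuple] : 0.-tuple (measurableTypeR R))
  | n'.+1 => lebesgue_tupleS (lebesgue_tuple R n')
  end.

(* Lebesgue measure on the Borel sets of R^n: the image of the n-fold product
   of the Lebesgue measure on R.  The topology of ['rV[R]_n] comes from the max
   norm; it is the usual one, and so are its Borel sets. *)
Section lebesgue_rV.
Context (R : realType) (n : nat).

Definition row_of_tuple (t : n.-tuple (measurableTypeR R)) : borel 'rV[R]_n :=
  \row_i tnth t i.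

Lemma measurable_row_of_tuple : measurable_fun setT row_of_tuple.
Proof.
apply: (@measurability _ _ _ (borel 'rV[R]_n) setT row_of_tuple
  (@open 'rV[R]_n) erefl) => _ [A oA <-].
rewrite setTI.
pose c (q : 'rV[rat]_n) : 'rV[R]_n := \row_i ratr (q 0 i).
pose W := [set p : 'rV[rat]_n * nat | ball (c p.1) p.2.+1%:R^-1 `<=` A].
have -> : A = \bigcup_(p in W) ball (c p.1) p.2.+1%:R^-1.
  apply/seteqP; split => [x Ax|x [p] Wp]; last exact: Wp.
  have /nbhs_ballP[e /= e0 xeA] := open_nbhs_nbhs (conj oA Ax).
  have [k ke] : exists k : nat, k.+1%:R^-1 < e / 2.
    have e20 : 0 < e / 2 by rewrite divr_gt0.
    have := near_infty_natSinv_lt (PosNum e20).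
    by case=> k _ /(_ k (leqnn k)) ?; exists k.
  have k0 : 0 < k.+1%:R^-1 :> R by rewrite invr_gt0.
  have qP i : exists q : rat, ball (x 0 i) k.+1%:R^-1 (ratr q : R).
    have /rat_in_itvoo[q] : x 0 i - k.+1%:R^-1 < x 0 i + k.+1%:R^-1.
      by rewrite ltrD2l (lt_trans _ k0)// oppr_lt0.
    by exists q; rewrite ball_itv.
  have [q xq] := choice qP.
  have cE : forall i j, ball (x i j) k.+1%:R^-1 (c (\row_i q i) i j).
    by move=> i j; rewrite !mxE ord1.
  exists (\row_i q i, k) => /=; last first.
    by apply: ball_sym; split.
  move=> y cy; apply: xeA; apply: (@le_ball _ _ _ (k.+1%:R^-1 + k.+1%:R^-1)).
    by rewrite (splitr e) lerD// ltW.
  by apply: ball_triangle cy; split.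
rewrite preimage_bigcup bigcup_mkcond.
apply: countable_bigcupT_measurable => // -[q k]; case: ifPn => // _.
rewrite (_ : _ @^-1` _ = \bigcap_(i in [set: 'I_n])
    ((fun t : n.-tuple (measurableTypeR R) => tnth t i) @^-1`
     ball (c q 0 i) k.+1%:R^-1)); last first.
  apply/seteqP; split => t /=.
    by move=> [_ tq] i _ /=; have := tq 0 i; rewrite [X in ball _ _ X]mxE.
  by move=> tq; split => // i j; rewrite [X in ball _ _ X]mxE ord1; exact: tq.
apply: fin_bigcap_measurable => // i _.
rewrite -[X in measurable X]setTI; apply: measurable_tnth => //.
by rewrite ball_itv; exact: measurable_itv.
Qed.

Definition lebesgue_rV : set (borel 'rV[R]_n) -> \bar R :=
  pushforward (lebesgue_tuple R n) row_of_tuple.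

Let lebesgue_rV0 : lebesgue_rV set0 = 0%E.
Proof. by apply: measure0; exact: measurable_row_of_tuple. Qed.

Let lebesgue_rV_ge0 A : (0 <= lebesgue_rV A)%E.
Proof. by apply: measure_ge0; exact: measurable_row_of_tuple. Qed.

Let lebesgue_rV_sigma_additive : semi_sigma_additive lebesgue_rV.
Proof.
by apply: measure_semi_sigma_additive; exact: measurable_row_of_tuple.
Qed.

HB.instance Definition _ := isMeasure.Build _ _ _ lebesgue_rV
  lebesgue_rV0 lebesgue_rV_ge0 lebesgue_rV_sigma_additive.
End lebesgue_rV.

Section euclidean.
Context (R : realType) (n : nat).

(* The canonical norm [`|x|] of ['rV[R]_n] is the max norm. *)
Definition edot (x y : 'rV[R]_n) : R := \sum_(i < n) x 0 i * y 0 i.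
Definition enorm (x : 'rV[R]_n) : R := Num.sqrt (edot x x).
End euclidean.

Definition hilbert_space (R : realType) (X : completeNormedModType R) : Prop :=
  exists ip : X -> X -> R,
    [/\ forall x y, ip x y = ip y x,
        forall a x y z, ip (a *: x + y) z = a * ip x z + ip y z
      & forall x, ip x x = `|x| ^+ 2].

Definition separable_space (X : topologicalType) : Prop :=
  exists A : set X, countable A /\ dense A.

Section bochner_integral.
Context d (T : measurableType d) (R : realType) (P : probability T R)
  (V : normedModType R).

Definition is_simple (s : T -> V) : Prop :=
  finite_set (range s) /\ forall v, measurable (s @^-1` [set v]).

Definition simple_integral (s : T -> V) : V :=
  \sum_(v \in range s) fine (P (s @^-1` [set v])) *: v.

Definition is_bochner_integral (f : T -> V) (v : V) : Prop :=
  measurable_fun [set: T] (f : T -> borel V) /\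
  exists s : nat -> T -> V,
    [/\ forall k, is_simple (s k),
        (\int[P]_w (`|f w - s k w|%R)%:E)%E @[k --> \oo] --> 0%E
      & simple_integral (s k) @[k --> \oo] --> v].

(* Junk value 0 when [f] is not Bochner integrable.  For [V := 'rV[R]_n] the
   max norm is equivalent to the Euclidean one and gives the same integral. *)
Definition bochner (f : T -> V) : V :=
  xget 0 [set v | is_bochner_integral f v].
End bochner_integral.

Section covariance_operator.
Context d (T : measurableType d) (R : realType) (P : probability T R) (n : nat).
Implicit Type V : normedModType R.

(* Cov(X, Y), as the operator x |-> E[<Y - EY, x> (X - EX)]. *)
Definition cov V (X : T -> V) (Y : T -> 'rV[R]_n) (x : 'rV[R]_n) : V :=
  bochner P (fun w => edot (Y w - bochner P Y) x *: (X w - bochner P X)).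

(* Matrix of the operator Cov(Z), acting on row vectors from the right. *)
Definition cov_mx (Z : T -> 'rV[R]_n) : 'M[R]_n := lin1_mx (cov Z Z).

(* K = Cov(X, Z) Cov(Z)^-1, meaningful when [cov_mx Z \in unitmx]. *)
Definition kalman_gain V (X : T -> V) (Z : T -> 'rV[R]_n) (y : 'rV[R]_n) : V :=
  cov X Z (y *m invmx (cov_mx Z)).

Definition analysis_variable V (X : T -> V) (Z : T -> 'rV[R]_n)
    (z : 'rV[R]_n) (w : T) : V :=
  X w + kalman_gain X Z (z - Z w).
End covariance_operator.

(* ||f||_{L^2}, where [nrm] is the norm of the target space. *)
Definition L2norm d (T : measurableType d) (R : realType) (P : probability T R)
    (V : Type) (nrm : V -> R) (f : T -> V) : \bar R :=
  ('N[P]_2%:E[EFin \o nrm \o f])%E.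

Definition independent d (T : measurableType d) (R : realType)
    (P : probability T R) (xi : nat -> {RV P >-> R}) : Prop :=
  forall (F : {fset nat}) (B : nat -> set R),
    (forall m, measurable (B m)) ->
    P (\bigcap_(m in [set` F]) (xi m @^-1` B m)) =
    (\prod_(m <- F) fine (P (xi m @^-1` B m)))%:E.

(* The polynomials [p a], a = 0, 1, ..., form a complete orthonormal system of
   L^2(R, mu): they are orthonormal and their linear span is dense. *)
Definition complete_orthonormal (R : realType) (mu : {measure set R -> \bar R})
    (p : nat -> {poly R}) : Prop :=
  (forall a b : nat,
     (\int[mu]_x ((p a).[x] * (p b).[x])%:E)%E = (a == b)%:R%:E) /\
  (forall f : R -> R, measurable_fun [set: R] f ->
     ('N[mu]_2%:E[EFin \o f] < +oo)%E ->
     forall e : R, 0 < e -> exists (k : nat) (c : nat -> R),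
       ('N[mu]_2%:E[EFin \o (fun x => f x - \sum_(a < k) c a * (p a).[x])%R]
          < e%:E)%E).

Notation multi_index := {fsfun nat -> nat with 0%N}.

Section polynomial_chaos.
Context d (T : measurableType d) (R : realType) (P : probability T R).
Variables (xi : nat -> {RV P >-> R}) (p : nat -> nat -> {poly R}).

(* [p m 0 = 1], so only the finitely many m with a m <> 0 contribute. *)
Definition chaos_poly (a : multi_index) (w : T) : R :=
  \prod_(m <- finsupp a) (p m (a m)).[xi m w].

Section vector_valued.
Context (V : normedModType R).
Implicit Types (nrm : V -> R) (x : multi_index -> V) (Y : T -> V).

Definition chaos_sum (F : {fset multi_index}) x (w : T) : V :=
  \sum_(a <- F) chaos_poly a w *: x a.

(* Y = sum_a x_a P_a(xi), with (unconditional) convergence in L^2. *)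
Definition chaos_expansion nrm Y x : Prop :=
  forall e : R, 0 < e -> exists F0 : {fset multi_index},
    forall F : {fset multi_index}, (F0 `<=` F)%fset ->
      (L2norm P nrm (fun w => Y w - chaos_sum F x w)%R < e%:E)%E.

Definition square_summable nrm x : Prop :=
  (\esum_(a in [set: multi_index]) (nrm (x a) ^+ 2)%R%:E < +oo)%E.

(* The coefficients are unique when the P_a(xi) are orthonormal in L^2. *)
Definition chaos_coef nrm Y : multi_index -> V :=
  xget (fun=> 0) [set x | chaos_expansion nrm Y x].

(* P_F (sum_a x_a P_a(xi)) = sum_(a in F) x_a P_a(xi). *)
Definition chaos_trunc nrm (F : {fset multi_index}) Y : T -> V :=
  chaos_sum F (chaos_coef nrm Y).
End vector_valued.

Section pckf.
Context (X : normedModType R) (n : nat).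
Variables (G : X -> 'rV[R]_n) (U : T -> X) (u : multi_index -> X).
Variable eps : T -> 'rV[R]_n.
Implicit Types (F : {fset multi_index}) (z : 'rV[R]_n).

Definition pckf_U F : T -> X := chaos_trunc Num.norm F U.

Definition pckf_Z F : T -> 'rV[R]_n :=
  chaos_trunc (@enorm R n) F (fun w => G (pckf_U F w) + eps w).

Definition pckf_analysis_coef F z (a : multi_index) : X :=
  u a +
  kalman_gain P (pckf_U F) (pckf_Z F)
    ((a == [fsfun])%:R *: z - chaos_coef (@enorm R n) (pckf_Z F) a).

Definition pckf_analysis F z : T -> X := chaos_sum F (pckf_analysis_coef F z).
End pckf.
End polynomial_chaos.

(* Main.v *)
Require Import Defs.
From HB Require Import structures.
From mathcomp Require Import all_boot all_order all_algebra finmap.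
From mathcomp Require Import all_classical all_reals all_analysis.
From mathcomp Require Import measurable_realfun.
From mathcomp Require Import ring lra.
Set Implicit Arguments.
Unset Strict Implicit.
Unset Printing Implicit Defensive.
Import Order.TTheory GRing.Theory Num.Theory numFieldNormedType.Exports.
Local Open Scope classical_set_scope.
Local Open Scope ring_scope.
Import HBNNSimple HBSimple.

(* Since the [P_a(xi)] are orthonormal and complete in L^2(sigma(xi)), the
   coefficients in a chaos expansion are the Fourier coefficients, so truncation
   is a contraction of L^2 and Z - Z_J splits into Z - P_J Z and
   P_J (G(U) - G(U_J)).  The second part vanishes because U_J -> U almost surely
   along subsequences and the (2 + delta)-moments make |G(U_J)|^2 uniformly
   integrable.  The density of eps makes hyperplanes null for the law of Z, hence
   Cov(Z) is definite, and the Kalman gain depends on (U, Z) in a locally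
   Lipschitz way; the rate follows from
   U^a - U^a_J = (U - U_J) - K (Z - Z_J) + (K - K_J) (z - Z_J). *)

(** * Mean-square calculus *)

(** Chaos coefficients and Bochner integrals are selected by [xget], so nothing can be computed
    before existence and, for coefficients, uniqueness are proved. Pairing with a fixed vector
    reduces both questions, and every property of [cov], to means of real functions; the notion
    [inner_product] makes this work for [X] and for row vectors alike. Only the univariate systems
    are assumed complete. Completeness in L^2(sigma(xi)) is obtained by approximating one indicator
    factor at a time by polynomials, followed by a Dynkin argument. It is applied to G(U_J), a
    function of finitely many [xi m]. [U] itself is only an L^2 limit of such sums and is not given
    as measurable for sigma(xi), so membership of Z in the chaos span is deduced from the L^2
    convergence of G(U_J), which must precede the projection argument for Z. The gain difference K -
    K_J is controlled by the two errors themselves once both are at most 1 and the relative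
    perturbation of Cov(Z) is at most 1/2. This is where convergence is used in the rate, and why
    the bound holds only for large indices. *)

Section mean_square.
Context d (T : measurableType d) (R : realType) (P : probability T R).
Implicit Types (f g h : T -> R) (c : R).

Definition intble f := P.-integrable [set: T] (EFin \o f).

Definition mean f : R := Rintegral P [set: T] f.

Lemma mean_EFin f : intble f -> (\int[P]_w (f w)%:E)%E = (mean f)%:E.
Proof. by move=> fi; rewrite fineK//; exact: integrable_fin_num. Qed.

Lemma intble_mfun f : intble f -> measurable_fun setT f.
Proof. by move=> /measurable_int/measurable_EFinP. Qed.

Lemma intble_cst c : intble (fun=> c).
Proof. exact: finite_measure_integrable_cst. Qed.

Lemma intbleD f g : intble f -> intble g -> intble (fun w => f w + g w).
Proof. by move=> fi gi; apply: eq_integrable (integrableD _ fi gi). Qed.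

Lemma intbleZ c f : intble f -> intble (fun w => c * f w).
Proof. by move=> fi; apply: eq_integrable (integrableZl _ c fi). Qed.

Lemma intbleB f g : intble f -> intble g -> intble (fun w => f w - g w).
Proof. by move=> fi gi; apply: eq_integrable (integrableB _ fi gi). Qed.

Lemma intble_sum (I : Type) (s : seq I) (h : I -> T -> R) :
  (forall i, intble (h i)) -> intble (fun w => \sum_(i <- s) h i w).
Proof.
move=> hi; elim: s => [|i s IH].
  apply: eq_integrable (intble_cst 0) => // w _.
  by rewrite /= big_nil.
apply: eq_integrable (intbleD (hi i) IH) => // w _.
by rewrite /= big_cons.
Qed.

Lemma le_intble f g : measurable_fun setT f -> (forall w, `|f w| <= g w) ->
  intble g -> intble f.
Proof.
move=> mf fg gi; apply: le_integrable gi => //; first exact/measurable_EFinP.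
by move=> w _ /=; rewrite lee_fin (le_trans (fg w))// ler_norm.
Qed.

Lemma intble_norm f : intble f -> intble (fun w => `|f w|).
Proof. by move=> fi; apply: eq_integrable (integrable_abse fi). Qed.

Lemma ge0_intble f : measurable_fun setT f -> (forall w, 0 <= f w) ->
  (\int[P]_w (f w)%:E < +oo)%E -> intble f.
Proof.
move=> mf f0 fi; apply/integrableP; split; first exact/measurable_EFinP.
by under eq_integral => w _ do rewrite /= ger0_norm//.
Qed.

Lemma mean_cst c : mean (fun=> c) = c.
Proof. by rewrite /mean Rintegral_cst//= probability_setT mulr1. Qed.

Lemma meanD f g : intble f -> intble g ->
  mean (fun w => f w + g w) = mean f + mean g.
Proof. exact: RintegralD. Qed.

Lemma meanB f g : intble f -> intble g ->
  mean (fun w => f w - g w) = mean f - mean g.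
Proof. exact: RintegralB. Qed.

Lemma meanZ c f : intble f -> mean (fun w => c * f w) = c * mean f.
Proof. by move=> fi; rewrite /mean RintegralZl. Qed.

Lemma mean_sum (I : Type) (s : seq I) (h : I -> T -> R) :
  (forall i, intble (h i)) ->
  mean (fun w => \sum_(i <- s) h i w) = \sum_(i <- s) mean (h i).
Proof.
move=> hi; elim: s => [|i s IH].
  by rewrite big_nil -[RHS](mean_cst 0); congr mean; apply/funext => w; rewrite big_nil.
rewrite big_cons -IH -meanD//; last exact: intble_sum.
by congr mean; apply/funext => w; rewrite big_cons.
Qed.

Lemma mean_ge0 f : (forall w, 0 <= f w) -> 0 <= mean f.
Proof. by move=> f0; apply: Rintegral_ge0. Qed.

Lemma le_mean f g : intble f -> intble g -> (forall w, f w <= g w) ->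
  mean f <= mean g.
Proof. by move=> fi gi fg; apply: le_Rintegral. Qed.

Lemma ler_norm_mean f : intble f -> `|mean f| <= mean (fun w => `|f w|).
Proof. by move=> fi; apply: le_normr_Rintegral. Qed.

Definition sqint f := measurable_fun setT f /\ intble (fun w => f w ^+ 2).

Lemma sqint_mfun f : sqint f -> measurable_fun setT f. Proof. by case. Qed.

Lemma sqintM f g : sqint f -> sqint g -> intble (fun w => f w * g w).
Proof.
move=> [mf fi] [mg gi]; apply: (le_intble _ _ (intbleD fi gi)).
  exact: measurable_funM.
move=> w; rewrite normrM -(real_normK (num_real (f w))) -(real_normK (num_real (g w))).
have := sqr_ge0 (`|f w| - `|g w|); have := normr_ge0 (f w); have := normr_ge0 (g w).
by nra.
Qed.

Lemma sqint_cst c : sqint (fun=> c).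
Proof. by split => //; exact: intble_cst. Qed.

Lemma sqint_intble f : sqint f -> intble f.
Proof.
move=> fs; apply: eq_integrable (sqintM fs (sqint_cst 1)) => // w _.
by rewrite /= mulr1.
Qed.

Lemma sqint_sq f : sqint f -> intble (fun w => f w ^+ 2). Proof. by case. Qed.

Lemma le_sqint f g : measurable_fun setT f -> (forall w, f w ^+ 2 <= g w) ->
  intble g -> sqint f.
Proof.
move=> mf fg gi; split => //; apply: le_intble gi; first exact: measurable_funX.
by move=> w; rewrite ger0_norm ?sqr_ge0.
Qed.

Lemma sqintD f g : sqint f -> sqint g -> sqint (fun w => f w + g w).
Proof.
move=> fs gs; have [[mf fi] [mg gi]] := (fs, gs).
apply: (le_sqint _ _ (intbleZ 2 (intbleD fi gi))); first exact: measurable_funD.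
by move=> w; have := sqr_ge0 (f w - g w); rewrite /=; nra.
Qed.

Lemma sqintZ c f : sqint f -> sqint (fun w => c * f w).
Proof.
move=> [mf fi]; split; first exact: measurable_funM.
by apply: eq_integrable (intbleZ (c ^+ 2) fi) => // w _; rewrite /= exprMn.
Qed.

Lemma sqintB f g : sqint f -> sqint g -> sqint (fun w => f w - g w).
Proof.
move=> fs gs; have := sqintD fs (sqintZ (-1) gs); congr sqint.
by apply/funext => w; rewrite mulN1r.
Qed.

Lemma sqint_sum (I : Type) (s : seq I) (h : I -> T -> R) :
  (forall i, sqint (h i)) -> sqint (fun w => \sum_(i <- s) h i w).
Proof.
move=> hi; elim: s => [|i s IH].
  by rewrite (_ : (fun _ => _) = fun=> 0); [exact: sqint_cst|apply/funext => w; rewrite big_nil].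
rewrite (_ : (fun _ => _) = fun w => h i w + \sum_(i <- s) h i w); first exact: sqintD.
by apply/funext => w; rewrite big_cons.
Qed.

Definition msq f : R := mean (fun w => f w ^+ 2).

Lemma msq_ge0 f : 0 <= msq f.
Proof. by apply: mean_ge0 => w; exact: sqr_ge0. Qed.

Lemma meanMDl f g h : sqint f -> sqint g -> sqint h ->
  mean (fun w => (f w + g w) * h w) =
  mean (fun w => f w * h w) + mean (fun w => g w * h w).
Proof.
move=> fs gs hs; rewrite -meanD; [|exact: sqintM..].
by congr mean; apply/funext => w; rewrite mulrDl.
Qed.

Lemma meanMBl f g h : sqint f -> sqint g -> sqint h ->
  mean (fun w => (f w - g w) * h w) =
  mean (fun w => f w * h w) - mean (fun w => g w * h w).
Proof.
move=> fs gs hs; rewrite -meanB; [|exact: sqintM..].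
by congr mean; apply/funext => w; rewrite mulrBl.
Qed.

Lemma meanMZl c f h : sqint f -> sqint h ->
  mean (fun w => c * f w * h w) = c * mean (fun w => f w * h w).
Proof.
move=> fs hs; rewrite -meanZ; last exact: sqintM.
by congr mean; apply/funext => w; rewrite mulrA.
Qed.

Lemma meanMC f g : mean (fun w => f w * g w) = mean (fun w => g w * f w).
Proof. by congr mean; apply/funext => w; rewrite mulrC. Qed.

Lemma msqD f g : sqint f -> sqint g ->
  msq (fun w => f w + g w) = msq f + 2 * mean (fun w => f w * g w) + msq g.
Proof.
move=> fs gs; rewrite /msq -meanZ ?sqintM// -!meanD//.
- by congr mean; apply/funext => w; ring.
- by apply: intbleD; [exact: sqint_sq|exact/intbleZ/sqintM].
- exact: sqint_sq.
- exact: sqint_sq.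
- exact/intbleZ/sqintM.
Qed.

Lemma msqZ c f : sqint f -> msq (fun w => c * f w) = c ^+ 2 * msq f.
Proof.
move=> fs; rewrite /msq -meanZ; last exact: sqint_sq.
by congr mean; apply/funext => w; rewrite exprMn.
Qed.

Lemma le_msq f g : sqint f -> sqint g -> (forall w, `|f w| <= `|g w|) ->
  msq f <= msq g.
Proof.
move=> fs gs fg; apply: le_mean; [exact: sqint_sq..|move=> w].
by rewrite -(real_normK (num_real (f w))) -(real_normK (num_real (g w))) lerXn2r ?nnegrE.
Qed.

Lemma msqD_le f g : sqint f -> sqint g ->
  msq (fun w => f w + g w) <= 2 * msq f + 2 * msq g.
Proof.
move=> fs gs; rewrite -mulrDr /msq -meanD; [|exact: sqint_sq..].
rewrite -meanZ; last by apply: intbleD; exact: sqint_sq.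
apply: le_mean.
- exact: (sqint_sq (sqintD fs gs)).
- by apply: intbleZ; apply: intbleD; exact: sqint_sq.
- by move=> w; have := sqr_ge0 (f w - g w); rewrite /=; nra.
Qed.

(** A quadratic that never turns negative has nonpositive discriminant. It is kept free of measures
    because it yields Cauchy-Schwarz twice: for means and for abstract inner products. *)
Lemma discr_le (a b c : R) : 0 <= c ->
  (forall t, 0 <= a + 2 * t * b + t ^+ 2 * c) -> b ^+ 2 <= a * c.
Proof.
move=> c0 H; have [c_eq0|cN0] := eqVneq c 0.
  have [-> |bN0] := eqVneq b 0; first by rewrite c_eq0 mulr0 expr0n.
  (* This [t] makes the affine function [a + 2 * t * b] equal to -1. *)
  have := H (- (a + 1) / (2 * b)); rewrite c_eq0 mulr0 addr0.
  rewrite (_ : 2 * _ * b = - (a + 1)); first lra.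
  by field.
have c_gt0 : 0 < c by rewrite lt_def cN0.
have := H (- b / c).
rewrite (_ : a + _ + _ = (a * c - b ^+ 2) / c); last by field.
by rewrite pmulr_lge0 ?invr_gt0// subr_ge0.
Qed.

Lemma mean_CS f g : sqint f -> sqint g ->
  mean (fun w => f w * g w) ^+ 2 <= msq f * msq g.
Proof.
move=> fs gs; apply: discr_le => [|t]; first exact: msq_ge0.
have gt := sqintZ t gs.
have := msq_ge0 (fun w => f w + t * g w); rewrite msqD// msqZ//.
by rewrite meanMC meanMZl// (meanMC g) mulrA.
Qed.

Definition rms f : R := Num.sqrt (msq f).

Lemma rms_ge0 f : 0 <= rms f. Proof. exact: sqrtr_ge0. Qed.

Lemma sqr_rms f : rms f ^+ 2 = msq f.
Proof. by rewrite sqr_sqrtr// msq_ge0. Qed.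

Lemma norm_meanM f g : sqint f -> sqint g ->
  `|mean (fun w => f w * g w)| <= rms f * rms g.
Proof.
move=> fs gs; rewrite -(ler_pXn2r (n := 2)) ?nnegrE ?mulr_ge0 ?rms_ge0//.
by rewrite real_normK ?num_real// exprMn !sqr_rms mean_CS.
Qed.

Lemma rmsD f g : sqint f -> sqint g -> rms (fun w => f w + g w) <= rms f + rms g.
Proof.
move=> fs gs; rewrite -(ler_pXn2r (n := 2)) ?nnegrE ?addr_ge0 ?rms_ge0//.
rewrite sqr_rms msqD// -!sqr_rms.
have := norm_meanM fs gs; have := ler_norm (mean (fun w => f w * g w)).
by nra.
Qed.

Lemma le_rms f g : sqint f -> sqint g -> (forall w, `|f w| <= `|g w|) ->
  rms f <= rms g.
Proof. by move=> fs gs fg; rewrite ler_sqrt ?msq_ge0// le_msq. Qed.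

Lemma rmsZ c f : sqint f -> rms (fun w => c * f w) = `|c| * rms f.
Proof. by move=> fs; rewrite /rms msqZ// sqrtrM ?sqr_ge0// sqrtr_sqr. Qed.

Lemma rms_cst c : rms (fun=> c) = `|c|.
Proof. by rewrite /rms /msq mean_cst sqrtr_sqr. Qed.

End mean_square.

(** * Products of independent random variables *)

Section independence.
Context d (T : measurableType d) (R : realType) (P : probability T R).
Implicit Types (f g h : T -> R) (c : R).
Local Notation mean := (mean P).
Local Notation intble := (intble P).

(** The limit is an extended integral since [f] is not known to be integrable; where integrability
    of a product is to be proved, it comes out of this limit being finite. *)
Lemma mean_monotone_cvg (f_ : nat -> T -> R) f :
  (forall n, intble (f_ n)) -> (forall n w, 0 <= f_ n w) ->
  (forall w, {homo f_^~ w : m n / (m <= n)%N >-> m <= n}) ->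
  (forall w, f_ n w @[n --> \oo] --> f w) ->
  (mean (f_ n))%:E @[n --> \oo] --> (\int[P]_w (f w)%:E)%E.
Proof.
move=> fi f0 fnd fcvg.
have := @cvg_monotone_convergence _ _ _ P setT measurableT (fun n w => (f_ n w)%:E).
rewrite (_ : (fun n => _) = fun n => (mean (f_ n))%:E); last first.
  by apply/funext => n; rewrite mean_EFin.
rewrite (_ : (fun w => limn _) = fun w => (f w)%:E).
  apply=> //.
  - by move=> n; apply/measurable_EFinP; exact: intble_mfun.
  - by move=> n w _; rewrite lee_fin.
  - by move=> w _ m n mn; rewrite lee_fin; exact: fnd.
apply/funext => w; apply/cvg_lim => //; apply/cvg_EFin; first exact: nearW.
exact: fcvg.
Qed.

Lemma intble_comp_bounded (W f : T -> R) M : intble W -> measurable_fun setT f ->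
  (forall w, `|f w| <= M) -> intble (fun w => W w * f w).
Proof.
move=> Wi mf fM; have Mi := intbleZ M (intble_norm Wi); apply: le_intble Mi.
  by apply: measurable_funM => //; exact: intble_mfun Wi.
by move=> w; rewrite normrM mulrC ler_wpM2r.
Qed.

Lemma mean_mul_indep_nnsfun (W : T -> R) (Y : {RV P >-> R})
    (g : {nnsfun measurableTypeR R >-> R}) :
  intble W ->
  (forall B : set R, measurable B ->
    mean (fun w => W w * \1_B (Y w)) = mean W * fine (P (Y @^-1` B))) ->
  intble (fun w => W w * g (Y w)) /\ 
  mean (fun w => W w * g (Y w)) = mean W * mean (fun w => g (Y w)).
Proof.
move=> Wi WB.
have mB B : measurable B -> measurable_fun setT (fun w => \1_B (Y w) : R).
  move=> mB; apply: (@measurableT_comp _ _ _ _ _ _ (\1_B : R -> R) _ (Y : T -> R)) => //.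
have iB (V : T -> R) B : measurable B -> intble V -> intble (fun w => V w * \1_B (Y w)).
  move=> mBB Vi; apply: (intble_comp_bounded (M := 1) Vi); first exact: mB.
  by move=> w; rewrite ger0_norm// indicE; case: (_ \in _).
pose s := fset_set (range g).
have gE x : g x = \sum_(y <- s) y * \1_(g @^-1` [set y]) x.
  by rewrite fimfunE fsbig_finite.
pose hs y := fun w => (y * (W w * \1_(g @^-1` [set y]) (Y w))).
have mg y : measurable (g @^-1` [set y] : set (measurableTypeR R)).
  exact: measurable_sfunP.
have hi y : intble (hs y) by apply: intbleZ; exact: (iB _ _ (mg y) Wi).
have WE : (fun w => W w * g (Y w)) = fun w => \sum_(y <- s) hs y w.
  apply/funext => w; rewrite gE mulr_sumr; apply: eq_bigr => y _.
  by rewrite /hs; ring.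
have gYE : (fun w => g (Y w)) = fun w => \sum_(y <- s) y * (1 * \1_(g @^-1` [set y]) (Y w)).
  by apply/funext => w; rewrite gE; apply: eq_bigr => y _; rewrite mul1r.
split; first by rewrite WE; exact: intble_sum.
rewrite WE mean_sum// gYE mean_sum; last first.
  by move=> y; apply: intbleZ; exact: (iB _ _ (mg y) (intble_cst P 1)).
rewrite mulr_sumr; apply: eq_bigr => y _.
rewrite /hs !(meanZ y); [|exact: (iB _ _ (mg y) (intble_cst P 1))|exact: (iB _ _ (mg y) Wi)].
rewrite (WB _ (mg y)) mulrCA; congr (_ * (_ * _)).
transitivity (fine (\int[P]_w ((\1_(Y @^-1` (g @^-1` [set y])) w : R)%:E)%E)).
  rewrite integral_indic ?setIT//.
  exact: (measurable_funPTI Y (mg y)).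
by congr (fine _); apply: eq_integral => w _; rewrite mul1r.
Qed.

(** From events of [Y] one passes to simple functions by linearity and to [g] by monotone
    convergence. [W] is an arbitrary nonnegative variable so that it can stand for the product of
    the remaining factors. *)
Lemma mean_mul_indep (W : T -> R) (Y : {RV P >-> R}) (g : R -> R) :
  intble W -> (forall w, 0 <= W w) ->
  (forall B : set R, measurable B ->
    mean (fun w => W w * \1_B (Y w)) = mean W * fine (P (Y @^-1` B))) ->
  measurable_fun setT g -> (forall x, 0 <= g x) -> intble (fun w => g (Y w)) ->
  intble (fun w => W w * g (Y w)) /\ 
  mean (fun w => W w * g (Y w)) = mean W * mean (fun w => g (Y w)).
Proof.
move=> Wi W0 WB mg g0 gYi.
have mge : measurable_fun [set: measurableTypeR R] (EFin \o g) by exact/measurable_EFinP.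
pose g_ := nnsfun_approx measurableT mge.
have g_cvg x : g_ n x @[n --> \oo] --> g x.
  have /fine_cvgP[_] := @cvg_nnsfun_approx _ _ _ _ measurableT _ mge
    (fun x _ => g0 x : (0 <= (EFin \o g) x)%E) x I.
  exact.
have g_nd x : {homo (fun n => g_ n x) : m n / (m <= n)%N >-> m <= n}.
  by move=> m n mn; have := nd_nnsfun_approx measurableT mge mn => /lefP; exact.
have g_W n := mean_mul_indep_nnsfun (g_ n) Wi WB.
have g_1 n : intble (fun w => g_ n (Y w)).
  (* The simple case with [W = 1], where factorisation over events is trivial, gives integrability
     of [g_ n (Y w)]. *)
  have H B : measurable B ->
      mean (fun w => 1 * \1_B (Y w)) = mean (fun=> 1) * fine (P (Y @^-1` B)).
    move=> mB; rewrite mean_cst mul1r.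
    transitivity (fine (\int[P]_w ((\1_(Y @^-1` B) w : R)%:E)%E)).
      by congr (fine _); apply: eq_integral => w _; rewrite mul1r.
    by rewrite integral_indic ?setIT//; exact: measurable_funPTI.
  have [+ _] := mean_mul_indep_nnsfun (g_ n) (intble_cst P 1) H.
  by congr intble; apply/funext => w; rewrite mul1r.
have c1 : (mean (fun w => W w * g_ n (Y w)))%:E @[n --> \oo] -->
    (\int[P]_w (W w * g (Y w))%:E)%E.
  apply: mean_monotone_cvg.
  - by move=> n; have [] := g_W n.
  - by move=> n w; rewrite mulr_ge0.
  - by move=> w m n mn; rewrite ler_wpM2l// g_nd.
  - by move=> w; apply: cvgM; [exact: cvg_cst|exact: g_cvg].
have c2 : (mean (fun w => g_ n (Y w)))%:E @[n --> \oo] -->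
    (\int[P]_w (g (Y w))%:E)%E.
  by apply: mean_monotone_cvg => [||w m n mn|]; [exact: g_1| |exact: g_nd|].
move: c2; rewrite mean_EFin// => /fine_cvgP[_ c2].
have c3 : (mean (fun w => W w * g_ n (Y w)))%:E @[n --> \oo] -->
    (mean W * mean (fun w => g (Y w)))%:E.
  apply/cvg_EFin; first exact: nearW.
  rewrite (_ : _ \o _ = fun n => mean W * mean (fun w => g_ n (Y w))); last first.
    by apply/funext => n; have [_ /= ->] := g_W n.
  by apply: cvgM c2; exact: cvg_cst.
(* The two limits agree, so the extended integral is finite: this provides integrability as well as
   the value. *)
have E := cvg_unique _ c1 c3.
have mWg : measurable_fun setT (fun w => W w * g (Y w)).
  by apply: measurable_funM; [exact: intble_mfun Wi|exact: intble_mfun gYi].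
split; last by rewrite {1}/mean /Rintegral E.
by apply: ge0_intble => //; rewrite ?E ?ltry// => w; rewrite mulr_ge0.
Qed.

Context (xi : nat -> {RV P >-> R}) (xi_indep : independent xi).

(* The independence hypothesis is the case [s = [::]]; indicators are then
   replaced by functions one at a time. *)
Lemma mean_prod_indep_ge0 (s t : seq nat) (g : nat -> R -> R) (B : nat -> set R) :
  uniq (s ++ t) ->
  (forall m, measurable (B m)) ->
  (forall m, measurable_fun setT (g m)) -> (forall m x, 0 <= g m x) ->
  (forall m, m \in s -> intble (fun w => g m (xi m w))) ->
  let W := fun w => (\prod_(m <- s) g m (xi m w)) * \prod_(m <- t) \1_(B m) (xi m w) in
  intble W /\ mean W = (\prod_(m <- s) mean (fun w => g m (xi m w))) *
    \prod_(m <- t) fine (P (xi m @^-1` B m)).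
Proof.
move=> + + mg g0; elim: s t B => [|m s IH] t B ust mB gi.
  rewrite /= in ust; pose A := \bigcap_(m in [set` t]) (xi m @^-1` B m).
  rewrite (_ : (fun w => _) = \1_A); last first.
    apply/funext => w; rewrite big_nil mul1r indicE.
    have [wA|wA] := boolP (w \in A).
      rewrite big_seq big1// => m mt; rewrite indicE mem_set//.
      by move: wA; rewrite inE; apply.
    have /existsNP[m /not_implyP[mt Bm]] : ~ A w by move=> Aw; move: wA; rewrite mem_set.
    rewrite (big_rem m)//= indicE memNset ?mul0r//.
  have mA : measurable A.
    apply: fin_bigcap_measurable => //.
    by move=> m _; exact: measurable_funPTI.
  split.
    apply: ge0_intble => //; rewrite integral_indic// setIT.
    by rewrite (le_lt_trans (probability_le1 _ _))// ltry.
  rewrite big_nil mul1r /mean /Rintegral integral_indic// setIT.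
  pose F : {fset nat} := [fset x in t]%fset.
  have AE : A = \bigcap_(m in [set` F]) (xi m @^-1` B m).
    by apply: eq_bigcapl; split => x /=; rewrite !inE.
  apply: (etrans (congr1 fine (etrans (congr1 P AE) (xi_indep F mB)))) => /=.
  by apply: perm_big; apply: uniq_perm => // [|x]; rewrite ?fset_uniq ?inE.
have /= /andP[ms ust'] := ust.
have mt : m \notin t by apply: contra ms; rewrite mem_cat => ->; rewrite orbT.
have gi' k : k \in s -> intble (fun w => g k (xi k w)).
  by move=> ks; apply: gi; rewrite inE ks orbT.
have [W'i W'E] := IH t B ust' mB gi'.
pose W' w := (\prod_(m <- s) g m (xi m w)) * \prod_(m <- t) \1_(B m) (xi m w).
have W'0 w : 0 <= W' w.
  by apply: mulr_ge0; apply: prodr_ge0 => k _ //; rewrite indicE.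
have W'B B0 : measurable B0 ->
    mean (fun w => W' w * \1_B0 (xi m w)) = mean W' * fine (P (xi m @^-1` B0)).
  (* Putting [B0] at place [m] turns the induction hypothesis for [s] and [m :: t] into the
     factorisation over events of [xi m] that [mean_mul_indep] asks for. *)
  move=> mB0; pose B' k := if k == m then B0 else B k.
  have ums : uniq (s ++ m :: t) by rewrite -(uniq_catCA [:: m] s t).
  have mB' k : measurable (B' k) by rewrite /B'; case: ifP.
  have B'E (F : nat -> set R -> R) : \prod_(k <- t) F k (B' k) = \prod_(k <- t) F k (B k).
    apply: eq_big_seq => k kt; rewrite /B' ifN//; apply: contraNneq mt => <-; exact: kt.
  have [_] := IH (m :: t) B' ums mB' gi'.
  rewrite big_cons (B'E (fun k C => fine (P (xi k @^-1` C)))) /B' eqxx mulrCA.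
  rewrite mulrC W'E => <-; congr mean; apply/funext => w.
  rewrite big_cons (B'E (fun k C => \1_C (xi k w))) eqxx /W'.
  by rewrite -mulrA; congr (_ * _); rewrite mulrC.
have gm : intble (fun w => g m (xi m w)) by apply: gi; rewrite mem_head.
have [Wi WE] := mean_mul_indep W'i W'0 W'B (mg m) (g0 m) gm.
rewrite (_ : (fun w => _ * _) = fun w => W' w * g m (xi m w)); last first.
  by apply/funext => w; rewrite big_cons /W'; ring.
by split => //; rewrite WE W'E big_cons; ring.
Qed.

(* One factor at a time moves from [s] to [t], split into its positive and
   negative parts. *)
Lemma mean_prod_indep (s t : seq nat) (g h : nat -> R -> R) :
  uniq (s ++ t) ->
  (forall m, measurable_fun setT (g m)) ->
  (forall m, measurable_fun setT (h m)) -> (forall m x, 0 <= h m x) ->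
  (forall m, m \in s -> intble (fun w => g m (xi m w))) ->
  (forall m, m \in t -> intble (fun w => h m (xi m w))) ->
  let W := fun w => (\prod_(m <- s) g m (xi m w)) * \prod_(m <- t) h m (xi m w) in
  intble W /\ mean W = (\prod_(m <- s) mean (fun w => g m (xi m w))) *
    \prod_(m <- t) mean (fun w => h m (xi m w)).
Proof.
move=> + mg; elim: s t h => [|m s IH] t h ust mh h0 gi hi.
  have ut0 : uniq (t ++ [::]) by rewrite cats0.
  have [Wi WE] := mean_prod_indep_ge0 ut0 (fun=> measurable0) mh h0 hi.
  rewrite big_nil mul1r; move: WE; rewrite big_nil mulr1 => <-.
  rewrite (_ : (fun w => _ * _) = (fun w : T =>
    (\prod_(m <- t) h m (xi m w)) * \prod_(m <- [::]) \1_(set0 : set R) (xi m w))) //.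
  by apply/funext => w; rewrite !big_nil mulr1 mul1r.
have /= /andP[ms ust'] := ust.
have mt : m \notin t by apply: contra ms; rewrite mem_cat => ->; rewrite orbT.
have ums : uniq (s ++ m :: t) by rewrite -(uniq_catCA [:: m] s t).
have gi' k : k \in s -> intble (fun w => g k (xi k w)).
  by move=> ks; apply: gi; rewrite inE ks orbT.
(* The induction hypothesis with a nonnegative [f] at place [m] joining [t]; it is applied to [gp]
   and [gn], the positive and negative parts of [g m]. *)
have part (f : R -> R) : measurable_fun setT f -> (forall x, 0 <= f x) ->
    intble (fun w => f (xi m w)) ->
    let W := fun w => (\prod_(m <- s) g m (xi m w)) *
      (f (xi m w) * \prod_(m <- t) h m (xi m w)) in
    intble W /\ mean W = (\prod_(m <- s) mean (fun w => g m (xi m w))) *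
      (mean (fun w => f (xi m w)) * \prod_(m <- t) mean (fun w => h m (xi m w))).
  move=> mf f0 fi; pose h' k := if k == m then f else h k.
  have h'E (F : nat -> (R -> R) -> R) : \prod_(k <- t) F k (h' k) = \prod_(k <- t) F k (h k).
    apply: eq_big_seq => k kt; rewrite /h' ifN//; apply: contraNneq mt => <-; exact: kt.
  have h'm : h' m = f by rewrite /h' eqxx.
  have mh' k : measurable_fun setT (h' k) by rewrite /h'; case: ifP.
  have h'0 k x : 0 <= h' k x by rewrite /h'; case: ifP.
  have h'i k : k \in m :: t -> intble (fun w => h' k (xi k w)).
    by rewrite inE /h'; case: eqP => [->//|_ /= kt]; exact: hi.
  have [] := IH (m :: t) h' ums mh' h'0 gi' h'i.
  rewrite big_cons (h'E (fun k q => mean (fun w => q (xi k w)))) h'm.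
  rewrite (_ : (fun w => _ * _) = fun w => (\prod_(m <- s) g m (xi m w)) *
      (f (xi m w) * \prod_(m <- t) h m (xi m w)))//.
  by apply/funext => w; rewrite big_cons (h'E (fun k q => q (xi k w))) h'm.
have gmi : intble (fun w => g m (xi m w)) by apply: gi; rewrite mem_head.
have mgm := mg m.
have mgx : measurable_fun setT (fun w => g m (xi m w)) by exact: intble_mfun gmi.
have m0 : measurable_fun [set: R] (fun _ : R => 0 : R) by exact: measurable_cst.
have gmax (a : R) : Num.max a 0 <= `|a| by rewrite ge_max ler_norm normr_ge0.
have max0 (a : R) : 0 <= Num.max a 0 by rewrite le_max lexx orbT.
have mN : measurable_fun setT (fun x => 0 - g m x) by exact: measurable_funB.
have mNx : measurable_fun setT (fun w => 0 - g m (xi m w)) by exact: measurable_funB.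
pose gp x := Num.max (g m x) 0; pose gn x := Num.max (0 - g m x) 0.
have gpi : intble (fun w => gp (xi m w)).
  apply: le_intble (intble_norm gmi); first exact: measurable_maxr.
  by move=> w; rewrite ger0_norm ?max0//; exact: (gmax (g m _)).
have gni : intble (fun w => gn (xi m w)).
  apply: le_intble (intble_norm gmi); first exact: measurable_maxr.
  by move=> w; rewrite ger0_norm ?max0//; apply: le_trans (gmax (0 - g m _)) _; rewrite sub0r normrN.
have [pi1 pE] := part gp (measurable_maxr mgm m0) (fun x => max0 _) gpi.
have [ni nE] := part gn (measurable_maxr mN m0) (fun x => max0 _) gni.
have gE x : g m x = gp x - gn x.
  rewrite /gp /gn; case: (ltgtP (g m x) 0) => gx.
  - by rewrite max_l ?sub0r ?oppr_ge0 ?ltW// opprK.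
  - by rewrite max_r ?subr0// sub0r oppr_le0 ltW.
  - by rewrite gx subr0 maxxx subr0.
rewrite (_ : (fun w => _ * _) = (fun w => (\prod_(m <- s) g m (xi m w)) *
      (gp (xi m w) * \prod_(m <- t) h m (xi m w)) - (\prod_(m <- s) g m (xi m w)) *
      (gn (xi m w) * \prod_(m <- t) h m (xi m w)))); last first.
  by apply/funext => w; rewrite big_cons gE; ring.
split; first exact: intbleB.
rewrite meanB// pE nE big_cons.
have -> : mean (fun w => g m (xi m w)) = mean (fun w => gp (xi m w)) - mean (fun w => gn (xi m w)).
  by rewrite -meanB//; congr mean; apply/funext => w; rewrite gE.
by ring.
Qed.
End independence.

(** * Orthonormality and completeness of the chaos polynomials *)

Section Lnorm2.
Context d (T : measurableType d) (R : realType) (mu : {measure set T -> \bar R}).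

Lemma Lnorm2E (f : T -> R) :
  ('N[mu]_2%:E[EFin \o f] = (\int[mu]_x (f x ^+ 2)%:E) `^ 2^-1)%E.
Proof.
rewrite Lnorm.unlock; congr (_ `^ _)%E; apply: eq_integral => x _ /=.
by rewrite powR_mulrn// real_normK ?num_real.
Qed.

Lemma Lnorm2_lt (f : T -> R) (e : R) : ('N[mu]_2%:E[EFin \o f] < e%:E)%E ->
  (\int[mu]_x (f x ^+ 2)%:E < (e ^+ 2)%:E)%E.
Proof.
rewrite Lnorm2E.
have : (0 <= \int[mu]_x (f x ^+ 2)%:E)%E.
  by apply: integral_ge0 => x _; rewrite lee_fin sqr_ge0.
case: (\int[mu]_x _)%E => // [r|_]; last by rewrite poweRyr ?invr_eq0 ?pnatr_eq0.
rewrite lee_fin => r0; rewrite poweR_EFin powR12_sqrt// !lte_fin => re.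
have e0 : 0 < e := le_lt_trans (sqrtr_ge0 _) re.
by rewrite -(sqr_sqrtr r0) ltrXn2r// ?nnegrE ?sqrtr_ge0// ltW.
Qed.

Lemma Lnorm2_fin (f : T -> R) (r : R) : (\int[mu]_x (f x ^+ 2)%:E)%E = r%:E ->
  ('N[mu]_2%:E[EFin \o f])%E = (Num.sqrt r)%:E.
Proof.
move=> E; have : (0 <= \int[mu]_x (f x ^+ 2)%:E)%E.
  by apply: integral_ge0 => x _; rewrite lee_fin sqr_ge0.
by rewrite Lnorm2E E lee_fin => r0; rewrite poweR_EFin powR12_sqrt.
Qed.
End Lnorm2.

Section chaos.
Context d (T : measurableType d) (R : realType) (P : probability T R).
Context (xi : nat -> {RV P >-> R}) (xi_indep : independent xi).
Context (p : nat -> nat -> {poly R}) (p_0 : forall m, p m 0%N = 1).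
Context (p_cons : forall m, complete_orthonormal (distribution P (xi m)) (p m)).
Implicit Types (f g h : T -> R) (c : R) (a b : multi_index) (F : {fset multi_index}).
Local Notation mean := (mean P).
Local Notation intble := (intble P).
Local Notation sqint := (sqint P).
Local Notation msq := (msq P).
Local Notation Pa := (chaos_poly xi p).

Lemma measurable_horner_RV (Y : {RV P >-> R}) (q : {poly R}) :
  measurable_fun setT (fun w => q.[Y w]).
Proof.
have H1 : measurable_fun [set: R] (horner q) by exact: measurable_poly.
have H2 : measurable_fun [set: T] (Y : T -> R) by exact: measurable_funPT.
exact: (measurableT_comp H1 H2).
Qed.

(** Orthonormality on the diagonal says that the integral of a nonnegative function equals 1, hence
    is finite. *)
Lemma sqint_poly m k : sqint (fun w => (p m k).[xi m w]).
Proof.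
have mq : measurable_fun setT (fun w => (p m k).[xi m w]).
  exact: measurable_horner_RV.
split=> //; apply: ge0_intble => [|w|]; [exact: measurable_funX|exact: sqr_ge0|].
have := (p_cons m).1 k k; rewrite eqxx (ge0_integral_distribution (xi m)).
- move=> E; apply: (@le_lt_trans _ _ 1%:E); last exact: ltry.
  by rewrite -E.
- by apply/measurable_EFinP; apply: measurable_funM; exact: measurable_poly.
- by move=> y; rewrite lee_fin -expr2 sqr_ge0.
Qed.

Lemma mean_poly m k l :
  mean (fun w => (p m k).[xi m w] * (p m l).[xi m w]) = (k == l)%:R.
Proof.
have := (p_cons m).1 k l; rewrite integral_distribution => [E||].
- by rewrite /mean /Rintegral; apply: (congr1 fine E).
- by apply/measurable_EFinP; apply: measurable_funM; exact: measurable_poly.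
- exact: (sqintM (sqint_poly m k) (sqint_poly m l)).
Qed.

(** Indices outside the support contribute the factor [p m 0 = 1], so two chaos polynomials can be
    multiplied over one common finite set. *)
Lemma chaos_polyE (S : {fset nat}) a w : (finsupp a `<=` S)%fset ->
  Pa a w = \prod_(m <- S) (p m (a m)).[xi m w].
Proof.
move=> aS; apply: big_fset_incl => // m _; rewrite memNfinsupp => /eqP ->.
by rewrite p_0 hornerC.
Qed.

Lemma chaos_poly0 w : Pa [fsfun] w = 1.
Proof. by rewrite /chaos_poly finsupp0 big_seq_fset0. Qed.

Lemma mean_chaos_polyM a b :
  intble (fun w => Pa a w * Pa b w) /\ mean (fun w => Pa a w * Pa b w) = (a == b)%:R.
Proof.
pose S := (finsupp a `|` finsupp b)%fset.
have uS : uniq (S ++ [::]) by rewrite cats0 fset_uniq.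
pose g m x := (p m (a m)).[x] * (p m (b m)).[x].
have mg m : measurable_fun setT (g m) by apply: measurable_funM; exact: measurable_poly.
have gi m : m \in (S : seq nat) -> intble (fun w => g m (xi m w)).
  by move=> _; exact: (sqintM (sqint_poly m (a m)) (sqint_poly m (b m))).
(* A placeholder: the list [t] of nonnegative factors is empty here. *)
pose z (_ : nat) (_ : R) : R := 0.
have mz m : measurable_fun [set: R] (z m) by exact: measurable_cst.
have [//|i E] := @mean_prod_indep _ _ _ _ _ xi_indep _ _ g z uS mg mz (fun _ _ => lexx 0) gi.
move: i E.
rewrite (_ : (fun w => _ * _) = fun w => Pa a w * Pa b w); last first.
  apply/funext => w; rewrite big_nil mulr1 (@chaos_polyE S) ?fsubsetUl//.
  by rewrite (@chaos_polyE S b) ?fsubsetUr// -big_split.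
move=> i E; split => //; rewrite E big_nil mulr1.
under eq_bigr do rewrite mean_poly.
have [->|ab] := eqVneq a b; first by rewrite big1// => m _; rewrite eqxx.
(* The differing index lies in one of the supports, and its factor [(a m == b m)%:R] annihilates the
   product. *)
have [m abm] : exists m, a m != b m.
  apply: contrapT => ab'; move/eqP: ab; apply; apply/fsfunP => m; apply/eqP.
  by apply/negPn/negP => abm; apply: ab'; exists m.
have mS : m \in S.
  rewrite inE !mem_finsupp -negb_and; apply: contra abm => /andP[/eqP -> /eqP ->].
  by rewrite eqxx.
by rewrite (big_fsetD1 m)//= (negPf abm) mul0r.
Qed.

Lemma sqint_chaos_poly a : sqint (Pa a).
Proof.
split; last by have [i _] := mean_chaos_polyM a a; apply: eq_integrable i.
rewrite /chaos_poly; apply: measurable_prod => m _ /=.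
exact: measurable_horner_RV.
Qed.

Definition real_sum F (x : multi_index -> R) w : R := \sum_(a <- F) x a * Pa a w.

Definition fcoef f a : R := mean (fun w => f w * Pa a w).

Lemma sqint_real_sum F x : sqint (real_sum F x).
Proof. by apply: sqint_sum => a; apply: sqintZ; exact: sqint_chaos_poly. Qed.

Lemma fcoefB f g a : sqint f -> sqint g ->
  fcoef (fun w => f w - g w) a = fcoef f a - fcoef g a.
Proof. by move=> fs gs; apply: meanMBl => //; exact: sqint_chaos_poly. Qed.

Lemma fcoef_real_sum F x a : fcoef (real_sum F x) a = if a \in F then x a else 0.
Proof.
rewrite /fcoef /real_sum.
under eq_fun do rewrite mulr_suml.
rewrite mean_sum => [|b]; last first.
  by apply: sqintM; [apply: sqintZ|]; exact: sqint_chaos_poly.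
have E b : mean (fun w => x b * Pa b w * Pa a w) = x b * (b == a)%:R.
  by rewrite meanMZl ?(mean_chaos_polyM b a).2//; exact: sqint_chaos_poly.
under eq_bigr do rewrite E.
case: ifPn => aF.
  rewrite (big_fsetD1 a)//= eqxx mulr1 big_seq big1 ?addr0// => b.
  by rewrite !inE => /andP[/negPf -> _]; rewrite mulr0.
rewrite big_seq big1// => b bF; case: eqP => [ba|]; rewrite ?mulr0//.
by move: aF; rewrite -ba bF.
Qed.

Lemma mean_mul_real_sum f F x : sqint f ->
  mean (fun w => f w * real_sum F x w) = \sum_(a <- F) x a * fcoef f a.
Proof.
move=> fs; rewrite /real_sum; under eq_fun do rewrite mulr_sumr.
have fp b : sqint (fun w => x b * Pa b w) by apply: sqintZ; exact: sqint_chaos_poly.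
rewrite mean_sum => [|b]; last exact: sqintM.
apply: eq_bigr => b _; rewrite meanMC meanMZl// 1?meanMC//.
exact: sqint_chaos_poly.
Qed.

Lemma msq_real_sum F x : msq (real_sum F x) = \sum_(a <- F) x a ^+ 2.
Proof.
transitivity (mean (fun w => real_sum F x w * real_sum F x w)).
  by congr mean; apply/funext => w; rewrite expr2.
rewrite mean_mul_real_sum; last exact: sqint_real_sum.
rewrite big_seq [RHS]big_seq; apply: eq_bigr => a aF.
by rewrite fcoef_real_sum aF.
Qed.

Lemma msq_sub_real_sum f F x : sqint f ->
  msq (fun w => f w - real_sum F x w) =
  msq f + \sum_(a <- F) (x a ^+ 2 - 2 * x a * fcoef f a).
Proof.
move=> fs; have xs := sqint_real_sum F x.
have -> : (fun w => f w - real_sum F x w) = (fun w => f w + -1 * real_sum F x w).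
  by apply/funext => w; rewrite mulN1r.
rewrite msqD//; last exact: sqintZ.
rewrite msqZ// sqrrN expr1n mul1r meanMC meanMZl// (meanMC P (real_sum F x)).
rewrite msq_real_sum mean_mul_real_sum// -addrA; congr (_ + _).
rewrite big_split/= sumrN addrC; congr (_ + _); rewrite mulN1r mulrN mulr_sumr.
by congr (- _); apply: eq_bigr => a _; rewrite mulrA.
Qed.

(** With [y] the Fourier coefficient, an index contributes [x ^+ 2 - 2 * x * y], which is at least
    [- y ^+ 2], and a new index contributes [- y ^+ 2], which is at most 0. So Fourier sums are best
    approximations and improve as the index set grows. *)
Lemma bessel_le f F F' x : sqint f -> (F `<=` F')%fset ->
  msq (fun w => f w - real_sum F' (fcoef f) w) <= msq (fun w => f w - real_sum F x w).
Proof.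
move=> fs FF'; rewrite !msq_sub_real_sum// lerD2l.
pose h a := if a \in F then x a ^+ 2 - 2 * x a * fcoef f a else 0.
have -> : \sum_(a <- F) (x a ^+ 2 - 2 * x a * fcoef f a) = \sum_(a <- F') h a.
  rewrite -(big_fset_incl _ FF') => [|a _ aF]; last by rewrite /h (negPf aF).
  by rewrite big_seq [RHS]big_seq; apply: eq_bigr => a aF; rewrite /h aF.
apply: ler_sum => a _; rewrite /h; case: ifP => _.
  by have := sqr_ge0 (x a - fcoef f a); nra.
by have := sqr_ge0 (fcoef f a); nra.
Qed.

Lemma bessel f F : sqint f -> msq (real_sum F (fcoef f)) <= msq f.
Proof.
move=> fs; have := msq_ge0 P (fun w => f w - real_sum F (fcoef f) w).
rewrite msq_sub_real_sum// msq_real_sum -(subr_ge0 _ (msq f)).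
by congr (0 <= _ + _); rewrite -sumrN; apply: eq_bigr => a _; ring.
Qed.

(** The L^2 closure of the span of the [Pa a]. One approximating sum for each [e] is enough as a
    definition: [bessel_le] upgrades it to Fourier sums over all large index sets. *)
Definition in_chaos f := sqint f /\
  forall e : R, 0 < e -> exists F x, msq (fun w => f w - real_sum F x w) < e.

Lemma in_chaos_fourier f e : in_chaos f -> 0 < e -> exists F0 : {fset multi_index},
  forall F, (F0 `<=` F)%fset -> msq (fun w => f w - real_sum F (fcoef f) w) < e.
Proof.
move=> [fs fH] /fH[F0 [x fx]]; exists F0 => F F0F.
exact: le_lt_trans (bessel_le x fs F0F) fx.
Qed.

Lemma in_chaos_lim f : sqint f ->
  (forall e : R, 0 < e -> exists2 g, in_chaos g & msq (fun w => f w - g w) < e) ->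
  in_chaos f.
Proof.
move=> fs H; split=> // e e0; have e4 : 0 < e / 4 by rewrite divr_gt0.
have [g [gs gH] fg] := H _ e4; have [F [x gx]] := gH _ e4; exists F, x.
have -> : (fun w => f w - real_sum F x w) = 
    (fun w => (f w - g w) + (g w - real_sum F x w)).
  by apply/funext => w; ring.
have /le_lt_trans := msqD_le (sqintB fs gs) (sqintB gs (sqint_real_sum F x)).
by apply; lra.
Qed.

Lemma in_chaosD f g : in_chaos f -> in_chaos g -> in_chaos (fun w => f w + g w).
Proof.
move=> fH gH; have [fs _] := fH; have [gs _] := gH; split; first exact: sqintD.
move=> e e0; have e4 : 0 < e / 4 by rewrite divr_gt0.
have [F1 H1] := in_chaos_fourier fH e4; have [F2 H2] := in_chaos_fourier gH e4.
pose F := (F1 `|` F2)%fset; exists F, (fun a => fcoef f a + fcoef g a).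
have -> : (fun w => f w + g w - real_sum F (fun a => fcoef f a + fcoef g a) w) =
    (fun w => (f w - real_sum F (fcoef f) w) + (g w - real_sum F (fcoef g) w)).
  apply/funext => w; rewrite /real_sum; under eq_bigr do rewrite mulrDl.
  by rewrite big_split/=; ring.
have /le_lt_trans := msqD_le (sqintB fs (sqint_real_sum F (fcoef f)))
  (sqintB gs (sqint_real_sum F (fcoef g))).
have num (r s : R) : r < e / 4 -> s < e / 4 -> 2 * r + 2 * s < e by lra.
by apply; apply: num; [exact: H1 (fsubsetUl _ _)|exact: H2 (fsubsetUr _ _)].
Qed.

Lemma in_chaosZ c f : in_chaos f -> in_chaos (fun w => c * f w).
Proof.
move=> [fs fH]; split; first exact: sqintZ.
(* [c ^+ 2 + 1] instead of [c ^+ 2] covers [c = 0]. *)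
move=> e e0; have c1 : 0 < c ^+ 2 + 1 by rewrite ltr_pwDr// sqr_ge0.
have [F [x fx]] := fH _ (divr_gt0 e0 c1); exists F, (fun a => c * x a).
have -> : (fun w => c * f w - real_sum F (fun a => c * x a) w) =
    (fun w => c * (f w - real_sum F x w)).
  apply/funext => w; rewrite /real_sum mulrBr mulr_sumr; congr (_ - _).
  by apply: eq_bigr => a _; rewrite mulrA.
rewrite msqZ; last exact: sqintB fs (sqint_real_sum F x).
move: fx; rewrite ltr_pdivlMr// mulrC; apply: le_lt_trans.
by rewrite ler_wpM2r ?msq_ge0// lerDl.
Qed.

Lemma in_chaos_poly a : in_chaos (Pa a).
Proof.
split; first exact: sqint_chaos_poly.
move=> e e0; exists [fset a]%fset, (fun=> 1).
have E : (fun w => Pa a w - real_sum [fset a]%fset (fun=> 1) w) = fun=> 0.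
  by apply/funext => w; rewrite /real_sum big_seq_fset1 mul1r subrr.
by rewrite E /msq mean_cst expr0n.
Qed.

Lemma in_chaos_cst c : in_chaos (fun=> c).
Proof.
rewrite (_ : (fun=> c) = fun w => c * Pa [fsfun] w).
  exact/in_chaosZ/in_chaos_poly.
by apply/funext => w; rewrite chaos_poly0 mulr1.
Qed.

Lemma in_chaosB f g : in_chaos f -> in_chaos g -> in_chaos (fun w => f w - g w).
Proof.
move=> fH gH; have := in_chaosD fH (in_chaosZ (-1) gH); congr in_chaos.
by apply/funext => w; rewrite mulN1r.
Qed.

Lemma in_chaos_sum (I : Type) (s : seq I) (h : I -> T -> R) :
  (forall i, in_chaos (h i)) -> in_chaos (fun w => \sum_(i <- s) h i w).
Proof.
move=> hi; elim: s => [|i s IH].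
  by rewrite (_ : (fun _ => _) = fun=> 0); [exact: in_chaos_cst|apply/funext => w; rewrite big_nil].
rewrite (_ : (fun _ => _) = fun w => h i w + \sum_(i <- s) h i w); first exact: in_chaosD.
by apply/funext => w; rewrite big_cons.
Qed.

End chaos.

(** * Dominated convergence in mean square *)

Section dominated.
Context d (T : measurableType d) (R : realType) (P : probability T R).
Implicit Types (f g h : T -> R) (c : R).

Lemma mean_dominated_cvg0 (h_ : nat -> T -> R) g :
  (forall n, measurable_fun setT (h_ n)) -> intble P g ->
  (forall n w, `|h_ n w| <= g w) ->
  {ae P, forall w, h_ n w @[n --> \oo] --> (0 : R)} ->
  mean P (h_ n) @[n --> \oo] --> (0 : R).
Proof.
move=> mh gi hg h0.
have hi n : intble P (h_ n) by exact: le_intble gi.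
have [|||||] := @dominated_convergence _ _ _ P _ measurableT
  (fun n w => (h_ n w)%:E) (cst 0%E) (EFin \o g).
- by move=> n; apply/measurable_EFinP.
- exact: measurable_cst.
- apply: filterS h0 => w h0 _; apply/cvg_EFin; first exact: nearW.
  exact: h0.
- exact: gi.
- by apply: nearW => w n _ /=; rewrite lee_fin.
move=> _ _; rewrite integral0.
under eq_fun do rewrite mean_EFin//.
by move=> /fine_cvgP[_].
Qed.

Lemma msq_dominated_cvg (f_ : nat -> T -> R) f g :
  (forall n, measurable_fun setT (f_ n)) -> sqint P g ->
  (forall n w, `|f_ n w| <= g w) -> (forall w, f_ n w @[n --> \oo] --> f w) ->
  sqint P f /\ msq P (fun w => f w - f_ n w) @[n --> \oo] --> (0 : R).
Proof.
move=> mf gs fg fcvg.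
have f_g w : `|f w| <= g w.
  have /(cvgr_to_le) : `|f_ n w| @[n --> \oo] --> `|f w| by apply: cvg_norm; exact: fcvg.
  by apply; apply: nearW => n; exact: fg.
have sq_le (x y : R) : `|x| <= y -> x ^+ 2 <= y ^+ 2.
  by move=> xy; rewrite -(real_normK (num_real x)) lerXn2r ?nnegrE// (le_trans _ xy).
have mf' : measurable_fun setT f by apply: measurable_fun_cvg => // w _; exact: fcvg.
have fs : sqint P f.
  by apply: (le_sqint mf' _ (sqint_sq gs)) => w; exact: sq_le.
(* The dominating function: (f - f_n)^2 <= 2 f^2 + 2 f_n^2 <= 4 g^2. *)
split=> //; have gi := intbleZ 4 (sqint_sq gs).
apply: (mean_dominated_cvg0 _ gi) => [n|n w|].
- by apply: measurable_funX; exact: measurable_funB.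
- rewrite ger0_norm ?sqr_ge0//; have := sq_le _ _ (f_g w); have := sq_le _ _ (fg n w).
  by have := sqr_ge0 (f w + f_ n w); nra.
apply: nearW => w.
have : f w - f_ n w @[n --> \oo] --> (0 : R).
  by rewrite -(subrr (f w)); apply: cvgB; [exact: cvg_cst|exact: fcvg].
by move=> c0; rewrite -[X in _ --> X](mulr0 (0 : R)); exact: (cvgM c0 c0).
Qed.

End dominated.

(** * Completeness of the multivariate chaos in L^2(sigma(xi)) *)

Section completeness.
Context d (T : measurableType d) (R : realType) (P : probability T R).
Context (xi : nat -> {RV P >-> R}) (xi_indep : independent xi).
Context (p : nat -> nat -> {poly R}) (p_0 : forall m, p m 0%N = 1).
Context (p_cons : forall m, complete_orthonormal (distribution P (xi m)) (p m)).
Implicit Types (a b : multi_index) (F : {fset multi_index}).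
Local Notation Pa := (chaos_poly xi p).
Local Notation in_chaos := (in_chaos xi p).
Let spa := sqint_chaos_poly xi_indep p_0 p_cons.

Lemma in_chaos_dominated (f_ : nat -> T -> R) f g :
  (forall n, in_chaos (f_ n)) -> sqint P g ->
  (forall n w, `|f_ n w| <= g w) -> (forall w, f_ n w @[n --> \oo] --> f w) ->
  in_chaos f.
Proof.
move=> fH gs fg fcvg.
have mf n : measurable_fun setT (f_ n) by have [[]] := fH n.
have [fs cv] := msq_dominated_cvg mf gs fg fcvg.
apply: (in_chaos_lim xi_indep p_0 p_cons) => // e e0.
have /cvgr0_norm_lt /(_ e e0) [N _ HN] := cv.
by exists (f_ N) => //; have := HN N (leqnn N); rewrite ger0_norm ?msq_ge0.
Qed.

Lemma indic_poly_approx m (B : set R) (e : R) : measurable B -> 0 < e ->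
  exists (k : nat) (x : nat -> R),
    let q y := \1_B y - \sum_(i < k) x i * (p m i).[y] in
    intble P (fun w => q (xi m w) ^+ 2) /\ mean P (fun w => q (xi m w) ^+ 2) < e.
Proof.
move=> mB e0.
have mI : measurable_fun [set: R] (\1_B : R -> R) by exact: measurable_indic.
have fin : ('N[distribution P (xi m)]_2%:E[EFin \o (\1_B : R -> R)] < +oo)%E.
  rewrite Lnorm2E poweR_lty//.
  apply: (@le_lt_trans _ _ (\int[distribution P (xi m)]_x (cst 1 x)))%E; last first.
    by rewrite integral_cst//= mul1e probability_setT ltry.
  apply: ge0_le_integral => //.
  - by apply/measurable_EFinP; exact: measurable_funX.
  - by move=> x _; rewrite lee_fin indicE; case: (_ \in _); rewrite ?expr1n// expr0n.
have se : 0 < Num.sqrt e by rewrite sqrtr_gt0.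
have [k [x H]] := (p_cons m).2 _ mI fin _ se; exists k, x => q.
have mq : measurable_fun [set: R] q.
  apply: measurable_funB => //; apply: measurable_sum => i.
  by apply: measurable_funM => //; exact: measurable_poly.
have mqx : measurable_fun setT (fun w => q (xi m w)).
  exact: (measurableT_comp mq (measurable_funPT (xi m))).
have {H} : (\int[P]_w (q (xi m w) ^+ 2)%:E < e%:E)%E.
  move/Lnorm2_lt: H; rewrite sqr_sqrtr ?(ltW e0)// (ge0_integral_distribution (xi m))//.
  - by apply/measurable_EFinP; exact: measurable_funX.
  - by move=> y; rewrite lee_fin sqr_ge0.
move=> qe.
have qi : intble P (fun w => q (xi m w) ^+ 2).
  apply: ge0_intble => [|w|]; [exact: measurable_funX|exact: sqr_ge0|].
  by rewrite (lt_trans qe)// ltry.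
by split => //; move: qe; rewrite mean_EFin// lte_fin.
Qed.

Lemma chaos_poly_with b m k w : m \notin finsupp b ->
  Pa [fsfun b with m |-> k] w = (p m k).[xi m w] * Pa b w.
Proof.
move=> mb; pose S := (m |` finsupp b)%fset.
rewrite (@chaos_polyE _ _ _ _ xi p p_0 S); last first.
  apply/fsubsetP => j; rewrite mem_finsupp fsfun_withE !inE mem_finsupp.
  by case: (j == m).
rewrite big_fsetU1//= fsfun_withE eqxx; congr (_ * _).
rewrite /chaos_poly big_seq [RHS]big_seq; apply: eq_bigr => j jb.
by rewrite fsfun_withE; case: eqP jb mb => // -> ->.
Qed.

(** [Pa b ^+ 2] has mean 1 and involves only variables other than [xi m], so as a weight it leaves
    the mean of [q (xi m w)] unchanged. *)
Lemma mean_indep_chaos_polyM m b (q : R -> R) : m \notin finsupp b ->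
  measurable_fun setT q -> (forall x, 0 <= q x) -> intble P (fun w => q (xi m w)) ->
  intble P (fun w => q (xi m w) * Pa b w ^+ 2) /\
  mean P (fun w => q (xi m w) * Pa b w ^+ 2) = mean P (fun w => q (xi m w)).
Proof.
move=> mb mq q0 qi.
pose s : seq nat := m :: finsupp b.
have us : uniq ([::] ++ s) by rewrite /= mb fset_uniq.
pose h j := if j == m then q else fun x => (p j (b j)).[x] ^+ 2.
have mh j : measurable_fun [set: R] (h j).
  rewrite /h; case: ifP => // _; apply: measurable_funX; exact: measurable_poly.
have h0 j x : 0 <= h j x by rewrite /h; case: ifP => // _; exact: sqr_ge0.
have hi j : j \in s -> intble P (fun w => h j (xi j w)).
  move=> _; rewrite /h; case: eqP => [->//|_].
  exact: sqint_sq (sqint_poly p_cons j (b j)).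
have hb (C : (R -> R) -> nat -> R) :
    \prod_(j <- finsupp b) C (h j) j = \prod_(j <- finsupp b) C (fun x => (p j (b j)).[x] ^+ 2) j.
  rewrite big_seq [RHS]big_seq; apply: eq_bigr => j jb.
  by rewrite /h; case: eqP jb mb => // -> ->.
have [//|i E] := @mean_prod_indep _ _ _ _ _ xi_indep [::] s h h us mh mh h0 _ hi.
have WE : (fun w => (\prod_(j <- [::]) h j (xi j w)) * \prod_(j <- s) h j (xi j w)) =
    (fun w => q (xi m w) * Pa b w ^+ 2).
  apply/funext => w; rewrite big_nil mul1r big_cons (hb (fun h j => h (xi j w))) /=.
  by rewrite {1}/h eqxx /chaos_poly prodrXl.
rewrite WE in i E; split=> //; rewrite E big_nil mul1r big_cons.
rewrite (hb (fun h j => mean P (fun w => h (xi j w)))) {1}/h eqxx big1 ?mulr1// => j _.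
by have := mean_poly p_cons j (b j) (b j); rewrite eqxx; apply.
Qed.

(** The factor [Pa b] makes the induction close: when the indicator of one [xi m] is approximated by
    a polynomial, the terms [p m i] are absorbed into [Pa b] because [m] lies outside its support.
    The other indicators are at most 1, so the error is that of the univariate approximation. *)
Lemma in_chaos_rectangle_poly (s : seq nat) (B : nat -> set R) b :
  uniq s -> (forall m, measurable (B m)) -> (forall m, m \in s -> m \notin finsupp b) ->
  in_chaos (fun w => (\prod_(m <- s) \1_(B m) (xi m w)) * Pa b w).
Proof.
move=> + mB; elim: s b => [|m s IH] b us sb.
  rewrite (_ : (fun w => _) = Pa b); first exact: in_chaos_poly.
  by apply/funext => w; rewrite big_nil mul1r.
have /= /andP[ms us'] := us.
have mb : m \notin finsupp b by apply: sb; rewrite mem_head.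
pose I w : R := \prod_(m <- s) \1_(B m) (xi m w).
have mI1 j : measurable_fun setT (fun w => \1_(B j) (xi j w) : R).
  have H1 : measurable_fun [set: R] (\1_(B j) : R -> R) by exact: measurable_indic.
  exact: (measurableT_comp H1 (measurable_funPT (xi j))).
have indic01 (B' : set R) x : 0 <= (\1_B' x : R) <= 1.
  by rewrite indicE; case: (_ \in _); rewrite lexx ler01.
have mI : measurable_fun setT I by apply: measurable_prod => j _; exact: mI1.
have I01 w : 0 <= I w <= 1.
  rewrite /I; apply: (big_ind (fun x => 0 <= x <= 1)) => [|x y|j _].
  - by rewrite ler01 lexx.
  - by move=> /andP[x0 x1] /andP[y0 y1]; rewrite mulr_ge0// mulr_ile1.
  - exact: indic01.
have mPa := sqint_mfun (spa b).
have fE : (fun w => (\prod_(j <- m :: s) \1_(B j) (xi j w)) * Pa b w) =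
    (fun w => \1_(B m) (xi m w) * (I w * Pa b w)).
  by apply/funext => w; rewrite big_cons mulrA.
rewrite fE; apply: (in_chaos_lim xi_indep p_0 p_cons).
  apply: (le_sqint _ _ (sqint_sq (spa b))).
    by apply: measurable_funM => //; exact: measurable_funM.
  move=> w; have /andP[a0 a1] := indic01 (B m) (xi m w); have /andP[b0 b1] := I01 w.
  by rewrite mulrA exprMn ler_piMl ?sqr_ge0// expr_le1 ?mulr_ge0 ?mulr_ile1.
move=> e e0; have [k [x]] := indic_poly_approx m (mB m) e0.
set q := fun y => _; move=> /= [qi qe].
exists (fun w => (\sum_(i < k) x i * (p m i).[xi m w]) * (I w * Pa b w)).
  have -> : (fun w => (\sum_(i < k) x i * (p m i).[xi m w]) * (I w * Pa b w)) =
      (fun w => \sum_(i < k) x i * (I w * Pa [fsfun b with m |-> val i] w)).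
    apply/funext => w; rewrite mulr_suml; apply: eq_bigr => i _.
    by rewrite chaos_poly_with//; ring.
  apply: (in_chaos_sum xi_indep p_0 p_cons) => i.
  apply: (in_chaosZ xi_indep p_0 p_cons); apply: IH => // j js.
  rewrite mem_finsupp fsfun_withE ifN; last by apply: contraNneq ms => <-.
  by rewrite -mem_finsupp sb// inE js orbT.
have mq : measurable_fun [set: R] q.
  apply: measurable_funB; first exact: measurable_indic.
  apply: measurable_sum => i.
  by apply: measurable_funM => //; exact: measurable_poly.
have mq2 : measurable_fun [set: R] (fun y => q y ^+ 2) by exact: measurable_funX.
have [qPi qPE] := mean_indep_chaos_polyM mb mq2 (fun y => sqr_ge0 (q y)) qi.
apply: le_lt_trans qe; rewrite -qPE.
have mqx : measurable_fun setT (fun w => q (xi m w)).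
  exact: (measurableT_comp mq (measurable_funPT (xi m))).
have dE w : (\1_(B m) (xi m w) * (I w * Pa b w) -
    (\sum_(i < k) x i * (p m i).[xi m w]) * (I w * Pa b w)) ^+ 2 =
    I w ^+ 2 * (q (xi m w) ^+ 2 * Pa b w ^+ 2).
  by rewrite /q; ring.
rewrite /msq; under eq_fun do rewrite dE.
have le w : I w ^+ 2 * (q (xi m w) ^+ 2 * Pa b w ^+ 2) <= q (xi m w) ^+ 2 * Pa b w ^+ 2.
  have I2 : I w ^+ 2 <= 1 by case/andP: (I01 w) => a0 a1; rewrite expr_le1.
  by rewrite ler_piMl//; apply: mulr_ge0; exact: sqr_ge0.
apply: le_mean => //; apply: (le_intble _ _ qPi).
  apply: measurable_funM; first exact: measurable_funX.
  by apply: measurable_funM; exact: measurable_funX.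
by move=> w; rewrite ger0_norm ?le//; apply: mulr_ge0; [exact: sqr_ge0|apply: mulr_ge0; exact: sqr_ge0].
Qed.

(** The finite-dimensional cylinder sets of [xi], a pi-system generating sigma(xi). *)
Definition rectangles : set (set T) := [set A | exists (F : {fset nat}) (B : nat -> set R),
  (forall m, measurable (B m)) /\ A = \bigcap_(m in [set` F]) (xi m @^-1` B m)].

Lemma rectanglesI : setI_closed rectangles.
Proof.
move=> _ _ [F [B [mB ->]]] [F' [B' [mB' ->]]].
exists (F `|` F')%fset, (fun m => (if m \in F then B m else setT) `&`
  (if m \in F' then B' m else setT)); split.
  by move=> m; apply: measurableI; case: ifP.
apply/seteqP; split => [w [wB wB'] m /=|w wBB].
  by move=> _; split; case: ifP => // mF; [exact: wB|exact: wB'].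
split=> m /= mF.
  have [|] := wBB m; first by rewrite /= inE mF.
  by rewrite mF.
have [|_] := wBB m; first by rewrite /= inE mF orbT.
by rewrite mF.
Qed.

Lemma in_chaos_rectangle A : rectangles A -> in_chaos (\1_A).
Proof.
move=> [F [B [mB ->]]].
have := @in_chaos_rectangle_poly F B [fsfun] (fset_uniq _) mB.
rewrite finsupp0 => /(_ (fun _ _ => isT)); congr in_chaos.
apply/funext => w; rewrite chaos_poly0 mulr1 indicE.
have [wA|wA] := boolP (_ \in _).
  rewrite big_seq big1// => m mF; rewrite indicE mem_set//.
  by move: wA; rewrite inE; apply.
have /existsNP[m /not_implyP[mF Bm]] :
    ~ (\bigcap_(m in [set` F]) (xi m @^-1` B m)) w.
  by move=> Aw; move: wA; rewrite mem_set.
by rewrite (big_fsetD1 m)//= indicE memNset ?mul0r.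
Qed.

Lemma measurable_rectangle A : rectangles A -> measurable A.
Proof.
move=> [F [B [mB ->]]]; apply: fin_bigcap_measurable => // m _.
exact: measurable_funPTI.
Qed.

(** Dynkin's argument: the sets whose indicator lies in the closed span contain the pi-system, are
    stable under complements since constants are in the span, and under countable disjoint unions by
    dominated convergence with bound 1. *)
Lemma in_chaos_indic A : <<s rectangles >> A -> in_chaos (\1_A).
Proof.
pose Q : set_system (g_sigma_algebraType rectangles) := [set A | in_chaos (\1_A)].
have sM B : <<s rectangles >> B -> measurable B.
  apply: smallest_sub; first exact: sigma_algebra_measurable.
  exact: measurable_rectangle.
move=> sA; apply: (@dynkin_induction _ (g_sigma_algebraType rectangles) rectangles Q) => //.
- exact: rectanglesI.
- rewrite /Q/= (_ : \1_setT = fun=> 1); first exact: in_chaos_cst.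
  by apply/funext => w; rewrite indicE in_setT.
- exact: in_chaos_rectangle.
- move=> S mS; rewrite /Q/= => SH.
  rewrite (_ : \1_(~` S) = fun w => 1 - \1_S w).
    by apply: in_chaosB => //; exact: in_chaos_cst.
  by apply/funext => w; rewrite !indicE in_setC; case: (_ \in _); rewrite ?subrr ?subr0.
move=> F mF tF HF; rewrite /Q/=.
pose U n := \big[setU/set0]_(i < n) F i.
apply: (@in_chaos_dominated (fun n => \1_(U n)) _ (fun=> 1)).
- elim=> [|n IH].
    rewrite /U big_ord0 (_ : \1_set0 = fun=> 0); first exact: in_chaos_cst.
    by apply/funext => w; rewrite indicE in_set0.
  rewrite (_ : \1_(U n.+1) = fun w => \1_(U n) w + \1_(F n) w).
    exact: (in_chaosD xi_indep p_0 p_cons IH (HF n)).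
  apply/funext => w; rewrite /U big_ord_recr/= !indicE in_setU.
  have [wU|] := boolP (_ \in \big[setU/set0]_(i < n) F i); last by rewrite add0r.
  rewrite memNset ?addr0// => wF.
  move: wU; rewrite inE -bigcup_mkord => -[i /= ni Fi].
  by have := tF i n I I (ex_intro _ w (conj Fi wF)) => ie; rewrite ie ltnn in ni.
- exact: sqint_cst.
- by move=> n w; rewrite indicE; case: (_ \in _); rewrite ?normr1 ?normr0.
move=> w; have [[i _ Fi]|nF] := pselect ((\bigcup_k F k) w).
  apply: cvg_near_cst; exists i.+1 => // n /= ni.
  rewrite !indicE !mem_set//; first by exists i.
  by rewrite /U -bigcup_mkord; exists i.
apply: cvg_near_cst; apply: nearW => n.
rewrite !indicE !memNset//.
by rewrite /U -bigcup_mkord => -[i _ Fi]; apply: nF; exists i.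
Qed.

(** Measurability for sigma(xi) puts the level sets of the approximating simple functions into
    sigma(xi). For a nonnegative function these approximants are dominated by the function itself;
    the general case splits into positive and negative parts. *)
Lemma in_chaos_measurable (f : T -> R) :
  measurable_fun setT (f : g_sigma_algebraType rectangles -> R) -> sqint P f ->
  in_chaos f.
Proof.
have nonneg (g : T -> R) : measurable_fun setT (g : g_sigma_algebraType rectangles -> R) ->
    (forall w, 0 <= g w) -> sqint P g -> in_chaos g.
  move=> mg g0 gs.
  have mge : measurable_fun [set: g_sigma_algebraType rectangles] (EFin \o g).
    exact/measurable_EFinP.
  pose g_ := nnsfun_approx measurableT mge.
  have g_cvg x : g_ n x @[n --> \oo] --> g x.
    have /fine_cvgP[_] := @cvg_nnsfun_approx _ _ _ _ measurableT _ mge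
      (fun x _ => g0 x : (0 <= (EFin \o g) x)%E) x I.
    exact.
  have g_nd x : {homo (fun n => g_ n x) : m n / (m <= n)%N >-> m <= n}.
    by move=> m n mn; have := nd_nnsfun_approx measurableT mge mn => /lefP; exact.
  apply: (@in_chaos_dominated (fun n w => g_ n w) g g) => //.
  - move=> n; rewrite (_ : (fun w => _) = fun w =>
      \sum_(y <- fset_set (range (g_ n))) y * \1_(g_ n @^-1` [set y]) w).
      apply: (in_chaos_sum xi_indep p_0 p_cons) => y.
      apply: (in_chaosZ xi_indep p_0 p_cons); apply: in_chaos_indic.
      exact: (measurable_sfunP (g_ n)).
    by apply/funext => w; rewrite fimfunE fsbig_finite.
  - move=> n w; rewrite ger0_norm//.
    have /cvgr_to_ge : g_ m w @[m --> \oo] --> g w by exact: g_cvg.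
    by apply; exists n => // m /= nm; exact: g_nd.
move=> mf fs.
have m0 : measurable_fun setT ((fun=> 0) : g_sigma_algebraType rectangles -> R).
  exact: measurable_cst.
have mf' := sqint_mfun fs.
have max0 (a : R) : 0 <= Num.max a 0 by rewrite le_max lexx orbT.
have maxs (g : T -> R) : sqint P g -> sqint P (fun w => Num.max (g w) 0).
  move=> gs; apply: (le_sqint _ _ (sqint_sq gs)).
    by apply: measurable_maxr; [exact: sqint_mfun gs|exact: measurable_cst].
  by move=> w; case: (leP (g w) 0) => _; rewrite ?expr0n ?sqr_ge0.
have -> : f = (fun w => Num.max (f w) 0 - Num.max (0 - f w) 0).
  apply/funext => w; case: (ltgtP (f w) 0) => gx.
  - by rewrite max_l ?sub0r ?oppr_ge0 ?ltW// opprK.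
  - by rewrite max_r ?subr0// sub0r oppr_le0 ltW.
  - by rewrite gx subr0 maxxx subr0.
apply: (in_chaosB xi_indep p_0 p_cons); apply: nonneg => //.
- exact: measurable_maxr.
- exact: maxs.
- by apply: measurable_maxr => //; exact: measurable_funB.
- by apply: maxs; apply: sqintB => //; exact: sqint_cst.
Qed.

End completeness.

(** * Strong measurability *)

Section finite_measurable.
Context d (T : measurableType d).

(** The condition of [is_simple] with an arbitrary type as target: pairs and booleans are allowed,
    so combinations of simple functions reduce to composition. *)
Definition finmeas S (s : T -> S) : Prop :=
  finite_set (range s) /\ forall v, measurable (s @^-1` [set v]).

Lemma finmeas_preimage S (s : T -> S) (A : set S) : finmeas s -> measurable (s @^-1` A).
Proof.
move=> [fs ms].
have -> : s @^-1` A = \bigcup_(v in range s `&` A) (s @^-1` [set v]).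
  apply/seteqP; split => [w Aw|w [v [_ Av] /= ->]//].
  by exists (s w) => //; split => //; exists w.
apply: fin_bigcup_measurable; last by move=> v _; exact: ms.
by apply: sub_finite_set fs => v [].
Qed.

Lemma finmeas_cst S (v : S) : finmeas (fun=> v).
Proof.
split.
  by apply: (@sub_finite_set _ _ [set v]) => // _ [w _ <-].
move=> u; have [->|uv] := pselect (v = u).
  by rewrite (_ : _ @^-1` _ = setT) //; apply/seteqP; split.
by rewrite (_ : _ @^-1` _ = set0) //; apply/seteqP; split.
Qed.

Lemma finmeas_comp S S' (phi : S -> S') (s : T -> S) :
  finmeas s -> finmeas (fun w => phi (s w)).
Proof.
move=> sf; split.
  apply: (@sub_finite_set _ _ (phi @` range s)); last exact: finite_image sf.1.
  by move=> _ [w _ <-]; exists (s w) => //; exists w.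
by move=> v; exact: (finmeas_preimage (phi @^-1` [set v]) sf).
Qed.

Lemma finmeas_pair S S' (s : T -> S) (s' : T -> S') :
  finmeas s -> finmeas s' -> finmeas (fun w => (s w, s' w)).
Proof.
move=> sf sf'; split.
  apply: (@sub_finite_set _ _ (range s `*` range s')).
    by move=> _ [w _ <-]; split; exists w.
  exact: finite_setX sf.1 sf'.1.
move=> [v v']; rewrite (_ : _ @^-1` _ = s @^-1` [set v] `&` s' @^-1` [set v']).
  by apply: measurableI; [exact: sf.2|exact: sf'.2].
by apply/seteqP; split => w /= [-> ->].
Qed.

Lemma finmeas_fun_if S (s s' : T -> S) (D : set T) : measurable D ->
  finmeas s -> finmeas s' -> finmeas (fun w => if w \in D then s w else s' w).
Proof.
move=> mD sf sf'.
have Df : finmeas (fun w => w \in D).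
  split; first by apply: (@sub_finite_set _ _ setT) => //; exact: finite_finset.
  move=> [].
    rewrite (_ : _ @^-1` _ = D)//.
    by apply/seteqP; split => w /=; [exact: set_mem|exact: mem_set].
  rewrite (_ : _ @^-1` _ = ~` D); first exact: measurableC.
  apply/seteqP; split => w /= => [/negbT wD Dw|]; last exact: memNset.
  by move: wD; rewrite mem_set.
exact: (finmeas_comp (fun q : bool * (S * S) => if q.1 then q.2.1 else q.2.2)
  (finmeas_pair Df (finmeas_pair sf sf'))).
Qed.

Lemma finmeas_measurable d' (S : measurableType d') (s : T -> S) :
  finmeas s -> measurable_fun setT s.
Proof. by move=> sf _ B _; rewrite setTI; exact: finmeas_preimage. Qed.

End finite_measurable.

Lemma continuous_borel_measurable (R : realType) (V : ptopologicalType) (phi : V -> R) :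
  continuous phi -> measurable_fun [set: borel V] (phi : borel V -> R).
Proof.
move=> cphi; apply: (measurability _ (RGenOInfty.measurableE R)) => _ /= -[_ [r ->] <-].
rewrite setTI; apply: sub_sigma_algebra.
by move/continuousP : cphi; apply; exact: interval_open.
Qed.

Section strongly_measurable.
Context d (T : measurableType d).

(* Unlike Borel measurability, this is stable under sums and continuous maps
   without separability of the target. *)
Definition smeas (V : topologicalType) (f : T -> V) : Prop :=
  exists s : nat -> T -> V, (forall k, finmeas (s k)) /\
    forall w, s k w @[k --> \oo] --> f w.

Lemma smeas_cst (V : topologicalType) (v : V) : smeas (fun=> v).
Proof.
by exists (fun _ _ => v); split => [k|w]; [exact: finmeas_cst|exact: cvg_cst].
Qed.

(** Simple approximants of [f] and [g] are paired pointwise, and joint sequential continuity of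
    [phi] passes to the limit. Instances are sums, scalings and inner products. *)
Lemma smeas_op2 (V W Z : topologicalType) (phi : V -> W -> Z) (f : T -> V) (g : T -> W) :
  (forall u v a b, u n @[n --> \oo] --> a -> v n @[n --> \oo] --> b ->
     phi (u n) (v n) @[n --> \oo] --> phi a b) ->
  smeas f -> smeas g -> smeas (fun w => phi (f w) (g w)).
Proof.
move=> phiC [s [sf sc]] [t [tf tc]]; exists (fun k w => phi (s k w) (t k w)); split.
  by move=> k; exact: (finmeas_comp (fun q => phi q.1 q.2) (finmeas_pair (sf k) (tf k))).
by move=> w; exact: phiC.
Qed.

Lemma smeas_comp (V W : topologicalType) (phi : V -> W) (f : T -> V) :
  continuous phi -> smeas f -> smeas (fun w => phi (f w)).
Proof.
move=> phiC [s [sf sc]]; exists (fun k w => phi (s k w)); split.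
  by move=> k; exact: finmeas_comp.
by move=> w; apply: continuous_cvg; [exact: phiC|exact: sc].
Qed.

Variable R : realType.

Lemma smeas_measurable (f : T -> R) : smeas f -> measurable_fun setT f.
Proof.
move=> [s [sf sc]]; apply: (@measurable_fun_cvg _ _ _ _ s) => [k|w _]; last exact: sc.
exact: finmeas_measurable.
Qed.

Lemma measurable_smeas (f : T -> R) : measurable_fun setT f -> smeas f.
Proof.
move=> mf; have mfe : measurable_fun setT (EFin \o f) by exact/measurable_EFinP.
have [g gc] := approximation_sfun measurableT mfe.
exists (fun k w => g k w); split.
  move=> k; split; first exact: fimfunP.
  by move=> v; exact: measurable_sfunP.
by move=> w; have /fine_cvgP[_] := gc w I.
Qed.

Section normed.
Variable V : normedModType R.
Implicit Types f g : T -> V.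

Lemma smeasD f g : smeas f -> smeas g -> smeas (fun w => f w + g w).
Proof. by apply: (@smeas_op2 V V V +%R) => u v a b uc vc; exact: cvgD. Qed.

Lemma smeasB f g : smeas f -> smeas g -> smeas (fun w => f w - g w).
Proof. by apply: (@smeas_op2 V V V (fun x y => x - y)) => u v a b uc vc; exact: cvgB. Qed.

Lemma smeasZ (f : T -> R) g : smeas f -> smeas g -> smeas (fun w => f w *: g w).
Proof. by apply: (@smeas_op2 R V V *:%R) => u v a b uc vc; exact: cvgZ. Qed.

Lemma smeas_sum (I : Type) (s : seq I) (h : I -> T -> V) :
  (forall i, smeas (h i)) -> smeas (fun w => \sum_(i <- s) h i w).
Proof.
move=> hi; elim: s => [|i s IH].
  by rewrite (_ : (fun _ => _) = fun=> 0); [exact: smeas_cst|apply/funext => w; rewrite big_nil].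
rewrite (_ : (fun _ => _) = fun w => h i w + \sum_(i <- s) h i w); first exact: smeasD.
by apply/funext => w; rewrite big_cons.
Qed.

(** [f w] lies in the open set [A] iff, for some radius, the balls of that radius around all but
    finitely many [s k w] are contained in [A]. This expresses the preimage by countably many
    preimages under simple functions. *)
Lemma smeas_borel f : smeas f -> measurable_fun [set: T] (f : T -> borel V).
Proof.
move=> [s [sf sc]].
apply: (@measurability _ _ _ (borel V) setT f (@open V) erefl) => _ [A oA <-].
rewrite setTI.
have -> : f @^-1` A = \bigcup_m \bigcup_N \bigcap_(k in [set k | (N <= k)%N])
    (s k @^-1` [set v | ball v (m.+1%:R^-1 : R) `<=` A]).
  apply/seteqP; split => [w Aw|w [m _ [N _ sA]]].
    have /nbhs_ballP[e /= e0 fA] := open_nbhs_nbhs (conj oA Aw : open_nbhs (f w) A).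
    have e20 : 0 < e / 2 by rewrite divr_gt0.
    have [m me] : exists m : nat, m.+1%:R^-1 < e / 2.
      have := near_infty_natSinv_lt (PosNum e20).
      by case=> k _ /(_ k (leqnn k)) ?; exists k.
    have /cvg_ballP/(_ _ e20)[N _ sN] := sc w.
    exists m => //; exists N => // k /= Nk v vk.
    apply: fA; apply: (@le_ball _ _ _ (e / 2 + e / 2)); first by rewrite -splitr.
    apply: ball_triangle (sN k Nk) _; apply: le_ball vk; exact: ltW.
  have m0 : 0 < m.+1%:R^-1 :> R by rewrite invr_gt0.
  have /cvg_ballP/(_ _ m0)[N' _ sN] := sc w.
  apply: (sA (maxn N N')); first exact: leq_maxl.
  by apply: ball_sym; apply: sN => /=; exact: leq_maxr.
apply: bigcup_measurable => m _; apply: bigcup_measurable => N _.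
apply: bigcap_measurable => [|k _]; first by exists N => /=.
exact: finmeas_preimage.
Qed.

(** In a nonseparable space a difference of Borel maps may fail to be Borel. On each of the finitely
    many level sets of [s], however, the distance is a continuous function of [f w]. *)
Lemma measurable_norm_sub_finmeas f (s : T -> V) :
  measurable_fun [set: T] (f : T -> borel V) -> finmeas s ->
  measurable_fun setT (fun w => `|f w - s w|).
Proof.
move=> mf sf _ B mB; rewrite setTI.
have -> : (fun w => `|f w - s w|) @^-1` B = \bigcup_(v in range s)
    (s @^-1` [set v] `&` (f @^-1` [set x | B `|x - v|])).
  apply/seteqP; split => [w Bw|w [v _ [/= -> //]]].
  by exists (s w); [exists w|split].
apply: fin_bigcup_measurable sf.1 _ => v _; apply: measurableI; first exact: sf.2.
have cv : continuous (fun x : V => `|x - v|).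
  by move=> x; apply: cvg_norm; apply: cvgB; [exact: cvg_id|exact: cvg_cst].
rewrite -[X in measurable X]setTI; apply: mf => //.
have mphi := continuous_borel_measurable cv.
by have := mphi measurableT _ mB; rewrite setTI.
Qed.

Lemma smeas_separable f : separable_space V ->
  measurable_fun [set: T] (f : T -> borel V) -> smeas f.
Proof.
move=> [A [cA dA]] mf.
have A0 : A !=set0.
  by have [v [_ Av]] := dA setT (ex_intro _ 0 I) openT; exists v.
have [q qA] : exists q : nat -> V, A `<=` range q.
  move/pfcard_geP: cA => [A0'|]; first by move: A0; rewrite A0' => -[].
  move=> [q]; exists q => v /(@surj _ _ _ _ q)[n _ <-]; by exists n.
(* For [0 < k], [s k w] is the point nearest to [f w] among the first [k] values of [q]; the value
   [q 0] at [k = 0] is arbitrary. Convergence follows from density of the range of [q]. *)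
pose fix s (k : nat) (w : T) {struct k} : V := if k is k'.+1 then
  (if w \in [set w | `|f w - q k'| < `|f w - s k' w|] then q k' else s k' w) else q 0%N.
have sf k : finmeas (s k).
  elim: k => [|k IH]; first exact: finmeas_cst.
  apply: finmeas_fun_if => //; last exact: finmeas_cst.
  have mb : measurable_fun setT (fun w => `|f w - q k| < `|f w - s k w|).
    apply: measurable_fun_ltr; last exact: measurable_norm_sub_finmeas.
    by apply: measurable_norm_sub_finmeas => //; exact: finmeas_cst.
  by have := mb measurableT [set true] I; rewrite setTI.
have s_le k i w : (i < k)%N -> `|f w - s k w| <= `|f w - q i|.
  elim: k => // k IH; rewrite ltnS leq_eqVlt => /orP[/eqP ->|ik] /=.
    by case: ifPn; [|rewrite notin_setE/= => /negP; rewrite -leNgt].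
  case: ifPn => [|_]; last exact: IH.
  by rewrite inE/= => /ltW /le_trans; apply; exact: IH.
exists s; split => // w; apply/cvgrPdist_lt => e e0.
have fb : ball (f w) e (f w) by exact: ballxx.
have [v [fv /qA[i _ qi]]] := dA _ (ex_intro _ (f w) fb) (ball_open (f w) e).
exists i.+1 => // k /= ik; apply: le_lt_trans (s_le _ _ w ik) _.
by rewrite qi; have : ball (f w) e v by []; rewrite -ball_normE.
Qed.

End normed.
End strongly_measurable.

Lemma separable_rV (R : realType) n : separable_space 'rV[R]_n.
Proof.
pose c (q : 'rV[rat]_n) : 'rV[R]_n := \row_i ratr (q 0 i).
exists (range c); split; first by apply: sub_countable (card_image_le _ _) _; exact: countableP.
move=> O [x Ox] oO.
have /nbhs_ballP[e /= e0 xeO] := open_nbhs_nbhs (conj oO Ox : open_nbhs x O).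
have qP i : exists q : rat, ball (x 0 i) e (ratr q : R).
  have /rat_in_itvoo[q] : x 0 i - e < x 0 i + e.
    by rewrite ltrD2l (lt_trans _ e0)// oppr_lt0.
  by exists q; rewrite ball_itv.
have [q xq] := choice qP; exists (c (\row_i q i)); split; last by exists (\row_i q i).
by apply: xeO; split => // i j; rewrite !mxE ord1; exact: xq.
Qed.

(** * Inner products and the Bochner integral *)

(* [c] absorbs the discrepancy between the norm of [ip] and the canonical norm:
   c = 1 for a Hilbert space, c = n for the dot product of ['rV_n], whose
   canonical norm is the max norm. *)
Definition inner_product (R : realType) (V : normedModType R) (ip : V -> V -> R) (c : R) :=
  [/\ forall x y, ip x y = ip y x,
      forall a x y z, ip (a *: x + y) z = a * ip x z + ip y z,
      forall x, `|x| ^+ 2 <= ip x x & forall x, ip x x <= c * `|x| ^+ 2].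

Section inner_product_theory.
Context (R : realType) (V : normedModType R) (ip : V -> V -> R) (c : R).
Hypothesis ipP : inner_product ip c.
Implicit Types (x y z : V) (a b : R).

Definition ipnorm x : R := Num.sqrt (ip x x).
Local Notation nrm := ipnorm.

Lemma ipC x y : ip x y = ip y x. Proof. by case: ipP. Qed.

Lemma ipPl a x y z : ip (a *: x + y) z = a * ip x z + ip y z. Proof. by case: ipP. Qed.

Lemma ip0l z : ip 0 z = 0.
Proof. have := ipPl 1 0 0 z; rewrite scaler0 addr0; lra. Qed.

Lemma ipZl a x z : ip (a *: x) z = a * ip x z.
Proof. by rewrite -[a *: x]addr0 ipPl ip0l addr0. Qed.

Lemma ipDl x y z : ip (x + y) z = ip x z + ip y z.
Proof. by rewrite -[x]scale1r ipPl mul1r scale1r. Qed.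

Lemma ipNl x z : ip (- x) z = - ip x z.
Proof. by rewrite -scaleN1r ipZl mulN1r. Qed.

Lemma ipBl x y z : ip (x - y) z = ip x z - ip y z.
Proof. by rewrite ipDl ipNl. Qed.

Lemma ipDr x y z : ip x (y + z) = ip x y + ip x z.
Proof. by rewrite ipC ipDl !(ipC _ x). Qed.

Lemma ipZr a x z : ip x (a *: z) = a * ip x z.
Proof. by rewrite ipC ipZl ipC. Qed.

Lemma ip_suml (I : Type) (s : seq I) (h : I -> V) z :
  ip (\sum_(i <- s) h i) z = \sum_(i <- s) ip (h i) z.
Proof. by apply: (big_morph (ip^~ z)) => [x y|]; rewrite ?ipDl ?ip0l. Qed.

Lemma ip_ge0 x : 0 <= ip x x.
Proof. by case: ipP => _ _ h _; apply: le_trans (h x); exact: sqr_ge0. Qed.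

Lemma nrm_ge0 x : 0 <= nrm x. Proof. exact: sqrtr_ge0. Qed.

Lemma sqr_nrm x : nrm x ^+ 2 = ip x x.
Proof. by rewrite sqr_sqrtr// ip_ge0. Qed.

Lemma ler_norm_nrm x : `|x| <= nrm x.
Proof.
rewrite -(ler_pXn2r (n := 2)) ?nnegrE ?nrm_ge0// sqr_nrm.
by case: ipP.
Qed.

Lemma ip_bound_ge0 x : x != 0 -> 0 <= c.
Proof.
case: ipP => _ _ h1 h2 x0; have x20 : 0 < `|x| ^+ 2 by rewrite exprn_gt0// normr_gt0.
by rewrite -(pmulr_lge0 _ x20); apply: le_trans (h2 x); exact: ip_ge0.
Qed.

Lemma nrm_le x : nrm x <= Num.sqrt c * `|x|.
Proof.
have [->|x0] := eqVneq x 0; first by rewrite /nrm ip0l sqrtr0 normr0 mulr0.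
rewrite -(ler_pXn2r (n := 2)) ?nnegrE ?nrm_ge0 ?mulr_ge0 ?sqrtr_ge0//.
rewrite sqr_nrm exprMn sqr_sqrtr ?(ip_bound_ge0 x0)//.
by case: ipP.
Qed.

Lemma nrm0 : nrm 0 = 0. Proof. by rewrite /nrm ip0l sqrtr0. Qed.

Lemma nrm_eq0 x : nrm x = 0 -> x = 0.
Proof.
move=> n0; apply/normr0_eq0/eqP; rewrite eq_le normr_ge0 andbT -n0.
exact: ler_norm_nrm.
Qed.

Lemma nrmZ a x : nrm (a *: x) = `|a| * nrm x.
Proof. by rewrite /nrm ipZl ipZr mulrA -expr2 sqrtrM ?sqr_ge0// sqrtr_sqr. Qed.

Lemma nrmN x : nrm (- x) = nrm x.
Proof. by rewrite -scaleN1r nrmZ normrN normr1 mul1r. Qed.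

Lemma nrmC x y : nrm (x - y) = nrm (y - x).
Proof. by rewrite -nrmN opprB. Qed.

Lemma ip_CS x y : `|ip x y| <= nrm x * nrm y.
Proof.
rewrite -(ler_pXn2r (n := 2)) ?nnegrE ?mulr_ge0 ?nrm_ge0//.
rewrite real_normK ?num_real// exprMn !sqr_nrm.
apply: discr_le => [|t]; first exact: ip_ge0.
have := ip_ge0 (x + t *: y).
rewrite ipDl !ipDr !ipZl !ipZr (ipC y x).
by rewrite (_ : _ + _ + _ = ip x x + 2 * t * ip x y + t ^+ 2 * ip y y)//; ring.
Qed.

Lemma nrmD x y : nrm (x + y) <= nrm x + nrm y.
Proof.
rewrite -(ler_pXn2r (n := 2)) ?nnegrE ?addr_ge0 ?nrm_ge0//.
rewrite sqr_nrm ipDl !ipDr -!sqr_nrm (ipC y x).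
by have := ip_CS x y; have := ler_norm (ip x y); nra.
Qed.

Lemma ler_dist_nrm x y : `|nrm x - nrm y| <= nrm (x - y).
Proof.
rewrite ler_norml; apply/andP; split.
  by have := nrmD (y - x) x; rewrite subrK nrmC; lra.
by have := nrmD (x - y) y; rewrite subrK; lra.
Qed.

Lemma cvg_nrm0 (u : nat -> V) x : u n @[n --> \oo] --> x ->
  nrm (x - u n) @[n --> \oo] --> (0 : R).
Proof.
move=> ux; apply: (@squeeze_cvgr _ _ _ _ (fun=> 0) (fun n => Num.sqrt c * `|x - u n|)).
- by apply: nearW => n; rewrite nrm_ge0 nrm_le.
- exact: cvg_cst.
- rewrite -[X in _ --> X](mulr0 (Num.sqrt c)); apply: cvgM; first exact: cvg_cst.
  rewrite -[X in _ --> X](@normr0 _ V) -(subrr x).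
  by apply: cvg_norm; apply: cvgB => //; exact: cvg_cst.
Qed.

Lemma cvg_nrm (u : nat -> V) x : u n @[n --> \oo] --> x ->
  nrm (u n) @[n --> \oo] --> nrm x.
Proof.
move=> /cvg_nrm0 ux; apply/cvgrPdist_lt => e e0.
have /cvgr0_norm_lt/(_ e e0) := ux; apply: filterS => n /=.
rewrite ger0_norm ?nrm_ge0//; exact: le_lt_trans (ler_dist_nrm _ _).
Qed.

Lemma cvg_ip (u v : nat -> V) x y : u n @[n --> \oo] --> x -> v n @[n --> \oo] --> y ->
  ip (u n) (v n) @[n --> \oo] --> ip x y.
Proof.
move=> ux vy; apply: cvg_sub0 (cvg_cst (ip x y)).
apply: norm_cvg0.
apply: (@squeeze_cvgr _ _ _ _ (fun=> 0)
  (fun n => nrm (x - u n) * nrm (v n) + nrm x * nrm (y - v n))).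
- apply: nearW => n; rewrite normr_ge0/=.
  rewrite -[X in `|X|]/(ip (u n) (v n) - ip x y) distrC.
  have -> : ip x y - ip (u n) (v n) = ip (x - u n) (v n) + ip x (y - v n).
    by rewrite ipBl (ipC x (y - v n)) ipBl !(ipC _ x); ring.
  by rewrite (le_trans (ler_normD _ _))// lerD// ip_CS.
- exact: cvg_cst.
- rewrite (_ : 0 = 0 * nrm y + nrm x * 0); last by rewrite mul0r mulr0 addr0.
  apply: cvgD; apply: cvgM => //; try exact: cvg_cst; try exact: cvg_nrm0.
  exact: cvg_nrm.
Qed.

Section measurability.
Context d (T : measurableType d) (P : probability T R).
Implicit Types f g : T -> V.

Lemma measurable_ip f g : smeas f -> smeas g -> measurable_fun setT (fun w => ip (f w) (g w)).
Proof.
move=> fm gm; apply: smeas_measurable.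
apply: (smeas_op2 (phi := ip)) fm gm => u v a b; exact: cvg_ip.
Qed.

Lemma measurable_nrm f : smeas f -> measurable_fun setT (fun w => nrm (f w)).
Proof.
move=> fm; apply: smeas_measurable.
apply: (smeas_op2 (phi := fun x _ : V => nrm x) _ fm fm) => u v a b ua _; exact: cvg_nrm.
Qed.

Definition vint f := smeas f /\ intble P (fun w => nrm (f w)).

Definition vsq f := smeas f /\ sqint P (fun w => nrm (f w)).

Definition vrms f : R := rms P (fun w => nrm (f w)).

Lemma vrms_ge0 f : 0 <= vrms f. Proof. exact: rms_ge0. Qed.

Lemma vsq_vint f : vsq f -> vint f.
Proof. by move=> [fm fs]; split => //; exact: sqint_intble. Qed.

Lemma vsq_cst x : vsq (fun=> x).
Proof. by split; [exact: smeas_cst|exact: sqint_cst]. Qed.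

Lemma le_vsq f (g : T -> R) : smeas f -> sqint P g -> (forall w, nrm (f w) <= g w) -> vsq f.
Proof.
move=> fm gs fg; split => //; apply: (le_sqint _ _ (sqint_sq gs)).
  exact: measurable_nrm.
by move=> w; rewrite lerXn2r ?nnegrE ?nrm_ge0// (le_trans _ (fg w))// nrm_ge0.
Qed.

Lemma vrms_cst x : vrms (fun=> x) = nrm x.
Proof. by rewrite /vrms rms_cst ger0_norm ?nrm_ge0. Qed.

Lemma vsqD f g : vsq f -> vsq g -> vsq (fun w => f w + g w).
Proof.
move=> [fm fs] [gm gs]; apply: le_vsq (sqintD fs gs) _; first exact: smeasD.
by move=> w; exact: nrmD.
Qed.

Lemma vsqB f g : vsq f -> vsq g -> vsq (fun w => f w - g w).
Proof.
move=> [fm fs] [gm gs]; apply: le_vsq (sqintD fs gs) _; first exact: smeasB.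
by move=> w; rewrite (le_trans (nrmD _ _))// nrmN.
Qed.

Lemma vsqZr (f : T -> R) x : sqint P f -> vsq (fun w => f w *: x).
Proof.
move=> fs; have [mf _] := fs; split.
  by apply: smeasZ; [exact: measurable_smeas|exact: smeas_cst].
have -> : (fun w => nrm (f w *: x)) = fun w => nrm x * `|f w|.
  by apply/funext => w; rewrite nrmZ mulrC.
apply: sqintZ; apply: le_sqint (sqint_sq fs).
  exact: measurableT_comp.
by move=> w; rewrite real_normK// num_real.
Qed.

Lemma vsq_sum (I : Type) (s : seq I) (h : I -> T -> V) :
  (forall i, vsq (h i)) -> vsq (fun w => \sum_(i <- s) h i w).
Proof.
move=> hi; elim: s => [|i s IH].
  by rewrite (_ : (fun _ => _) = fun=> 0); [exact: vsq_cst|apply/funext => w; rewrite big_nil].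
rewrite (_ : (fun _ => _) = fun w => h i w + \sum_(i <- s) h i w); first exact: vsqD.
by apply/funext => w; rewrite big_cons.
Qed.

Lemma vrmsD f g : vsq f -> vsq g -> vrms (fun w => f w + g w) <= vrms f + vrms g.
Proof.
move=> fs gs; have [_ fs'] := fs; have [_ gs'] := gs.
have [_ ds] := vsqD fs gs; apply: le_trans (rmsD fs' gs').
apply: le_rms => // [|w]; first exact: sqintD.
by rewrite !ger0_norm ?addr_ge0 ?nrm_ge0// nrmD.
Qed.

Lemma vrmsN f : vrms (fun w => - f w) = vrms f.
Proof. by rewrite /vrms; congr rms; apply/funext => w; rewrite nrmN. Qed.

Lemma vrmsC f g : vrms (fun w => f w - g w) = vrms (fun w => g w - f w).
Proof. by rewrite /vrms; congr rms; apply/funext => w; rewrite nrmC. Qed.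

Lemma vrmsB f g : vsq f -> vsq g -> vrms (fun w => f w - g w) <= vrms f + vrms g.
Proof.
move=> fs gs; rewrite -(vrmsN g).
have gN : vsq (fun w => - g w).
  by have := vsqB (vsq_cst 0) gs; congr vsq; apply/funext => w; rewrite sub0r.
exact: vrmsD.
Qed.

Lemma sqint_ip f x : vsq f -> sqint P (fun w => ip (f w) x).
Proof.
move=> [fm fs]; apply: (le_sqint _ _ (sqint_sq (sqintZ (nrm x) fs))).
  by apply: measurable_ip => //; exact: smeas_cst.
move=> w; rewrite -(real_normK (num_real (ip _ _))) lerXn2r ?nnegrE ?mulr_ge0 ?nrm_ge0//.
by rewrite mulrC ip_CS.
Qed.

Lemma rms_ip_le f x : vsq f -> rms P (fun w => ip (f w) x) <= vrms f * nrm x.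
Proof.
move=> fs; have [_ fs'] := fs.
rewrite mulrC -[X in X * _](ger0_norm (nrm_ge0 x)) -rmsZ//.
apply: le_rms => [||w]; [exact: sqint_ip|exact: sqintZ|].
by apply: le_trans (ler_norm _); rewrite mulrC ip_CS.
Qed.

Lemma L2normE f : vsq f -> L2norm P nrm f = (vrms f)%:E.
Proof. by move=> [fm [mf fi]]; apply: Lnorm2_fin; rewrite mean_EFin. Qed.

(** A finite [L2norm] of a strongly measurable map forces square-integrability, so remainders of
    chaos expansions, and with them the expanded variables, are square-integrable. *)
Lemma L2norm_lt_vsq f e : smeas f -> (L2norm P nrm f < e%:E)%E ->
  vsq f /\ vrms f < e.
Proof.
move=> fm fe; have fs : vsq f.
  split=> //; split; first exact: measurable_nrm.
  have := Lnorm2_lt fe => fe2; apply: ge0_intble => [|w|]; last exact: lt_trans fe2 (ltry _).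
    by apply: measurable_funX; exact: measurable_nrm.
  exact: sqr_ge0.
by split => //; move: fe; rewrite L2normE// lte_fin.
Qed.

End measurability.
End inner_product_theory.

(** Sequential completeness as a property of a bare [normedModType], so that one development covers
    both the Hilbert space and row vectors. *)
Definition cauchy_complete (R : realType) (V : normedModType R) := forall u : nat -> V,
  (forall e : R, 0 < e -> exists N, forall m n, (N <= m)%N -> (N <= n)%N -> `|u m - u n| < e) ->
  exists l : V, u n @[n --> \oo] --> l.

(** * Existence and weak characterisation of the Bochner integral *)

Section bochner_theory.
Context (R : realType) (V : normedModType R) (ip : V -> V -> R) (c : R).
Hypothesis ipP : inner_product ip c.
Hypothesis V_complete : cauchy_complete V.
Context d (T : measurableType d) (P : probability T R).
Implicit Types (x y z v : V) (a b : R) (f g s : T -> V).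
Local Notation nrm := (ipnorm ip).
Local Notation vint := (vint ip P).
Local Notation mean := (mean P).

Lemma le_vint f (g : T -> R) : smeas f -> intble P g -> (forall w, nrm (f w) <= g w) -> vint f.
Proof.
move=> fm gi fg; split => //; apply: le_intble gi; first exact: (measurable_nrm ipP).
by move=> w; rewrite ger0_norm ?nrm_ge0.
Qed.

Lemma vintD f g : vint f -> vint g -> vint (fun w => f w + g w).
Proof.
move=> [fm fi] [gm gi]; apply: le_vint (intbleD fi gi) _; first exact: smeasD.
by move=> w; exact: (nrmD ipP).
Qed.

Lemma vintZ a f : vint f -> vint (fun w => a *: f w).
Proof.
move=> [fm fi]; apply: le_vint (intbleZ `|a| fi) _.
  by apply: smeasZ => //; exact: smeas_cst.
by move=> w; rewrite (nrmZ ipP).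
Qed.

Lemma vintB f g : vint f -> vint g -> vint (fun w => f w - g w).
Proof.
move=> fi gi; have := vintD fi (vintZ (-1) gi).
by congr vint; apply/funext => w; rewrite scaleN1r.
Qed.

Lemma intble_norm_vint f : vint f -> intble P (fun w => `|f w|).
Proof.
move=> [fm fi]; apply: le_intble fi => [|w]; last first.
  by rewrite normr_id (ler_norm_nrm ipP).
apply: smeas_measurable; apply: (@smeas_comp _ _ V R (fun x => `|x|)) => //.
by move=> y; apply: cvg_norm; exact: cvg_id.
Qed.

Lemma vint_simple s : finmeas s -> vint s.
Proof.
move=> sf; split; first by exists (fun=> s); split => // w; exact: cvg_cst.
have [M sM] : exists M, forall w, nrm (s w) <= M.
  exists (\sum_(v <- fset_set (range s)) nrm v) => w.
  rewrite (big_fsetD1 (s w))/=; last first.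
    by rewrite in_fset_set ?inE; [exists w|exact: sf.1].
  by rewrite lerDl sumr_ge0// => v _; exact: nrm_ge0.
apply: le_intble (intble_cst P M); last by move=> w; rewrite ger0_norm ?nrm_ge0.
apply: finmeas_measurable; exact: finmeas_comp.
Qed.

Lemma intble_ip f x : vint f -> intble P (fun w => ip (f w) x).
Proof.
move=> [fm fi]; apply: le_intble (intbleZ (nrm x) fi).
  by apply: (measurable_ip ipP) => //; exact: smeas_cst.
by move=> w; rewrite mulrC (ip_CS ipP).
Qed.

Lemma ip_simple_integral s x : finmeas s ->
  ip (simple_integral P s) x = mean (fun w => ip (s w) x).
Proof.
move=> sf; rewrite /simple_integral fsbig_finite; last exact: sf.1.
rewrite (ip_suml ipP).
have sE w : ip (s w) x =
    \sum_(v <- fset_set (range s)) ip v x * \1_(s @^-1` [set v]) w.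
  rewrite (big_fsetD1 (s w))/=; last first.
    by rewrite in_fset_set ?inE; [exists w|exact: sf.1].
  rewrite indicE mem_set// mulr1 big_seq big1 ?addr0// => v.
  rewrite !inE => /andP[/eqP vs _]; rewrite indicE memNset ?mulr0//= => sv.
  exact: vs.
have iI v : intble P (\1_(s @^-1` [set v]) : T -> R).
  apply: ge0_intble => //; first exact/measurable_indic/sf.2.
  rewrite integral_indic ?setIT//; last exact: sf.2.
  by rewrite (le_lt_trans (probability_le1 _ (sf.2 v)))// ltry.
under [in RHS]eq_fun do rewrite sE.
rewrite mean_sum => [|v]; last exact: intbleZ.
apply: eq_bigr => v _; rewrite (ipZl ipP) meanZ// mulrC; congr (_ * _).
rewrite /mean /Rintegral integral_indic ?setIT//; exact: sf.2.
Qed.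

(** Duality: the test vector [v] itself gives [nrm v ^+ 2 <= a * nrm v]. *)
Lemma nrm_bound v a : 0 <= a -> (forall x, ip v x <= a * nrm x) -> nrm v <= a.
Proof.
move=> a0 va; have [v0|v0] := eqVneq (nrm v) 0; first by rewrite v0.
have v_gt0 : 0 < nrm v by rewrite lt_def v0 nrm_ge0.
by rewrite -(ler_pM2r v_gt0) -expr2 (sqr_nrm ipP).
Qed.

(** The identity is exact for simple functions. For [f] the error is at most [Num.sqrt c * nrm x]
    times the L^1 distance to [s k]; the factor [Num.sqrt c] appears because that distance is taken
    in the canonical norm. *)
Lemma bochner_weak f v x : vint f -> is_bochner_integral P f v ->
  ip v x = mean (fun w => ip (f w) x).
Proof.
move=> fi [_ [s [ss sc vc]]].
have c1 : ip (simple_integral P (s k)) x @[k --> \oo] --> ip v x.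
  by apply: (cvg_ip ipP) => //; exact: cvg_cst.
have s_int k : vint (s k) by apply: vint_simple; exact: ss.
pose K := Num.sqrt c * nrm x.
have K0 : 0 <= K by rewrite mulr_ge0 ?sqrtr_ge0 ?nrm_ge0.
have nb := intble_norm_vint.
have di k := vintB fi (s_int k).
have c2 : mean (fun w => `|f w - s k w|) @[k --> \oo] --> (0 : R).
  have E k : (\int[P]_w (`|f w - s k w|%R)%:E)%E = (mean (fun w => `|f w - s k w|))%:E.
    by rewrite mean_EFin//; exact: nb.
  by move: sc; under eq_fun do rewrite E; move=> /fine_cvgP[].
suff c3 : ip (simple_integral P (s k)) x @[k --> \oo] --> mean (fun w => ip (f w) x).
  exact: (cvg_unique _ c1 c3).
apply/cvgrPdist_le => e e0.
have /cvgr0_norm_le/(_ (e / (K + 1))) : mean (fun w => `|f w - s k w|) @[k --> \oo] --> (0 : R) by [].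
have K1 : 0 < K + 1 by lra.
move=> /(_ (divr_gt0 e0 K1)); apply: filterS => k /=.
rewrite ger0_norm; last by apply: mean_ge0.
rewrite ler_pdivlMr// => ke.
rewrite ip_simple_integral; last exact: ss.
rewrite -meanB; [|exact: intble_ip..].
apply: (le_trans (ler_norm_mean _)); first by apply: intbleB; exact: intble_ip.
apply: le_trans ke.
apply: (@le_trans _ _ (mean (fun w => K * `|f w - s k w|))).
  apply: le_mean.
  - by apply: intble_norm; apply: intbleB; exact: intble_ip.
  - by apply: intbleZ; exact: nb.
  - move=> w; rewrite -(ipBl ipP) (le_trans (ip_CS ipP _ _))// mulrC /K.
    by rewrite -mulrA mulrCA ler_wpM2l ?nrm_ge0// (nrm_le ipP).
rewrite meanZ ?nb// mulrC ler_wpM2l//; last lra.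
by apply: mean_ge0.
Qed.

(** The approximants given by [smeas] converge only pointwise. Replacing by 0 the values with
    [nrm (s k w) > 2 * nrm (f w)] gives a dominated sequence with the same limit, hence L^1
    convergence; the simple integrals are then Cauchy, and completeness supplies the integral. *)
Lemma bochner_exists f : vint f -> exists v, is_bochner_integral P f v.
Proof.
move=> fi; have [[s [sf sc]] ni] := fi.
pose D k := [set w | nrm (s k w) <= 2 * nrm (f w)].
pose t k w := if w \in D k then s k w else 0.
have mnf := measurable_nrm ipP fi.1.
have mD k : measurable (D k).
  have mns : measurable_fun setT (fun w => nrm (s k w)).
    by apply: finmeas_measurable; exact: finmeas_comp.
  have mb : measurable_fun setT (fun w => nrm (s k w) <= 2 * nrm (f w)).
    by apply: measurable_fun_ler => //; exact: measurable_funM.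
  by have := mb measurableT [set true] I; rewrite setTI.
have tf k : finmeas (t k) by apply: finmeas_fun_if => //; exact: finmeas_cst.
have t_le k w : nrm (t k w) <= 2 * nrm (f w).
  rewrite /t; case: ifPn => [/set_mem//|_].
  by rewrite (nrm0 ipP) mulr_ge0 ?nrm_ge0.
have tc w : t k w @[k --> \oo] --> f w.
  (* If [f w = 0], the cut-off forces [t k w = 0]; otherwise it is inactive for large [k], because
     [nrm (s k w)] tends to [nrm (f w) < 2 * nrm (f w)]. *)
  have [f0|f0] := eqVneq (nrm (f w)) 0.
    have t0 k : t k w = 0.
      apply: (nrm_eq0 ipP); apply/eqP; rewrite eq_le nrm_ge0 andbT.
      by have := t_le k w; rewrite f0 mulr0.
    rewrite (nrm_eq0 ipP f0); under eq_fun do rewrite t0; exact: cvg_cst.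
  have f_gt0 : 0 < nrm (f w) by rewrite lt_def f0 nrm_ge0.
  have /cvgr_le/(_ (2 * nrm (f w))) : nrm (s k w) @[k --> \oo] --> nrm (f w).
    by apply: (cvg_nrm ipP); exact: sc.
  move=> /(_ ltac:(lra)) sD; apply: cvg_trans (sc w).
  by apply: near_eq_cvg; apply: filterS sD => k sk; rewrite /t mem_set.
have ti k : vint (t k) by exact: vint_simple.
have dm k : measurable_fun setT (fun w => nrm (f w - t k w)).
  by apply: (measurable_nrm ipP); apply: smeasB; [exact: fi.1|exact: (ti k).1].
have d0 : mean (fun w => nrm (f w - t k w)) @[k --> \oo] --> (0 : R).
  apply: (mean_dominated_cvg0 (g := fun w => 3 * nrm (f w))) => //.
  - exact: intbleZ ni.
  - move=> k w; rewrite ger0_norm ?nrm_ge0//.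
    have := nrmD ipP (f w) (- t k w); rewrite (nrmN ipP).
    by have := t_le k w; lra.
  - by apply: nearW => w; apply: (cvg_nrm0 ipP); exact: tc.
have tI k l : nrm (simple_integral P (t k) - simple_integral P (t l)) <=
    mean (fun w => nrm (f w - t k w)) + mean (fun w => nrm (f w - t l w)).
  have [_ ik] := vintB fi (ti k); have [_ il] := vintB fi (ti l).
  apply: nrm_bound => [|x].
    by rewrite addr_ge0//; apply: mean_ge0 => w; exact: nrm_ge0.
  rewrite (ipBl ipP) !ip_simple_integral// -meanB ?intble_ip//.
  rewrite -meanD// mulrC -meanZ; last exact: intbleD.
  apply: le_mean.
  - by apply: intbleB; exact: intble_ip.
  - by apply: intbleZ; exact: intbleD.
  move=> w; rewrite -(ipBl ipP) (le_trans (ler_norm _))// (le_trans (ip_CS ipP _ _))//.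
  rewrite mulrC ler_wpM2l ?nrm_ge0//.
  rewrite (_ : t k w - t l w = (f w - t l w) - (f w - t k w)); last first.
    by rewrite opprB [RHS]addrC addrA subrK.
  by rewrite (le_trans (nrmD ipP _ _))// (nrmN ipP) addrC.
have [v vc] : exists v, simple_integral P (t k) @[k --> \oo] --> v.
  apply: V_complete => e e0.
  have e2 : 0 < e / 2 by rewrite divr_gt0.
  have /cvgr0_norm_lt/(_ _ e2)[N _ HN] := d0.
  exists N => k l Nk Nl; apply: le_lt_trans (ler_norm_nrm ipP _) _.
  apply: le_lt_trans (tI k l) _.
  have := HN k Nk; have := HN l Nl; rewrite /= !ger0_norm ?mean_ge0//; try by move=> w; exact: nrm_ge0.
  lra.
exists v; split; first by apply: smeas_borel; exact: fi.1.
exists t; split => //.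
have nE k : (\int[P]_w (`|f w - t k w|%R)%:E)%E = (mean (fun w => `|f w - t k w|))%:E.
  by rewrite mean_EFin//; apply: intble_norm_vint; exact: vintB.
under eq_fun do rewrite nE.
apply/cvg_EFin; first exact: nearW.
apply: (@squeeze_cvgr _ _ _ _ (fun=> 0) (fun k => mean (fun w => nrm (f w - t k w)))) => //; last exact: cvg_cst.
apply: nearW => k; rewrite mean_ge0//=; have dv := vintB fi (ti k).
apply: le_mean; [exact: intble_norm_vint|exact: dv.2|].
by move=> w; exact: (ler_norm_nrm ipP).
Qed.

(** [bochner_weak] applies to whichever integral [xget] selects, so existence is enough to compute
    with [bochner]. *)
Lemma bochnerE f x : vint f -> ip (bochner P f) x = mean (fun w => ip (f w) x).
Proof.
move=> fi; apply: bochner_weak => //.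
by apply: (@xgetPex _ 0 [set v | is_bochner_integral P f v]); exact: bochner_exists.
Qed.

End bochner_theory.

(** * Chaos expansions of vector-valued random variables *)

Section vector_chaos.
Context (R : realType) (V : normedModType R) (ip : V -> V -> R) (c : R).
Hypothesis ipP : inner_product ip c.
Context d (T : measurableType d) (P : probability T R).
Context (xi : nat -> {RV P >-> R}) (xi_indep : independent xi).
Context (p : nat -> nat -> {poly R}) (p_0 : forall m, p m 0%N = 1).
Context (p_cons : forall m, complete_orthonormal (distribution P (xi m)) (p m)).
Implicit Types (x y : multi_index -> V) (F : {fset multi_index}) (Y : T -> V).
Local Notation nrm := (ipnorm ip).
Local Notation Pa := (chaos_poly xi p).
Local Notation chaos_sum := (chaos_sum xi p).
Let spa := sqint_chaos_poly xi_indep p_0 p_cons.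

Lemma vsq_chaos_sum F x : vsq ip P (chaos_sum F x).
Proof. by apply: (vsq_sum ipP) => a; apply: (vsqZr ipP); exact: spa. Qed.

(** Pairing the sum with [x a] gives a real chaos sum whose coefficient at [a] is [ip (x a) (x a)].
    By orthonormality its root mean square is at least this coefficient; by Cauchy-Schwarz it is at
    most [nrm (x a)] times that of the vector sum. *)
Lemma coef_le_chaos_sum F x a : a \in F -> nrm (x a) <= vrms ip P (chaos_sum F x).
Proof.
move=> aF; have Sv := vsq_chaos_sum F x.
have [x0|x0] := eqVneq (nrm (x a)) 0; first by rewrite x0 vrms_ge0.
have x_gt0 : 0 < nrm (x a) by rewrite lt_def x0 nrm_ge0.
rewrite -(ler_pM2r x_gt0) -expr2 (sqr_nrm ipP).
apply: le_trans (rms_ip_le ipP (x a) Sv).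
have -> : (fun w => ip (chaos_sum F x w) (x a)) = real_sum xi p F (fun b => ip (x b) (x a)).
  apply/funext => w; rewrite (ip_suml ipP); apply: eq_bigr => b _.
  by rewrite (ipZl ipP) mulrC.
rewrite /rms (msq_real_sum xi_indep p_0 p_cons) -[leLHS]ger0_norm ?(ip_ge0 ipP)//.
rewrite -sqrtr_sqr ler_sqrt; last by apply: sumr_ge0 => b _; exact: sqr_ge0.
by rewrite (big_fsetD1 a)//= lerDl sumr_ge0// => b _; exact: sqr_ge0.
Qed.

(** On an index set containing [a] and large enough for both expansions, the two partial sums differ
    by at most [e] in mean square, which bounds the difference of the coefficients at [a]. *)
Lemma chaos_expansion_unique Y x y : smeas Y ->
  chaos_expansion xi p nrm Y x -> chaos_expansion xi p nrm Y y -> x = y.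
Proof.
move=> Ym Yx Yy; apply/funext => a; apply/eqP; rewrite -subr_eq0; apply/eqP.
apply: (nrm_eq0 ipP); apply/eqP; rewrite eq_le nrm_ge0 andbT.
apply/ler_addgt0Pr => e e0; rewrite add0r; have e2 : 0 < e / 2 by rewrite divr_gt0.
have [F1 H1] := Yx _ e2; have [F2 H2] := Yy _ e2.
pose F := (a |` (F1 `|` F2))%fset.
have F1F : (F1 `<=` F)%fset := fsubset_trans (fsubsetUl _ _) (fsubsetUr _ _).
have F2F : (F2 `<=` F)%fset := fsubset_trans (fsubsetUr _ _) (fsubsetUr _ _).
have m1 : smeas (fun w => Y w - chaos_sum F x w).
  by apply: smeasB => //; exact: (vsq_chaos_sum F x).1.
have m2 : smeas (fun w => Y w - chaos_sum F y w).
  by apply: smeasB => //; exact: (vsq_chaos_sum F y).1.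
have [v1 n1] := L2norm_lt_vsq ipP m1 (H1 F F1F).
have [v2 n2] := L2norm_lt_vsq ipP m2 (H2 F F2F).
have aF : a \in F := fset1U1 _ _.
apply: le_trans (coef_le_chaos_sum (fun a => x a - y a) aF) _.
have -> : chaos_sum F (fun a => x a - y a) =
    (fun w => (Y w - chaos_sum F y w) - (Y w - chaos_sum F x w)).
  apply/funext => w; rewrite opprB [RHS]addrC addrA subrK.
  by rewrite /Defs.chaos_sum -sumrB; apply: eq_bigr => b _; rewrite scalerBr.
by apply: le_trans (vrmsB ipP v2 v1) _; lra.
Qed.

Lemma chaos_coefE Y x : smeas Y -> chaos_expansion xi p nrm Y x ->
  chaos_coef xi p nrm Y = x.
Proof.
move=> Ym Yx; apply: (chaos_expansion_unique Ym) => //.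
by apply: (@xgetPex _ (fun=> 0) [set x | chaos_expansion xi p nrm Y x]); exists x.
Qed.

(** The analysis step reads the coefficients of [Z_J] through [chaos_coef]; this identifies them,
    with value 0 outside [F]. *)
Lemma chaos_expansion_sum F x :
  chaos_expansion xi p nrm (chaos_sum F x) (fun a => if a \in F then x a else 0).
Proof.
move=> e e0; exists F => F' FF'.
have E : chaos_sum F' (fun a => if a \in F then x a else 0) = chaos_sum F x.
  apply/funext => w; rewrite /Defs.chaos_sum -(big_fset_incl _ FF').
    by rewrite big_seq [RHS]big_seq; apply: eq_bigr => a ->.
  by move=> a _ /negPf ->; rewrite scaler0.
rewrite E; have -> : (fun w => chaos_sum F x w - chaos_sum F x w) = fun=> 0.
  by apply/funext => w; rewrite subrr.
rewrite (L2normE (vsq_cst ip P 0)) /vrms (nrm0 ipP) rms_cst normr0 lte_fin//.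
Qed.

End vector_chaos.

(** * The two target spaces, and chaos expansions of row vectors *)

Lemma cauchy_seq_cvg (R : realType) (W : completePseudoMetricType R) (u : nat -> W) :
  (forall e : R, 0 < e -> exists N, forall i j, (N <= i)%N -> (N <= j)%N ->
    ball (u i) e (u j)) -> exists l : W, u n @[n --> \oo] --> l.
Proof.
move=> uC; suff : cvg (u n @[n --> \oo]) by move=> /cvg_ex.
apply/cauchy_cvgP/cauchy_ballP => e e0; have [N HN] := uC e e0.
exists (u @` [set i | (N <= i)%N], u @` [set i | (N <= i)%N]).
  by split; exists N => // i Ni; exists i.
by move=> [x y] /= [[i Ni <-] [j Nj <-]]; exact: HN.
Qed.

Section euclidean_space.
Context (R : realType) (n : nat).
Implicit Types x y z : 'rV[R]_n.

Lemma edotC x y : edot x y = edot y x.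
Proof. by apply: eq_bigr => i _; rewrite mulrC. Qed.

Lemma inner_product_edot : inner_product (@edot R n) n%:R.
Proof.
have coordle x i : `|x 0 i| <= `|x|.
  rewrite [leRHS]/Num.norm /= mx_normrE; exact: (le_bigmax _ (fun ij => `|x ij.1 ij.2|) (0, i)).
split=> [|a x y z|x|x].
- exact: edotC.
- rewrite /edot mulr_sumr -big_split; apply: eq_bigr => i _ /=.
  by rewrite !mxE; ring.
- have e0 : 0 <= edot x x by apply: sumr_ge0 => i _; rewrite -expr2 sqr_ge0.
  rewrite -(sqr_sqrtr e0) lerXn2r ?nnegrE ?sqrtr_ge0//.
  rewrite [leLHS]/Num.norm /= mx_normrE; apply/bigmax_leP; split => [|[j i] _]; first exact: sqrtr_ge0.
  rewrite /= ord1 -sqrtr_sqr ler_sqrt//.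
  by rewrite /edot (bigD1 i)//= -expr2 lerDl sumr_ge0// => k _; rewrite -expr2 sqr_ge0.
- rewrite mulr_natl -[X in _ *+ X]card_ord -sumr_const; apply: ler_sum => i _.
  by rewrite -expr2 -(real_normK (num_real (x 0 i))) lerXn2r ?nnegrE.
Qed.

Lemma cauchy_complete_rV : cauchy_complete 'rV[R]_n.
Proof.
move=> u uC; apply: cauchy_seq_cvg => e e0; have [N HN] := uC e e0.
by exists N => i j Ni Nj; rewrite -ball_normE; exact: HN.
Qed.

End euclidean_space.

Lemma cauchy_complete_normed (R : realType) (X : completeNormedModType R) :
  cauchy_complete X.
Proof.
move=> u uC; apply: cauchy_seq_cvg => e e0; have [N HN] := uC e e0.
by exists N => i j Ni Nj; rewrite -ball_normE; exact: HN.
Qed.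

Lemma separable_smeas_RV (R : realType) d (T : measurableType d) (P : probability T R)
    (V : normedModType R) (Y : {RV P >-> borel V}) :
  separable_space V -> smeas (Y : T -> V).
Proof. by move=> sV; apply: smeas_separable => //; exact: (measurable_funPT Y). Qed.

Section euclidean_chaos.
Context (R : realType) (n : nat).
Context d (T : measurableType d) (P : probability T R).
Context (xi : nat -> {RV P >-> R}) (xi_indep : independent xi).
Context (p : nat -> nat -> {poly R}) (p_0 : forall m, p m 0%N = 1).
Context (p_cons : forall m, complete_orthonormal (distribution P (xi m)) (p m)).
Implicit Types (F : {fset multi_index}) (Y f : T -> 'rV[R]_n).

Lemma sqr_enorm (x : 'rV[R]_n) : enorm x ^+ 2 = \sum_(i < n) x 0 i ^+ 2.
Proof. by rewrite (sqr_nrm (inner_product_edot R n)). Qed.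

Lemma edot_delta (x : 'rV[R]_n) i : edot x (delta_mx 0 i) = x 0 i.
Proof.
rewrite /edot (bigD1 i)//= mxE !eqxx mulr1 big1 ?addr0// => j ji.
by rewrite mxE (negPf ji) andbF mulr0.
Qed.

Lemma L2norm_rV f : (forall i, sqint P (fun w => f w 0 i)) ->
  L2norm P (@enorm R n) f = (Num.sqrt (\sum_(i < n) msq P (fun w => f w 0 i)))%:E.
Proof.
move=> fs; apply: Lnorm2_fin.
have fi i : intble P (fun w => f w 0 i ^+ 2) by exact: sqint_sq (fs i).
rewrite /msq -(mean_sum _ fi) -mean_EFin; last exact: intble_sum.
by apply: eq_integral => w _; rewrite /= sqr_enorm.
Qed.

Definition rV_fcoef Y (a : multi_index) : 'rV[R]_n :=
  \row_i fcoef xi p (fun w => Y w 0 i) a.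

Lemma chaos_sum_coord F (x : multi_index -> 'rV[R]_n) w i :
  (chaos_sum xi p F x w : 'rV[R]_n) 0 i = real_sum xi p F (fun a => x a 0 i) w.
Proof.
by rewrite /chaos_sum /real_sum summxE; apply: eq_bigr => a _; rewrite mxE mulrC.
Qed.

Lemma chaos_expansion_rV Y : (forall i, in_chaos xi p (fun w => Y w 0 i)) ->
  chaos_expansion xi p (@enorm R n) Y (rV_fcoef Y).
Proof.
move=> Yc e e0; have n1 : 0 < (n.+1)%:R :> R by rewrite ltr0n.
(* [n.+1] rather than [n] keeps the denominator nonzero and the sum of the [n] coordinate errors
   strictly below [e ^+ 2]. *)
have en0 : 0 < e ^+ 2 / n.+1%:R by rewrite divr_gt0// exprn_gt0.
have [F0 HF0] := choice (fun i => in_chaos_fourier xi_indep p_0 p_cons (Yc i) en0).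
exists (\big[fsetU/fset0]_(i < n) F0 i)%fset => F F0F.
have sE i w : (Y w - chaos_sum xi p F (rV_fcoef Y) w) 0 i = 
    Y w 0 i - real_sum xi p F (fcoef xi p (fun w => Y w 0 i)) w.
  rewrite mxE [X in _ + X]mxE chaos_sum_coord; congr (_ - _).
  by apply: eq_bigr => a _; rewrite mxE.
have fE i : (fun w => (Y w - chaos_sum xi p F (rV_fcoef Y) w) 0 i) =
    (fun w => Y w 0 i - real_sum xi p F (fcoef xi p (fun w => Y w 0 i)) w).
  by apply/funext => w; exact: sE.
rewrite L2norm_rV => [|i]; last first.
  by rewrite fE; apply: sqintB; [exact: (Yc i).1|exact: sqint_real_sum].
rewrite lte_fin -[ltRHS]ger0_norm ?(ltW e0)// -sqrtr_sqr ltr_sqrt ?exprn_gt0//.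
apply: (@le_lt_trans _ _ (\sum_(i < n) (e ^+ 2 / n.+1%:R))).
  apply: ler_sum => i _; rewrite fE; apply/ltW/HF0; apply: fsubset_trans F0F.
  by apply: bigfcup_sup => //; exact: mem_index_enum.
rewrite sumr_const card_ord -[ltLHS]mulr_natl mulrCA gtr_pMr ?exprn_gt0//.
by rewrite ltr_pdivrMr// mul1r ltr_nat.
Qed.

End euclidean_chaos.

(** * Covariance operators and the Kalman gain *)

Section real_covariance.
Context d (T : measurableType d) (R : realType) (P : probability T R).
Implicit Types (f g : T -> R).
Local Notation mean := (mean P).
Local Notation sqint := (sqint P).

Definition rcov f g : R := mean (fun w => (f w - mean f) * (g w - mean g)).

Lemma sqint_center f : sqint f -> sqint (fun w => f w - mean f).
Proof. by move=> fs; apply: sqintB => //; exact: sqint_cst. Qed.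

Lemma rcovC f g : rcov f g = rcov g f.
Proof. by rewrite /rcov meanMC. Qed.

Lemma rcovBl f f' g : sqint f -> sqint f' -> sqint g ->
  rcov (fun w => f w - f' w) g = rcov f g - rcov f' g.
Proof.
move=> fs fs' gs; rewrite /rcov -meanMBl; [|exact: sqint_center..].
rewrite meanB; [|exact: sqint_intble..].
by congr mean; apply/funext => w; ring.
Qed.

Lemma rcovDl f f' g : sqint f -> sqint f' -> sqint g ->
  rcov (fun w => f w + f' w) g = rcov f g + rcov f' g.
Proof.
move=> fs fs' gs; rewrite /rcov -meanMDl; [|exact: sqint_center..].
rewrite meanD; [|exact: sqint_intble..].
by congr mean; apply/funext => w; ring.
Qed.

Lemma rcovZl a f g : sqint f -> sqint g -> rcov (fun w => a * f w) g = a * rcov f g.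
Proof.
move=> fs gs; rewrite /rcov -meanMZl; [|exact: sqint_center..].
rewrite meanZ; last exact: sqint_intble.
by congr mean; apply/funext => w; ring.
Qed.

Lemma rcov_sub f f' g g' : sqint f -> sqint f' -> sqint g -> sqint g' ->
  rcov f g - rcov f' g' = rcov (fun w => f w - f' w) g + rcov f' (fun w => g w - g' w).
Proof.
move=> fs fs' gs gs'; rewrite rcovBl// (rcovC f' (fun w => _ - _)) rcovBl//.
by rewrite (rcovC g f') (rcovC g' f') addrA subrK.
Qed.

Lemma rms_center_le f : sqint f -> rms P (fun w => f w - mean f) <= rms P f.
Proof.
move=> fs; rewrite ler_sqrt ?msq_ge0//.
rewrite (msqD (g := fun=> - mean f))//; last exact: sqint_cst.
rewrite meanMC meanZ; last exact: sqint_intble.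
have -> : msq P (fun=> - mean f) = mean f ^+ 2 by rewrite /msq mean_cst sqrrN.
by have := sqr_ge0 (mean f); nra.
Qed.

Lemma norm_rcov f g : sqint f -> sqint g -> `|rcov f g| <= rms P f * rms P g.
Proof.
move=> fs gs; apply: le_trans (norm_meanM (sqint_center fs) (sqint_center gs)) _.
by apply: ler_pM; rewrite ?rms_ge0// rms_center_le.
Qed.

Lemma rcov_eq0_ae f : sqint f -> rcov f f = 0 ->
  {ae P, forall w, f w = mean f}.
Proof.
move=> fs f0; have [mf0 if0] := sqint_center fs.
have mf2 : measurable_fun setT (fun w => ((f w - mean f) ^+ 2)%:E).
  by apply/measurable_EFinP; exact: measurable_funX.
have /(ae_eq_integral_abs P measurableT mf2) :
    (\int[P]_w `|((f w - mean f) ^+ 2)%:E|)%E = 0%E.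
  under eq_integral do rewrite gee0_abs ?lee_fin ?sqr_ge0//.
  by rewrite mean_EFin//; congr (_%:E).
apply: filterS => w /(_ I) [] /eqP; rewrite sqrf_eq0 subr_eq0.
by move=> /eqP.
Qed.

End real_covariance.

Section covariance.
Context (R : realType) (V : normedModType R) (ip : V -> V -> R) (c : R).
Hypothesis ipP : inner_product ip c.
Hypothesis V_complete : cauchy_complete V.
Context d (T : measurableType d) (P : probability T R) (n : nat).
Implicit Types (X : T -> V) (Y : T -> 'rV[R]_n) (x y : 'rV[R]_n) (v : V).
Local Notation nrm := (ipnorm ip).
Let eP := inner_product_edot R n.
Local Notation erms := (vrms (@edot R n) P).
Local Notation vrms := (vrms ip P).

Lemma ip_inj v v' : (forall u, ip v u = ip v' u) -> v = v'.
Proof.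
move=> H; apply/eqP; rewrite -subr_eq0; apply/eqP/(nrm_eq0 ipP).
by rewrite /ipnorm (ipBl ipP) H subrr sqrtr0.
Qed.

(** The only contact with the Bochner integrals inside [cov]. Linearity, norm bounds and
    perturbation estimates for [cov] are derived from this weak form through [ip_inj] and
    [nrm_bound]. *)
Lemma ip_cov X Y x v : vsq ip P X -> vsq (@edot R n) P Y ->
  ip (cov P X Y x) v = rcov P (fun w => edot (Y w) x) (fun w => ip (X w) v).
Proof.
move=> Xs Ys; have Xi := vsq_vint Xs; have Yi := vsq_vint Ys.
have X0 := vsqB ipP Xs (vsq_cst ip P (bochner P X)).
have Y0 := vsqB eP Ys (vsq_cst (@edot R n) P (bochner P Y)).
have ys := sqint_ip eP x Y0.
rewrite /cov (bochnerE ipP V_complete).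
  congr mean; apply/funext => w; rewrite (ipZl ipP) (ipBl ipP) (ipBl eP).
  rewrite (bochnerE ipP V_complete _ Xi) (bochnerE eP _ _ Yi)//.
  exact: cauchy_complete_rV.
split.
  by apply: smeasZ; [apply: measurable_smeas; exact: sqint_mfun ys|exact: X0.1].
have ax : sqint P (fun w => `|edot (Y w - bochner P Y) x|).
  apply: le_sqint (sqint_sq ys); first by apply: measurableT_comp => //; exact: sqint_mfun ys.
  by move=> w; rewrite real_normK// num_real.
apply: eq_integrable (sqintM ax X0.2) => // w _.
by rewrite /= (nrmZ ipP).
Qed.

Lemma cov_linear X Y a x y : vsq ip P X -> vsq (@edot R n) P Y ->
  cov P X Y (a *: x + y) = a *: cov P X Y x + cov P X Y y.
Proof.
move=> Xs Ys; apply: ip_inj => v; rewrite (ipPl ipP).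
have xs := sqint_ip eP x Ys; have ys := sqint_ip eP y Ys; have vs := sqint_ip ipP v Xs.
have E0 : (fun w => edot (Y w) (a *: x + y)) = (fun w => a * edot (Y w) x + edot (Y w) y).
  by apply/funext => w; rewrite edotC (ipPl eP) !(edotC (Y w)).
apply: (etrans (ip_cov _ v Xs Ys)); apply: (etrans (congr1 (rcov P ^~ _) E0)).
apply: (etrans (rcovDl (sqintZ a xs) ys vs)).
apply: (etrans (congr1 (+%R ^~ _) (rcovZl a xs vs))); apply: esym.
exact: (congr2 (fun b b' => a * b + b') (ip_cov x v Xs Ys) (ip_cov y v Xs Ys)).
Qed.

Lemma cov0 X Y : vsq ip P X -> vsq (@edot R n) P Y -> cov P X Y 0 = 0.
Proof.
move=> Xs Ys; have := cov_linear 1 0 0 Xs Ys.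
by rewrite scaler0 addr0 scale1r => E; apply: (addrI (cov P X Y 0)); rewrite addr0 -E.
Qed.

Lemma cov_sub X Y x y : vsq ip P X -> vsq (@edot R n) P Y ->
  cov P X Y (x - y) = cov P X Y x - cov P X Y y.
Proof. by move=> Xs Ys; rewrite addrC -scaleN1r cov_linear// scaleN1r addrC. Qed.

Lemma cov_sum X Y (I : Type) (s : seq I) (a : I -> R) (y : I -> 'rV[R]_n) :
  vsq ip P X -> vsq (@edot R n) P Y ->
  cov P X Y (\sum_(i <- s) a i *: y i) = \sum_(i <- s) a i *: cov P X Y (y i).
Proof.
move=> Xs Ys; elim: s => [|i s IH]; first by rewrite !big_nil cov0.
by rewrite !big_cons cov_linear// IH.
Qed.

Lemma nrm_cov_le X Y x : vsq ip P X -> vsq (@edot R n) P Y ->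
  nrm (cov P X Y x) <= vrms X * erms Y * enorm x.
Proof.
move=> Xs Ys; apply: (nrm_bound ipP) => [|v].
  by rewrite !mulr_ge0 ?vrms_ge0 ?sqrtr_ge0.
rewrite ip_cov// (le_trans (ler_norm _))//.
apply: le_trans (norm_rcov (sqint_ip eP x Ys) (sqint_ip ipP v Xs)) _.
rewrite [leRHS](_ : _ = (erms Y * enorm x) * (vrms X * nrm v)); last by ring.
by apply: ler_pM; rewrite ?rms_ge0//; [exact: (rms_ip_le eP)|exact: (rms_ip_le ipP)].
Qed.

(** By bilinearity, Cov(X, Y) - Cov(X', Y') = Cov(X, Y - Y') + Cov(X - X', Y'), and each term is
    bounded by a product of root mean squares. *)
Lemma nrm_cov_sub X X' Y Y' x : vsq ip P X -> vsq ip P X' ->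
  vsq (@edot R n) P Y -> vsq (@edot R n) P Y' ->
  nrm (cov P X Y x - cov P X' Y' x) <=
  (vrms X * erms (fun w => Y w - Y' w) + vrms (fun w => X w - X' w) * erms Y') * enorm x.
Proof.
move=> Xs Xs' Ys Ys'; have Xd := vsqB ipP Xs Xs'.
have Yd : vsq (@edot R n) P (fun w => Y w - Y' w) by exact: (vsqB eP Ys Ys').
have -> : cov P X Y x - cov P X' Y' x =
    cov P X (fun w => Y w - Y' w) x + cov P (fun w => X w - X' w) Y' x.
  apply: ip_inj => v; rewrite (ipBl ipP) (ipDl ipP).
  have E1 := congr2 (fun a b => a - b) (ip_cov x v Xs Ys) (ip_cov x v Xs' Ys').
  have E2 := congr2 +%R (ip_cov x v Xs Yd) (ip_cov x v Xd Ys').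
  have E3 := rcov_sub (sqint_ip eP x Ys) (sqint_ip eP x Ys') (sqint_ip ipP v Xs)
    (sqint_ip ipP v Xs').
  apply: (etrans E1); apply: (etrans E3); apply: etrans (esym E2).
  apply: congr2; [apply: (congr1 (rcov P ^~ _))|apply: (congr1 (rcov P _))].
    by apply/funext => w; rewrite (ipBl eP).
  by apply/funext => w; rewrite (ipBl ipP).
apply: (le_trans (nrmD ipP _ _)); rewrite mulrDl; apply: lerD; exact: nrm_cov_le.
Qed.

End covariance.

(** * The covariance matrix and perturbation of its inverse *)

Section covariance_matrix.
Context (R : realType) (n : nat) d (T : measurableType d) (P : probability T R).
Implicit Types (Z : T -> 'rV[R]_n) (x y : 'rV[R]_n) (A B : 'M[R]_n).
Let eP := inner_product_edot R n.
Let rVc := @cauchy_complete_rV R n.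
Local Notation vsq := (vsq (@edot R n) P).
Local Notation erms := (vrms (@edot R n) P).

Lemma row_cov_mx Z i : row i (cov_mx P Z) = cov P Z Z (delta_mx 0 i).
Proof. by apply/rowP => j; rewrite !mxE. Qed.

Lemma mulmx_cov_mx Z x : vsq Z -> x *m cov_mx P Z = cov P Z Z x.
Proof.
move=> Zs; rewrite mulmx_sum_row [x in RHS]row_sum_delta.
rewrite (cov_sum eP rVc _ (fun i => x 0 i) _ Zs Zs).
by apply: eq_bigr => i _; rewrite row_cov_mx.
Qed.

Lemma edot_cov_mx Z x : vsq Z ->
  edot (x *m cov_mx P Z) x = rcov P (fun w => edot (Z w) x) (fun w => edot (Z w) x).
Proof. by move=> Zs; rewrite mulmx_cov_mx// (ip_cov eP rVc _ _ Zs Zs). Qed.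

Lemma unitmx_ker0 A : (forall x, x *m A = 0 -> x = 0) -> A \in unitmx.
Proof.
move=> H; rewrite -row_free_unit -kermx_eq0; apply/rowV0P => v /sub_kermxP; exact: H.
Qed.

Lemma enormN x : enorm (- x) = enorm x.
Proof. exact: (nrmN eP x). Qed.

Lemma enormD x y : enorm (x + y) <= enorm x + enorm y.
Proof. exact: (nrmD eP x y). Qed.

(** The Frobenius norm, written by rows because the rows of [cov_mx] are the values of [cov] at unit
    vectors. *)
Definition fro A : R := Num.sqrt (\sum_i enorm (row i A) ^+ 2).

Lemma fro_ge0 A : 0 <= fro A. Proof. exact: sqrtr_ge0. Qed.

Lemma sqr_fro A : fro A ^+ 2 = \sum_i enorm (row i A) ^+ 2.
Proof. by rewrite sqr_sqrtr//; apply: sumr_ge0 => i _; exact: sqr_ge0. Qed.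

Lemma fro_le A (k : R) : 0 <= k -> (forall i, enorm (row i A) <= k) ->
  fro A <= Num.sqrt n%:R * k.
Proof.
move=> k0 H; rewrite -[k]ger0_norm// -sqrtr_sqr -sqrtrM// ler_sqrt ?mulr_ge0 ?sqr_ge0//.
rewrite mulr_natl -[X in _ *+ X]card_ord -sumr_const; apply: ler_sum => i _.
by apply: lerXn2r; rewrite ?nnegrE ?sqrtr_ge0.
Qed.

Lemma row_sub A B i : row i (A - B) = row i A - row i B.
Proof. by apply/rowP => j; rewrite !mxE. Qed.

(** Cauchy-Schwarz is applied to each column of [A], after regrouping the squared entries from rows
    to columns. *)
Lemma enorm_mulmx x A : enorm (x *m A) <= fro A * enorm x.
Proof.
rewrite -(ler_pXn2r (n := 2)) ?nnegrE ?mulr_ge0 ?fro_ge0 ?sqrtr_ge0//.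
rewrite exprMn sqr_fro sqr_enorm mulr_suml.
have -> : \sum_i enorm (row i A) ^+ 2 * enorm x ^+ 2 =
    \sum_j (\sum_i A i j ^+ 2) * enorm x ^+ 2.
  rewrite -!mulr_suml exchange_big/=; congr (_ * _); apply: eq_bigr => i _.
  by rewrite sqr_enorm; apply: eq_bigr => j _; rewrite mxE.
apply: ler_sum => j _.
have -> : (x *m A) 0 j = edot x (\row_i A i j).
  by rewrite mxE; apply: eq_bigr => i _; rewrite mxE.
have -> : \sum_i A i j ^+ 2 = enorm (\row_i A i j) ^+ 2.
  by rewrite sqr_enorm; apply: eq_bigr => i _; rewrite mxE.
rewrite -exprMn -(real_normK (num_real (edot _ _))).
rewrite lerXn2r ?nnegrE ?mulr_ge0 ?sqrtr_ge0// mulrC.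
exact: (ip_CS eP).
Qed.

Lemma fro_cov_sub Z Z' : vsq Z -> vsq Z' ->
  fro (cov_mx P Z' - cov_mx P Z) <=
  Num.sqrt n%:R * ((erms Z + erms Z') * erms (fun w => Z w - Z' w)).
Proof.
move=> Zs Zs'; set k := _ * erms _.
have k0 : 0 <= k by rewrite mulr_ge0 ?addr_ge0 ?vrms_ge0.
have H i : enorm (row i (cov_mx P Z' - cov_mx P Z)) <= k.
  have E : row i (cov_mx P Z' - cov_mx P Z) =
      cov P Z' Z' (delta_mx 0 i) - cov P Z Z (delta_mx 0 i).
    exact: etrans (row_sub _ _ _) (congr2 (fun a b => a - b) (row_cov_mx _ _) (row_cov_mx _ _)).
  apply: (le_trans (y := (erms Z' * erms (fun w => Z' w - Z w) + erms (fun w => Z' w - Z w) * erms Z) * enorm (delta_mx 0 i : 'rV[R]_n))).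
    apply: (le_trans _ (nrm_cov_sub eP rVc (delta_mx 0 i) Zs' Zs Zs' Zs)).
    rewrite E. exact: lexx.
  have -> : enorm (delta_mx 0 i : 'rV[R]_n) = 1.
    by rewrite /enorm edot_delta mxE !eqxx sqrtr1.
  have -> : erms (fun w => Z' w - Z w) = erms (fun w => Z w - Z' w) by exact: (vrmsC eP).
  by rewrite mulr1 /k; lra.
exact: fro_le.
Qed.

(* With [y = x B^-1], [x A^-1 - y = y (B - A) A^-1]. *)
Lemma invmx_perturb A B : A \in unitmx -> fro (B - A) * fro (invmx A) <= 2^-1 ->
  B \in unitmx /\ forall x, enorm (x *m invmx A - x *m invmx B) <=
    2 * fro (invmx A) ^+ 2 * fro (B - A) * enorm x.
Proof.
(* A contraction with factor 1/2. If [y B = 0], this map sends [y] to [- y], so [y = 0]; later, half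
   of the norm of [x B^-1] is absorbed into the left-hand side, whence the factor 2 in [y_le]. *)
move=> Au AB; have small y : enorm (y *m (B - A) *m invmx A) <= 2^-1 * enorm y.
  apply: (le_trans (enorm_mulmx _ _)).
  apply: (le_trans (ler_wpM2l (fro_ge0 _) (enorm_mulmx _ _))).
  by rewrite mulrA ler_wpM2r ?sqrtr_ge0// mulrC.
have Bu : B \in unitmx.
  apply: unitmx_ker0 => y yB; apply: (nrm_eq0 eP); apply/eqP.
  rewrite eq_le nrm_ge0 andbT; suff : enorm y <= 0 by [].
  by have := small y; rewrite mulmxBr yB sub0r mulNmx mulmxK// enormN; lra.
split=> // x; pose y := x *m invmx B.
have yE : x *m invmx A - y = y *m (B - A) *m invmx A.
  by rewrite mulmxBr mulmxBl mulmxKV// mulmxK.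
have y_le : enorm y <= 2 * fro (invmx A) * enorm x.
  have := enormD (x *m invmx A) (- (x *m invmx A - y)).
  have {1}<- : y = x *m invmx A + - (x *m invmx A - y) by rewrite opprB addrC subrK.
  rewrite enormN.
  by have := enorm_mulmx x (invmx A); have := small y; rewrite -yE; lra.
rewrite -/y yE; apply: (le_trans (enorm_mulmx _ _)).
apply: (le_trans (ler_wpM2l (fro_ge0 _) (enorm_mulmx _ _))).
rewrite (_ : 2 * _ * _ * _ = fro (invmx A) * (fro (B - A) * (2 * fro (invmx A) * enorm x))).
  by rewrite !ler_wpM2l ?fro_ge0.
by ring.
Qed.

End covariance_matrix.

(** * Boundedness and local Lipschitz dependence of the gain *)

Section kalman_gain.
Context (R : realType) (V : normedModType R) (ip : V -> V -> R) (c : R).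
Hypothesis ipP : inner_product ip c.
Hypothesis V_complete : cauchy_complete V.
Context d (T : measurableType d) (P : probability T R) (n : nat).
Implicit Types (X : T -> V) (Z : T -> 'rV[R]_n).
Local Notation nrm := (ipnorm ip).
Let eP := inner_product_edot R n.
Local Notation erms := (vrms (@edot R n) P).
Local Notation vrms := (vrms ip P).

Lemma kalman_gain_sub X Z x y : vsq ip P X -> vsq (@edot R n) P Z ->
  kalman_gain P X Z (x - y) = kalman_gain P X Z x - kalman_gain P X Z y.
Proof. by move=> Xs Zs; rewrite /kalman_gain mulmxBl (cov_sub ipP V_complete). Qed.

Lemma nrm_kalman_gain_le X Z y : vsq ip P X -> vsq (@edot R n) P Z ->
  nrm (kalman_gain P X Z y) <=
  vrms X * erms Z * fro (invmx (cov_mx P Z)) * enorm y.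
Proof.
move=> Xs Zs; apply: (le_trans (nrm_cov_le ipP V_complete _ Xs Zs)).
by rewrite -[leRHS]mulrA ler_wpM2l ?mulr_ge0 ?vrms_ge0// enorm_mulmx.
Qed.

Lemma kalman_gain_perturb X X' Z Z' y (r := fro (invmx (cov_mx P Z))) :
  vsq ip P X -> vsq ip P X' -> vsq (@edot R n) P Z -> vsq (@edot R n) P Z' ->
  cov_mx P Z \in unitmx -> fro (cov_mx P Z' - cov_mx P Z) * r <= 2^-1 ->
  nrm (kalman_gain P X Z y - kalman_gain P X' Z' y) <=
  ((vrms X * erms (fun w => Z w - Z' w) + vrms (fun w => X w - X' w) * erms Z') * r +
   vrms X' * erms Z' * (2 * r ^+ 2 * fro (cov_mx P Z' - cov_mx P Z))) * enorm y.
Proof.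
move=> Xs Xs' Zs Zs' Zu small; have [Zu' Zi] := invmx_perturb Zu small.
pose x := y *m invmx (cov_mx P Z); pose x' := y *m invmx (cov_mx P Z').
(* The change of the covariance operator at fixed [x] is separated from the change of its argument,
   which carries the perturbed inverse. *)
have E : kalman_gain P X Z y - kalman_gain P X' Z' y =
    (cov P X Z x - cov P X' Z' x) + cov P X' Z' (x - x').
  apply: esym; apply: (etrans (congr1 _ (cov_sub ipP V_complete x x' Xs' Zs'))).
  exact: subrKA.
have lexE (a b : R) : a = b -> a <= b by move=> ->.
apply: (le_trans (lexE _ _ (congr1 nrm E))); apply: (le_trans (nrmD ipP _ _)).
rewrite [leRHS]mulrDl; apply: lerD.
  apply: (le_trans (nrm_cov_sub ipP V_complete _ Xs Xs' Zs Zs')).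
  rewrite -[leRHS]mulrA ler_wpM2l ?enorm_mulmx//.
  by rewrite addr_ge0// mulr_ge0 ?vrms_ge0.
apply: (le_trans (nrm_cov_le ipP V_complete _ Xs' Zs')).
rewrite -[leRHS]mulrA; apply: ler_wpM2l; last exact: (Zi y).
by rewrite mulr_ge0 ?vrms_ge0.
Qed.

End kalman_gain.

(** * Invertibility of the observation covariance *)

(** Induction on the dimension, slicing along the first coordinate. If a later coefficient is
    nonzero, every slice is a hyperplane in one dimension less; otherwise the set is the product of
    the point [a / b ord0] with the whole space, and points are Lebesgue null. *)
Lemma lebesgue_tuple_hyperplane (R : realType) n (b : 'I_n -> R) (a : R) :
  (exists i, b i != 0) ->
  lebesgue_tuple R n [set t | \sum_(i < n) tnth t i * b i = a] = 0%E.
Proof.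
elim: n b a => [|n IH] b a; first by move=> [[]].
move=> [i bi].
rewrite /= /lebesgue_tupleS /pushforward.
set S := _ @^-1` _.
have SE x t : S (x, t) <-> x * b ord0 + \sum_(i < n) tnth t i * b (lift ord0 i) = a.
  rewrite /S/preimage/= big_ord_recl tnth0.
  rewrite (eq_bigr (fun i => tnth t i * b (lift ord0 i)))// => i0 _.
  by congr (_ * _); exact: tnthS.
have [[j bj]|nb] := pselect (exists j, b (lift ord0 j) != 0).
  rewrite /product_measure1; apply: integral0_eq => x _ /=.
  rewrite (_ : xsection S x = [set t | \sum_(i < n) tnth t i * b (lift ord0 i) = a - x * b ord0]).
    by apply: IH; exists j.
  apply/seteqP; split => t; rewrite /xsection/= inE.
    by move=> /SE <-; rewrite addrC addKr.
  by move=> tE; apply/SE; rewrite tE addrC subrK.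
have b0 j : b (lift ord0 j) = 0.
  by apply/eqP/negPn/negP => bj; apply: nb; exists j.
have bi0 : b ord0 != 0.
  by move: bi; case: (unliftP ord0 i) => [j ->|->//]; rewrite b0 eqxx.
have -> : S = [set a / b ord0] `*` setT.
  apply/seteqP; split => -[x t] /=.
    move/SE; rewrite big1 ?addr0 => [<-|j _]; last by rewrite b0 mulr0.
    by split => //; rewrite mulfK.
  by move=> [-> _]; apply/SE; rewrite big1 ?addr0 ?divfK// => j _; rewrite b0 mulr0.
rewrite product_measure1E//.
by rewrite [X in (X * _)%E](lebesgue_measure_set1 (a / b ord0)) mul0e.
Qed.

Lemma lebesgue_rV_hyperplane (R : realType) n (x : 'rV[R]_n) (a : R) :
  x != 0 -> lebesgue_rV [set e | edot e x = a] = 0%E.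
Proof.
move=> x0; rewrite /lebesgue_rV /pushforward.
have -> : row_of_tuple (n:=n) @^-1` [set e | edot e x = a] =
    [set t | \sum_(i < n) tnth t i * x 0 i = a].
  have E t : edot (row_of_tuple t) x = \sum_(i < n) tnth t i * x 0 i.
    by apply: eq_bigr => i _; rewrite mxE.
  by apply/seteqP; split => t /=; rewrite E.
apply: lebesgue_tuple_hyperplane.
apply: contrapT => nx; move/eqP: x0; apply; apply/rowP => i; rewrite mxE.
by apply/eqP/negPn/negP => xi; apply: nx; exists i.
Qed.

Lemma continuous_ip (R : realType) (V : normedModType R) (ip : V -> V -> R) (c : R)
  (ipP : inner_product ip c) (x : V) : continuous (fun y => ip y x).
Proof.
move=> y; apply/cvgrPdist_lt => e e0.
pose K := Num.sqrt c * ipnorm ip x + 1.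
have K0 : 0 < K by rewrite ltr_wpDl// mulr_ge0 ?sqrtr_ge0.
near=> z.
rewrite -(ipBl ipP); apply: le_lt_trans (ip_CS ipP _ _) _.
apply: (@le_lt_trans _ _ (`|y - z| * K)).
  apply: (@le_trans _ _ (Num.sqrt c * `|y - z| * ipnorm ip x)).
    by rewrite ler_wpM2r ?sqrtr_ge0// (nrm_le ipP).
  by rewrite mulrAC mulrC ler_wpM2l// lerDl.
rewrite -ltr_pdivlMr//.
near: z; apply: cvgr_dist_lt; [exact: cvg_id|by rewrite divr_gt0].
Unshelve. all: end_near.
Qed.

Section observation.
Context (R : realType) (dT : measure_display) (T : measurableType dT) (P : probability T R).
Context (X : normedModType R) (n : nat).
Context (mu0 : probability (borel X) R) (nu : probability (borel 'rV[R]_n) R).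
Context (U : {RV P >-> borel X}) (eps : {RV P >-> borel 'rV[R]_n}) (G : X -> 'rV[R]_n).
Hypothesis law_U_eps : forall C : set (borel X * borel 'rV[R]_n), measurable C ->
  P ((fun w => (U w, eps w)) @^-1` C) = (mu0 \x nu)%E C.
Context (c : R) (l : 'rV[R]_n -> R).
Hypothesis l_meas : measurable_fun [set: borel 'rV[R]_n] (l : borel 'rV[R]_n -> R).
Hypothesis nu_density : forall B : set (borel 'rV[R]_n), measurable B ->
  nu B = (\int[@lebesgue_rV R n]_(x in B) (c * expR (- l x))%:E)%E.
Hypothesis G_cont : continuous G.
Implicit Types (x : 'rV[R]_n).

Lemma continuous_edot x : continuous (fun y : 'rV[R]_n => edot y x).
Proof. exact: (@continuous_ip _ _ _ _ (inner_product_edot R n) x). Qed.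

Lemma measurable_edot x : measurable_fun [set: borel 'rV[R]_n] (fun y : borel 'rV[R]_n => edot y x).
Proof. exact: (continuous_borel_measurable (@continuous_edot x)). Qed.

Lemma measurable_hyperplane x (a : R) :
  measurable ([set e | edot e x = a] : set (borel 'rV[R]_n)).
Proof.
have := measurable_edot x measurableT (measurable_set1 a).
by rewrite setTI.
Qed.

Lemma nu_hyperplane x (a : R) : x != 0 -> nu [set e | edot e x = a] = 0%E.
Proof.
move=> x0; rewrite nu_density; last exact: measurable_hyperplane.
apply: null_set_integral.
- exact: measurable_hyperplane.
- apply/measurable_EFinP; apply: measurable_funM; first exact: measurable_cst.
  apply: (measurable_funS measurableT) => //.
  have mN : measurable_fun [set: borel 'rV[R]_n] (fun y : borel 'rV[R]_n => - l y).
    exact: measurable_funN.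
  exact: (measurableT_comp (@measurable_expR R) mN).
- exact: lebesgue_rV_hyperplane.
Qed.

(** By independence the law of the pair can be sliced at [U = u]: the slice is a hyperplane for
    [eps], null by the density. *)
Lemma observation_no_atom x (a : R) : x != 0 ->
  P [set w | edot (G (U w) + eps w) x = a] = 0%E.
Proof.
move=> x0; pose f (q : borel X * borel 'rV[R]_n) := edot (G q.1) x + edot q.2 x.
have mG : measurable_fun [set: borel X] (fun u : borel X => edot (G u) x).
  apply: (@continuous_borel_measurable R X (fun u => edot (G u) x)).
  by move=> u; apply: (@continuous_comp _ _ _ G (fun y => edot y x)); [exact: G_cont|exact: continuous_edot].
have mf : measurable_fun setT f.
  apply: measurable_funD.
    exact: (measurableT_comp mG measurable_fst).
  exact: (measurableT_comp (measurable_edot x) measurable_snd).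
have mC : measurable (f @^-1` [set a]).
  by rewrite -[X in measurable X]setTI; apply: mf => //; exact: measurable_set1.
have -> : [set w | edot (G (U w) + eps w) x = a] =
    (fun w => (U w, eps w)) @^-1` (f @^-1` [set a]).
  apply/seteqP; split => w /=; by rewrite /f/= (ipDl (inner_product_edot R n)).
apply: (etrans (law_U_eps mC)); rewrite /product_measure1.
apply: integral0_eq => u _ /=.
rewrite (_ : xsection _ u = [set e | edot e x = a - edot (G u) x]).
  exact: nu_hyperplane.
apply/seteqP; split => e; rewrite /xsection/= inE /f/=.
  by move=> <-; rewrite addrC addKr.
by move=> ->; rewrite addrC subrK.
Qed.

Hypothesis Z_vsq : vsq (@edot R n) P (fun w => G (U w) + eps w).

(** A nonzero vector in the kernel would have an almost surely constant pairing with the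
    observation, giving full mass to a null event. *)
Lemma cov_mx_observation_unit : cov_mx P (fun w => G (U w) + eps w) \in unitmx.
Proof.
apply: unitmx_ker0 => x xA; apply/eqP/negPn/negP => x0.
have := edot_cov_mx x Z_vsq; rewrite xA (ip0l (inner_product_edot R n)).
move=> /esym /(rcov_eq0_ae (sqint_ip (inner_product_edot R n) x Z_vsq)).
set a := mean _ _ => -[N [mN N0 sN]].
have na := observation_no_atom a x0.
have : P [set: T] = 0%E.
  apply/eqP; rewrite eq_le measure_ge0 andbT.
  have mS : measurable [set w | edot (G (U w) + eps w) x = a].
    have [m _] := sqint_ip (inner_product_edot R n) x Z_vsq.
    by have := m measurableT [set a] (measurable_set1 a); rewrite setTI.
  apply: (@le_trans _ _ (P (N `|` [set w | edot (G (U w) + eps w) x = a]))).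
    apply: le_measure; rewrite ?inE//; first exact: measurableU.
    move=> w _; have [|nw] := pselect (edot (G (U w) + eps w) x = a); first by right.
    by left; apply: sN.
  apply: (le_trans (measureU2 _ mN mS)).
  by rewrite [X in (X + _)%E](N0 : P N = 0%E) add0e [leLHS]na.
by rewrite probability_setT => /eqP; rewrite onee_eq0.
Qed.

End observation.

(** * Mean-square continuity of the forward map *)

Section mean_square_convergence.
Context d (T : measurableType d) (R : realType) (P : probability T R).

Lemma cvg_rms0 (f_ : nat -> T -> R) : msq P (f_ k) @[k --> \oo] --> (0 : R) ->
  rms P (f_ k) @[k --> \oo] --> (0 : R).
Proof.
move=> f0; apply/cvgr0Pnorm_lt => e e0.
have /cvgr0_norm_lt/(_ _ (exprn_gt0 2 e0)) := f0; apply: filterS => k /=.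
rewrite !ger0_norm ?msq_ge0 ?rms_ge0// => fe.
by rewrite -(ltr_pXn2r (n := 2)) ?nnegrE ?rms_ge0 ?(ltW e0)// sqr_rms.
Qed.

(** The bounds are summable, so the series of squares has finite mean and converges almost
    everywhere; its terms therefore tend to 0. *)
Lemma summable_msq_ae_cvg0 (f_ : nat -> T -> R) :
  (forall k, sqint P (f_ k)) -> (forall k, msq P (f_ k) <= 1 / (2 ^ k.+1)%:R) ->
  {ae P, forall w, f_ k w @[k --> \oo] --> (0 : R)}.
Proof.
move=> fs fk.
have mf k : measurable_fun setT (fun w => (f_ k w ^+ 2)%:E).
  by apply/measurable_EFinP; exact: intble_mfun (sqint_sq (fs k)).
have f0 k w : (0 <= (f_ k w ^+ 2)%:E)%E by rewrite lee_fin sqr_ge0.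
pose S w := (\sum_(0 <= k <oo) (f_ k w ^+ 2)%:E)%E.
have S_le : (\int[P]_w S w <= 1%:E)%E.
  rewrite integral_nneseries//.
  apply: le_trans (@epsilon_trick0 R 1 xpredT ler01).
  apply: lee_nneseries => [k _ _|k _]; first by apply: integral_ge0 => w _.
  rewrite mean_EFin; last exact: sqint_sq (fs k).
  by rewrite lee_fin; exact: fk.
have S0 w : (0 <= S w)%E by apply: nneseries_ge0.
have Si : P.-integrable setT S.
  apply/integrableP; split.
    by apply: ge0_emeasurable_sum => // k w _ _.
  under eq_integral do rewrite gee0_abs//.
  by rewrite (le_lt_trans S_le)// ltry.
apply: filterS (integrable_ae measurableT Si) => w /(_ I) Sfin.
have cs : cvgn (series (fun k => f_ k w ^+ 2)).
  apply: nondecreasing_is_cvgn.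
    apply/nondecreasing_seqP => k; rewrite /series/= big_nat_recr//= lerDl.
    exact: sqr_ge0.
  exists (fine (S w)) => _ [k _ <-].
  rewrite -lee_fin fineK// /series/= -sumEFin.
  by apply: nneseries_lim_ge => i _ _.
have c2 := cvg_series_cvg_0 cs.
apply/cvgr0Pnorm_lt => e e0.
have /cvgr0_norm_lt/(_ (e ^+ 2)) := c2; move=> /(_ (exprn_gt0 2 e0)).
apply: filterS => k /=; rewrite ger0_norm ?sqr_ge0// -(real_normK (num_real (f_ k w))).
by rewrite ltr_pXn2r// nnegrE ltW.
Qed.

(** Where [y > k], the excess over [k] is at most [y] and (y / k)^a >= 1. The extra moment is thus
    traded for decay in the truncation level. *)
Lemma le_sq_trunc (y k a : R) : 0 <= y -> 0 < k -> 0 < a ->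
  (Num.max (y - k) 0) ^+ 2 <= y `^ (2 + a) / k `^ a.
Proof.
move=> y0 k0 a0; have ka : 0 < k `^ a by rewrite powR_gt0.
case: (leP (y - k) 0) => yk.
  by rewrite expr0n/= divr_ge0// powR_ge0.
have y_gt : k < y by rewrite -subr_gt0.
have y_gt0 : 0 < y := lt_trans k0 y_gt.
rewrite ler_pdivlMr// powRD; last by rewrite (gt_eqF y_gt0) implybT.
apply: ler_pM; rewrite ?sqr_ge0 ?(ltW ka)//.
  by rewrite (powR_mulrn 2)// lerXn2r ?nnegrE ?(ltW yk)// lerBlDr lerDl ltW.
by apply: ge0_ler_powR; rewrite ?nnegrE ?(ltW a0) ?(ltW k0)// ltW.
Qed.

(** If [x > 2 * k], then [x] is at most [2 * k] plus the two excesses; using (s + t)^2 <= 2 s^2 + 2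
    t^2 twice gives the factors 2, 4 and 4. *)
Lemma sq_le_trunc (x y z k : R) : 0 <= x -> x <= y + z -> 0 <= k ->
  x ^+ 2 <= 2 * Num.min x (2 * k) ^+ 2 + 4 * Num.max (y - k) 0 ^+ 2 +
            4 * Num.max (z - k) 0 ^+ 2.
Proof.
move=> x0 xyz k0; case: (leP x (2 * k)) => xk.
  by have := sqr_ge0 (Num.max (y - k) 0); have := sqr_ge0 (Num.max (z - k) 0);
    have := sqr_ge0 x; lra.
set a := Num.max (y - k) 0; set b := Num.max (z - k) 0.
have a0 : 0 <= a by rewrite le_max lexx orbT.
have b0 : 0 <= b by rewrite le_max lexx orbT.
have ya : y <= k + a by rewrite -lerBlDl le_max lexx.
have zb : z <= k + b by rewrite -lerBlDl le_max lexx.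
have x_le : x <= 2 * k + a + b by lra.
apply: (@le_trans _ _ ((2 * k + a + b) ^+ 2)).
  by rewrite lerXn2r ?nnegrE ?addr_ge0 ?mulr_ge0.
by have := sqr_ge0 (2 * k - a - b); have := sqr_ge0 (a - b); nra.
Qed.

(** A form of Vitali's theorem. [D_] capped at a fixed level converges by bounded convergence; what
    exceeds the cap is bounded by the excess of [Y], small by integrability, and that of [Y_ n],
    small uniformly in [n] by the moment bound. *)
Lemma vitali_msq (D_ Y_ : nat -> T -> R) (Y : T -> R) (a C : R) : 0 < a ->
  (forall n, measurable_fun setT (D_ n)) -> (forall n, measurable_fun setT (Y_ n)) ->
  sqint P Y -> (forall w, 0 <= Y w) -> (forall n w, 0 <= Y_ n w) ->
  (forall n w, 0 <= D_ n w <= Y w + Y_ n w) ->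
  (forall n, (\int[P]_w (Y_ n w `^ (2 + a))%:E <= C%:E)%E) ->
  {ae P, forall w, D_ n w @[n --> \oo] --> (0 : R)} ->
  msq P (D_ n) @[n --> \oo] --> (0 : R).
Proof.
move=> a0 mD mY Ys Y0 Y_0 DY YC D0; have mY' := sqint_mfun Ys.
have mpow n : measurable_fun setT (fun w => Y_ n w `^ (2 + a)).
  exact: (measurableT_comp (measurable_powR (2 + a)) (mY n)).
have powi n : intble P (fun w => Y_ n w `^ (2 + a)).
  apply: ge0_intble => // [w|]; first exact: powR_ge0.
  by rewrite (le_lt_trans (YC n))// ltry.
have powC n : mean P (fun w => Y_ n w `^ (2 + a)) <= C.
  by have := YC n; rewrite mean_EFin.
have C0 : 0 <= C.
  by apply: le_trans (powC 0%N); apply: mean_ge0 => w; exact: powR_ge0.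
pose trc (f : T -> R) (k : R) w := Num.max (f w - k) 0.
have mtrc f k : measurable_fun setT f -> measurable_fun setT (trc f k).
  by move=> mf; apply: measurable_maxr; [exact: measurable_funB|exact: measurable_cst].
have trc0 f k w : 0 <= trc f k w by rewrite le_max lexx orbT.
have trcYi k : 0 <= k -> sqint P (trc Y k).
  move=> k0; apply: (le_sqint (mtrc _ _ mY') _ (sqint_sq Ys)) => w.
  rewrite lerXn2r ?nnegrE//.
  by rewrite ge_max Y0 lerBlDr lerDl k0.
have trcYn n k : 0 < k -> intble P (fun w => trc (Y_ n) k w ^+ 2) /\
    msq P (trc (Y_ n) k) <= C / k `^ a.
  move=> k0; have ii := intbleZ (k `^ a)^-1 (powi n).
  have le w : trc (Y_ n) k w ^+ 2 <= (k `^ a)^-1 * Y_ n w `^ (2 + a).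
    by rewrite mulrC; exact: le_sq_trunc.
  have i2 : intble P (fun w => trc (Y_ n) k w ^+ 2).
    apply: le_intble ii; first by apply: measurable_funX; exact: mtrc.
    by move=> w; rewrite ger0_norm ?sqr_ge0.
  split=> //; apply: (le_trans (le_mean i2 ii le)).
  by rewrite meanZ// mulrC ler_wpM2r ?powC// invr_ge0 powR_ge0.
have trcY0 : msq P (trc Y k%:R) @[k --> \oo] --> (0 : R).
  apply: (mean_dominated_cvg0 (g := fun w => Y w ^+ 2)) => [k||k w|].
  - by apply: measurable_funX; exact: mtrc.
  - exact: sqint_sq Ys.
  - rewrite ger0_norm ?sqr_ge0// lerXn2r ?nnegrE//.
    by rewrite ge_max Y0 lerBlDr lerDl ler0n.
  - apply: nearW => w; apply: cvg_near_cst.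
    exists (Num.Def.archi_bound (Y w)) => // k /= Yk.
    rewrite /trc max_r ?expr0n//= subr_le0.
    by rewrite (le_trans (ltW (archi_boundP (Y0 w))))// ler_nat.
(* The three pieces enter with weights 2, 4 and 4, so [e / 16] for each leaves 10/16 of [e]. *)
apply/cvgr0Pnorm_lt => e e0; have e16 : 0 < e / 16 by rewrite divr_gt0.
have /cvgr0_norm_lt/(_ _ e16)[N1 _ H1] := trcY0.
(* The level at which q^a equals [(C + 1) / (e / 16)]; [C + 1] instead of [C] makes the bound [ka]
   strict. *)
pose q := ((C + 1) / (e / 16)) `^ a^-1.
pose k := maxn N1 (Num.Def.archi_bound q).+1.
have q0 : 0 <= q by exact: powR_ge0.
have k0 : 0 < k%:R :> R by rewrite ltr0n leq_max ltnS orbT.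
have kq : q <= k%:R.
  rewrite (le_trans (ltW (archi_boundP q0)))// ler_nat leq_max; apply/orP; right.
  exact: leqnSn.
have ka : C / k%:R `^ a < e / 16.
  have ka0 : 0 < k%:R `^ a by rewrite powR_gt0.
  rewrite ltr_pdivrMr//; apply: (@lt_le_trans _ _ (C + 1)); first by rewrite ltrDl.
  rewrite mulrC -ler_pdivrMr//.
  have -> : (C + 1) / (e / 16) = q `^ a.
    by rewrite /q -powRrM mulVf ?gt_eqF// powRr1// divr_ge0 ?addr_ge0 ?(ltW e16).
  by apply: ge0_ler_powR; rewrite ?nnegrE ?(ltW a0) ?(ltW k0).
have k1 := H1 k (leq_maxl _ _); rewrite /= ger0_norm ?msq_ge0// in k1.
pose mn n w := Num.min (D_ n w) (2 * k%:R).
have mn0 n w : 0 <= mn n w.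
  by rewrite le_min (andP (DY n w)).1 mulr_ge0// ltW.
have mmn n : measurable_fun setT (mn n).
  by apply: measurable_minr => //; exact: measurable_cst.
have mnsi n : sqint P (mn n).
  apply: (le_sqint (mmn n) _ (sqint_sq (sqint_cst P (2 * k%:R)))) => w.
  by rewrite lerXn2r ?nnegrE ?mulr_ge0 ?(ltW k0)// ge_min lexx orbT.
have mn_cvg : msq P (mn n) @[n --> \oo] --> (0 : R).
  apply: (mean_dominated_cvg0 (g := fun=> (2 * k%:R) ^+ 2)) => [n||n w|].
  - exact: measurable_funX.
  - exact: intble_cst.
  - rewrite ger0_norm ?sqr_ge0// lerXn2r ?nnegrE ?mulr_ge0 ?(ltW k0)//.
    by rewrite ge_min lexx orbT.
  - apply: filterS D0 => w Dw.
    apply: (@squeeze_cvgr _ _ _ _ (fun=> 0) (fun n => D_ n w * D_ n w)).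
    + apply: nearW => n; rewrite sqr_ge0/= -expr2 lerXn2r ?nnegrE ?(andP (DY n w)).1//.
      by rewrite ge_min lexx.
    + exact: cvg_cst.
    + by rewrite -[X in _ --> X](mulr0 (0 : R)); apply: cvgM.
have /cvgr0_norm_lt/(_ _ e16) := mn_cvg; apply: filterS => n /=.
rewrite !ger0_norm ?msq_ge0// => mne.
have [Yi Yle] := trcYn n _ k0.
have i1 := intbleZ 2 (sqint_sq (mnsi n)).
have i2 := intbleZ 4 (sqint_sq (trcYi _ (ltW k0))).
have i3 := intbleZ 4 Yi.
have i12 := intbleD i1 i2; have i123 := intbleD i12 i3.
have Dle w : D_ n w ^+ 2 <= 2 * mn n w ^+ 2 + 4 * trc Y k%:R w ^+ 2 +
    4 * trc (Y_ n) k%:R w ^+ 2.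
  by have /andP[d0 dle] := DY n w; apply: sq_le_trunc => //; exact: ltW.
have iD : intble P (fun w => D_ n w ^+ 2).
  apply: le_intble i123; first exact: measurable_funX.
  by move=> w; rewrite ger0_norm ?sqr_ge0.
apply: (le_lt_trans (le_mean iD i123 Dle)).
rewrite meanD// meanD// !meanZ//; [|exact: sqint_sq (trcYi _ (ltW k0))|exact: sqint_sq (mnsi n)].
move: mne Yle k1; rewrite /msq; lra.
Qed.

End mean_square_convergence.

(** * Mean-square convergence of the images under the forward map *)

Section continuous_mapping.
Context (R : realType) (V : normedModType R) (ip : V -> V -> R) (c : R).
Hypothesis ipP : inner_product ip c.
Context d (T : measurableType d) (P : probability T R) (n : nat).
Context (U : T -> V) (U_ : nat -> T -> V) (G : V -> 'rV[R]_n) (a C : R).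
Hypothesis Us : vsq ip P U.
Hypothesis U_s : forall k, vsq ip P (U_ k).
Hypothesis U_cvg : vrms ip P (fun w => U w - U_ k w) @[k --> \oo] --> (0 : R).
Hypothesis G_cont : continuous G.
Hypothesis GU : vsq (@edot R n) P (fun w => G (U w)).
Hypothesis a0 : 0 < a.
Hypothesis GC : forall k, (\int[P]_w (enorm (G (U_ k w)) `^ (2 + a))%:E <= C%:E)%E.
Let eP := inner_product_edot R n.

Lemma powR_ge_sqr (y : R) : 0 <= y -> y ^+ 2 <= 1 + y `^ (2 + a).
Proof.
move=> y0; case: (leP y 1) => y1.
  by rewrite (@le_trans _ _ 1)// ?expr_le1// lerDl powR_ge0.
rewrite (@le_trans _ _ (y `^ (2 + a)))// ?lerDr ?ler01//.
rewrite -(powR_mulrn 2 y0) ler_powR ?(ltW y1)//.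
by rewrite lerDl ltW.
Qed.

Lemma vsq_comp_moment k : vsq (@edot R n) P (fun w => G (U_ k w)).
Proof.
have Gm : smeas (fun w => G (U_ k w)) by apply: smeas_comp => //; exact: (U_s k).1.
split=> //; have mG := measurable_nrm eP Gm.
have pi : intble P (fun w => enorm (G (U_ k w)) `^ (2 + a)).
  apply: ge0_intble => [|w|]; [|exact: powR_ge0|].
    exact: (measurableT_comp (measurable_powR (2 + a)) mG).
  by rewrite (le_lt_trans (GC k))// ltry.
apply: (le_sqint mG _ (intbleD (intble_cst P 1) pi)) => w.
by apply: powR_ge_sqr; exact: sqrtr_ge0.
Qed.

(* Otherwise some subsequence stays away from 0, although along a further one
   [U_] converges to [U] almost surely. *)
Lemma continuous_mapping_rms :
  vrms (@edot R n) P (fun w => G (U w) - G (U_ k w)) @[k --> \oo] --> (0 : R).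
Proof.
pose D k w := enorm (G (U w) - G (U_ k w)).
have Ds k : sqint P (D k) := (vsqB eP GU (vsq_comp_moment k)).2.
have dU k : sqint P (fun w => ipnorm ip (U w - U_ k w)) := (vsqB ipP Us (U_s k)).2.
suff D0 : msq P (D k) @[k --> \oo] --> (0 : R).
  exact: cvg_rms0.
apply: contrapT => nD.
have [e e0 De] : exists2 e : R, 0 < e & forall N, exists2 k, (N <= k)%N & e <= msq P (D k).
  apply: contrapT => nE; apply: nD; apply/cvgr0Pnorm_lt => e e0.
  apply: contrapT => nN; apply: nE; exists e => // N.
  apply: contrapT => nk; apply: nN; exists N => // k /= Nk.
  rewrite ger0_norm ?msq_ge0// ltNge; apply/negP => ek; apply: nk.
  by exists k.
have msqU : msq P (fun w => ipnorm ip (U w - U_ k w)) @[k --> \oo] --> (0 : R).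
  have E : (fun k => msq P (fun w => ipnorm ip (U w - U_ k w))) =
      (fun k => vrms ip P (fun w => U w - U_ k w) * vrms ip P (fun w => U w - U_ k w)).
    by apply/funext => k; rewrite -expr2 -sqr_rms.
  by rewrite E; have := cvgM U_cvg U_cvg; rewrite mulr0; apply.
(* An index late enough for the [j]-th geometric bound at which [D] is still at least [e]. Only
   these two properties enter, so [phi] need not be monotone. *)
have phi_ex j : exists k, e <= msq P (D k) /\
    msq P (fun w => ipnorm ip (U w - U_ k w)) <= 1 / (2 ^ j.+1)%:R.
  have j0 : 0 < 1 / (2 ^ j.+1)%:R :> R by rewrite divr_gt0// ltr0n expn_gt0.
  have /cvgr0_norm_lt/(_ _ j0)[N _ HN] := msqU.
  have [k Nk ek] := De N; exists k; split=> //.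
  by have := HN k Nk; rewrite /= ger0_norm ?msq_ge0// => /ltW.
have [phi phiP] := choice phi_ex.
have ae0 := summable_msq_ae_cvg0 (fun j => dU (phi j)) (fun j => (phiP j).2).
have D0' : msq P (D (phi j)) @[j --> \oo] --> (0 : R).
  have DY j w : 0 <= D (phi j) w <= enorm (G (U w)) + enorm (G (U_ (phi j) w)).
    rewrite /D; apply/andP; split; first exact: sqrtr_ge0.
    by apply: (le_trans (enormD _ _)); rewrite enormN.
  have Dw : {ae P, forall w, D (phi j) w @[j --> \oo] --> (0 : R)}.
    apply: filterS ae0 => w Uw.
    have Ucv : U_ (phi j) w @[j --> \oo] --> U w.
      apply/cvgrPdist_lt => r r0.
      have /cvgr0_norm_lt/(_ _ r0) := Uw; apply: filterS => j /=.
      rewrite ger0_norm ?nrm_ge0//; exact: le_lt_trans (ler_norm_nrm ipP _).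
    apply: (cvg_nrm0 eP).
    by apply: (@continuous_cvg _ _ _ _ _ _ G); [exact: G_cont|exact: Ucv].
  exact: (vitali_msq a0 (fun j => sqint_mfun (Ds (phi j)))
    (fun j => sqint_mfun (vsq_comp_moment (phi j)).2) GU.2 (fun w => sqrtr_ge0 _)
    (fun j w => sqrtr_ge0 _) DY (fun j => GC (phi j)) Dw).
have /cvgr0_norm_lt/(_ _ e0)[N _ HN] := D0'.
have := le_lt_trans (phiP N).1 (le_lt_trans (ler_norm _) (HN N (leqnn N))).
by rewrite ltxx.
Qed.

End continuous_mapping.

(** * Convergence of the filter *)

Section exhaustion.
Context (J : nat -> {fset multi_index}).
Hypothesis J_mono : forall m n, (m <= n)%N -> (J m `<=` J n)%fset.
Hypothesis J_exhaustive : forall a, exists n, a \in J n.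

Lemma fset_exhausted (F0 : {fset multi_index}) :
  exists N, forall n, (N <= n)%N -> (F0 `<=` J n)%fset.
Proof.
have [N_ HN] := choice J_exhaustive.
exists (\max_(a <- F0) N_ a)%N => n Nn; apply/fsubsetP => a aF.
apply: (fsubsetP (J_mono _) a (HN a)); apply: leq_trans Nn.
by apply: leq_bigmax_seq.
Qed.

Context (R : realType) (V : normedModType R) (ip : V -> V -> R) (c : R).
Hypothesis ipP : inner_product ip c.
Context d (T : measurableType d) (P : probability T R).
Context (xi : nat -> {RV P >-> R}) (xi_indep : independent xi).
Context (p : nat -> nat -> {poly R}) (p_0 : forall m, p m 0%N = 1).
Context (p_cons : forall m, complete_orthonormal (distribution P (xi m)) (p m)).

Lemma chaos_expansion_vsq (Y : T -> V) x : smeas Y ->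
  chaos_expansion xi p (ipnorm ip) Y x -> vsq ip P Y.
Proof.
move=> Ym /(_ 1 ltr01)[F /(_ F (fsubset_refl F))].
have Ss := vsq_chaos_sum ipP xi_indep p_0 p_cons F x.
move=> /(L2norm_lt_vsq ipP (smeasB Ym Ss.1))[Ds _].
have := vsqD ipP Ds Ss; congr vsq.
by apply/funext => w; rewrite subrK.
Qed.

Lemma chaos_expansion_vrms_cvg0 (Y : T -> V) x : smeas Y ->
  chaos_expansion xi p (ipnorm ip) Y x ->
  vrms ip P (fun w => Y w - chaos_sum xi p (J n) x w) @[n --> \oo] --> (0 : R).
Proof.
move=> Ym Yx; apply/cvgr0Pnorm_lt => e e0; have [F0 HF] := Yx e e0.
have [N HN] := fset_exhausted F0; exists N => // n /= Nn.
have Ss := vsq_chaos_sum ipP xi_indep p_0 p_cons (J n) x.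
have [_] := L2norm_lt_vsq ipP (smeasB Ym Ss.1) (HF _ (HN n Nn)).
by rewrite ger0_norm ?vrms_ge0.
Qed.

End exhaustion.

(** * Projections of row-vector variables, coordinate by coordinate *)

Section coordinates.
Context (R : realType) (n : nat).
Context d (T : measurableType d) (P : probability T R).
Context (xi : nat -> {RV P >-> R}) (xi_indep : independent xi).
Context (p : nat -> nat -> {poly R}) (p_0 : forall m, p m 0%N = 1).
Context (p_cons : forall m, complete_orthonormal (distribution P (xi m)) (p m)).
Implicit Types (Y : T -> 'rV[R]_n) (F : {fset multi_index}).
Let eP := inner_product_edot R n.
Local Notation evsq := (vsq (@edot R n) P).
Local Notation erms := (vrms (@edot R n) P).

Lemma sqint_coord Y i : evsq Y -> sqint P (fun w => Y w 0 i).
Proof.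
move=> Ys; have := sqint_ip eP (delta_mx 0 i) Ys; congr sqint.
by apply/funext => w; rewrite edot_delta.
Qed.

Lemma sqr_vrms_rV Y : evsq Y -> erms Y ^+ 2 = \sum_(i < n) msq P (fun w => Y w 0 i).
Proof.
move=> Ys; rewrite sqr_rms /msq -mean_sum => [|i]; last exact: sqint_sq (sqint_coord i Ys).
by congr mean; apply/funext => w; exact: sqr_enorm.
Qed.

Lemma msq_coord_le Y i : evsq Y -> msq P (fun w => Y w 0 i) <= erms Y ^+ 2.
Proof.
move=> Ys; rewrite (sqr_vrms_rV Ys) (bigD1 i)//= lerDl sumr_ge0// => k _.
exact: msq_ge0.
Qed.

Lemma vrms_le_coord Y Y' : evsq Y -> evsq Y' ->
  (forall i, msq P (fun w => Y w 0 i) <= msq P (fun w => Y' w 0 i)) -> erms Y <= erms Y'.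
Proof.
move=> Ys Ys' H; rewrite -(ler_pXn2r (n := 2)) ?nnegrE ?vrms_ge0//.
by rewrite (sqr_vrms_rV Ys) (sqr_vrms_rV Ys'); apply: ler_sum.
Qed.

Lemma chaos_expansion_in_chaos Y x i : smeas Y ->
  chaos_expansion xi p (@enorm R n) Y x -> in_chaos xi p (fun w => Y w 0 i).
Proof.
move=> Ym Yx; have Ys := chaos_expansion_vsq eP xi_indep p_0 p_cons Ym Yx.
split; first exact: sqint_coord.
move=> e e0; have se0 : 0 < Num.sqrt e by rewrite sqrtr_gt0.
have [F /(_ F (fsubset_refl F)) YF] := Yx _ se0.
have Ss := vsq_chaos_sum eP xi_indep p_0 p_cons F x.
have [Ds De] := L2norm_lt_vsq eP (smeasB Ym Ss.1) YF.
exists F, (fun a => x a 0 i).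
have := msq_coord_le i Ds.
have -> : (fun w => (Y w - chaos_sum xi p F x w) 0 i) =
    (fun w => Y w 0 i - real_sum xi p F (fun a => x a 0 i) w).
  by apply/funext => w; rewrite mxE [X in _ + X]mxE chaos_sum_coord.
move=> /le_lt_trans; apply.
by rewrite -(sqr_sqrtr (ltW e0)) ltrXn2r// ?nnegrE ?vrms_ge0// ltW.
Qed.

(** By linearity of Fourier coefficients the left-hand difference is the truncation of [Y - Y'], to
    which Bessel's inequality applies in each coordinate. *)
Lemma vrms_chaos_sum_sub F Y Y' : evsq Y -> evsq Y' ->
  erms (fun w => chaos_sum xi p F (rV_fcoef xi p Y) w - chaos_sum xi p F (rV_fcoef xi p Y') w)
  <= erms (fun w => Y w - Y' w).
Proof.
move=> Ys Ys'; have D := vsqB eP Ys Ys'.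
have S := vsqB eP (vsq_chaos_sum eP xi_indep p_0 p_cons F (rV_fcoef xi p Y))
  (vsq_chaos_sum eP xi_indep p_0 p_cons F (rV_fcoef xi p Y')).
apply: (vrms_le_coord S D) => i.
have Di := sqintB (sqint_coord i Ys) (sqint_coord i Ys').
have -> : (fun w => (Y w - Y' w) 0 i) = (fun w => Y w 0 i - Y' w 0 i).
  by apply/funext => w; rewrite mxE [X in _ + X]mxE.
apply: le_trans (bessel xi_indep p_0 p_cons F Di).
have -> // : (fun w => (chaos_sum xi p F (rV_fcoef xi p Y) w -
    chaos_sum xi p F (rV_fcoef xi p Y') w) 0 i) =
    real_sum xi p F (fcoef xi p (fun w => Y w 0 i - Y' w 0 i)).
apply/funext => w; rewrite mxE [X in _ + X]mxE !chaos_sum_coord /real_sum -sumrB.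
apply: eq_bigr => a _.
rewrite (fcoefB xi_indep p_0 p_cons _ (sqint_coord i Ys) (sqint_coord i Ys')) mulrBl.
by rewrite /rV_fcoef !mxE.
Qed.

Context (X : normedModType R) (G : X -> 'rV[R]_n).
Hypothesis G_cont : continuous G.

(** A finite chaos sum is strongly measurable for sigma(xi), being a polynomial expression in the
    [xi m], and continuity of [G] preserves this. The space [T'] below is [T] with that smaller
    sigma-algebra. *)
Lemma in_chaos_comp_chaos_sum F (u : multi_index -> X) i :
  evsq (fun w => G (chaos_sum xi p F u w)) ->
  in_chaos xi p (fun w => G (chaos_sum xi p F u w) 0 i).
Proof.
move=> Gs; apply: (in_chaos_measurable xi_indep p_0 p_cons); last exact: sqint_coord.
pose T' := g_sigma_algebraType (rectangles xi).
have mxi m : measurable_fun setT (xi m : T' -> R).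
  move=> _ B mB; rewrite setTI; apply: sub_sigma_algebra.
  exists [fset m]%fset, (fun=> B); split => //.
  apply/seteqP; split => [w Bw k /=|w].
    by rewrite inE => /eqP ->.
  by move=> /(_ m); apply; rewrite /= inE.
have mPa a : measurable_fun setT (chaos_poly xi p a : T' -> R).
  apply: measurable_prod => m _ /=.
  have H1 : measurable_fun [set: R] (horner (p m (a m))) by exact: measurable_poly.
  exact: (measurableT_comp H1 (mxi m)).
have Sm : smeas (chaos_sum xi p F u : T' -> X).
  apply: smeas_sum => a; apply: smeasZ; last exact: smeas_cst.
  exact: measurable_smeas.
have Gm : smeas ((fun w => G (chaos_sum xi p F u w)) : T' -> 'rV[R]_n).
  exact: smeas_comp.
apply: smeas_measurable.
have -> : (fun w => G (chaos_sum xi p F u w) 0 i) =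
    (fun w => edot (G (chaos_sum xi p F u w)) (delta_mx 0 i)).
  by apply/funext => w; rewrite edot_delta.
apply: (@smeas_comp _ T' _ R (fun y => edot y (delta_mx 0 i))) => //.
exact: (@continuous_ip _ _ _ _ eP).
Qed.

End coordinates.

Section kalman_gain_linear.
Context (R : realType) (V : normedModType R) (ip : V -> V -> R) (c : R).
Hypothesis ipP : inner_product ip c.
Hypothesis V_complete : cauchy_complete V.
Context d (T : measurableType d) (P : probability T R) (n : nat).
Context (X : T -> V) (Z : T -> 'rV[R]_n).
Hypothesis Xs : vsq ip P X.
Hypothesis Zs : vsq (@edot R n) P Z.
Let eP := inner_product_edot R n.

Lemma kalman_gain_sum (I : Type) (s : seq I) (a : I -> R) (y : I -> 'rV[R]_n) :
  kalman_gain P X Z (\sum_(i <- s) a i *: y i) = \sum_(i <- s) a i *: kalman_gain P X Z (y i).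
Proof.
rewrite /kalman_gain mulmx_suml -(cov_sum ipP V_complete _ _ _ Xs Zs).
by congr cov; apply: eq_bigr => i _; rewrite scalemxAl.
Qed.

Lemma vsq_kalman_gain (Y : T -> 'rV[R]_n) : vsq (@edot R n) P Y ->
  vsq ip P (fun w => kalman_gain P X Z (Y w)).
Proof.
move=> Ys.
have -> : (fun w => kalman_gain P X Z (Y w)) =
    (fun w => \sum_(i < n) Y w 0 i *: kalman_gain P X Z (delta_mx 0 i)).
  by apply/funext => w; rewrite {1}(row_sum_delta (Y w)) kalman_gain_sum.
by apply: (vsq_sum ipP) => i; apply: (vsqZr ipP); exact: sqint_coord.
Qed.

Lemma vsq_analysis z : vsq ip P (analysis_variable P X Z z).
Proof. exact: (vsqD ipP Xs (vsq_kalman_gain (vsqB eP (vsq_cst _ _ z) Zs))). Qed.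

End kalman_gain_linear.

Lemma vrms_sub_le (R : realType) (V : normedModType R) (ip : V -> V -> R) (c : R)
    (ipP : inner_product ip c) d (T : measurableType d) (P : probability T R) (f g : T -> V) :
  vsq ip P f -> vsq ip P g -> vrms ip P g <= vrms ip P f + vrms ip P (fun w => f w - g w).
Proof.
move=> fs gs; have {1}-> : g = (fun w => f w - (f w - g w)).
  by apply/funext => w; rewrite opprB addrC subrK.
exact: (vrmsB ipP fs (vsqB ipP fs gs)).
Qed.

Lemma eq_ler (R : realType) (a b : R) : a = b -> a <= b.
Proof. by move=> ->. Qed.

Lemma vrms_le_comb d (T : measurableType d) (R : realType) (P : probability T R)
    (f a b e : T -> R) (m k : R) : sqint P f -> sqint P a -> sqint P b -> sqint P e ->
  0 <= m -> 0 <= k -> (forall w, f w <= a w + (m * b w + k * e w)) -> (forall w, 0 <= f w) ->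
  rms P f <= rms P a + (m * rms P b + k * rms P e).
Proof.
move=> fs as_ bs es m0 k0 le_f f0.
have bs' := sqintZ m bs; have es' := sqintZ k es; have s2 := sqintD bs' es'.
apply: (@le_trans _ _ (rms P (fun w => a w + (m * b w + k * e w)))).
  apply: (le_rms fs (sqintD as_ s2)) => w; rewrite ger0_norm//.
  exact: le_trans (le_f w) (ler_norm _).
apply: (le_trans (rmsD as_ s2)); rewrite lerD2l.
apply: (le_trans (rmsD bs' es')).
by rewrite (rmsZ _ bs) (rmsZ _ es) !ger0_norm.
Qed.

(** The arithmetic behind [analysis_bound]: [s] stands for the root mean square of [z - Z'], [fr]
    for the perturbation of the covariance matrix, and both are eliminated, together with [vX'] and
    [vZ'], in favour of unperturbed quantities. *)
Lemma analysis_bound_arith (R : realType) (vX vZ vX' vZ' dX dZ r fr kappa zn s : R) :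
  0 <= vX -> 0 <= vZ -> 0 <= vX' -> 0 <= vZ' -> 0 <= dX -> 0 <= dZ -> 0 <= r -> 0 <= fr ->
  0 <= s -> vX' <= vX + 1 -> vZ' <= vZ + 1 -> fr <= kappa * dZ -> s <= zn + (vZ + 1) ->
  0 <= kappa ->
  dX + (vX * vZ * r * dZ + ((vX * dZ + dX * vZ') * r + vX' * vZ' * (2 * r ^+ 2 * fr)) * s) <=
  (1 + vX * vZ * r + ((vX + (vZ + 1)) * r + (vX + 1) * (vZ + 1) * (2 * r ^+ 2 * kappa)) *
    (zn + (vZ + 1))) * (dX + dZ).
Proof.
move=> vX0 vZ0 vX'0 vZ'0 dX0 dZ0 r0 fr0 s0 hX hZ hf hs kap0.
set k := (vX * dZ + dX * vZ') * r + _.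
set q := (vX + (vZ + 1)) * r + _.
have rr0 : 0 <= 2 * r ^+ 2 by rewrite mulr_ge0 ?sqr_ge0.
have k0 : 0 <= k.
  by apply: addr_ge0; do ?[apply: addr_ge0 | apply: mulr_ge0 | exact: sqr_ge0].
have kq : k <= q * (dX + dZ).
  rewrite /k /q [leRHS]mulrDl; apply: lerD.
    rewrite [leRHS]mulrAC ler_wpM2r//.
    have := ler_wpM2l dX0 hZ; have := mulr_ge0 vX0 dX0; have := mulr_ge0 vZ0 dZ0.
    by move: vZ0 dZ0 => *; nra.
  rewrite -[leRHS]mulrA; apply: ler_pM; [exact: mulr_ge0|exact: mulr_ge0|exact: ler_pM|].
  rewrite -[leRHS]mulrA ler_wpM2l//; apply: (le_trans hf).
  by rewrite ler_wpM2l// lerDr.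
have := ler_pM k0 s0 kq hs; have := mulr_ge0 (mulr_ge0 (mulr_ge0 vX0 vZ0) r0) dX0.
rewrite [X in _ -> _ -> _ <= X](_ : _ = dX + dZ + vX * vZ * r * dX + vX * vZ * r * dZ +
  q * (dX + dZ) * (zn + (vZ + 1))); last by ring.
by lra.
Qed.

(** * Error of the analysis step with an explicit constant *)

Section analysis_error.
Context (R : realType) (V : normedModType R) (ip : V -> V -> R) (c : R).
Hypothesis ipP : inner_product ip c.
Hypothesis V_complete : cauchy_complete V.
Context d (T : measurableType d) (P : probability T R) (n : nat).
Context (X X' : T -> V) (Z Z' : T -> 'rV[R]_n) (z : 'rV[R]_n).
Hypothesis Xs : vsq ip P X.
Hypothesis Xs' : vsq ip P X'.
Hypothesis Zs : vsq (@edot R n) P Z.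
Hypothesis Zs' : vsq (@edot R n) P Z'.
Let eP := inner_product_edot R n.
Local Notation nrm := (ipnorm ip).
Local Notation erms := (vrms (@edot R n) P).
Local Notation vrms := (vrms ip P).
Let r := fro (invmx (cov_mx P Z)).
(** Lipschitz constant of the covariance matrix near [Z]: [erms Z + erms Z' <= 2 * erms Z + 1] when
    [dZ <= 1]. *)
Let kappa := Num.sqrt n%:R * (2 * erms Z + 1).
Let dX := vrms (fun w => X w - X' w).
Let dZ := erms (fun w => Z w - Z' w).

Let dXs : vsq ip P (fun w => X w - X' w) := vsqB ipP Xs Xs'.
Let dZs : vsq (@edot R n) P (fun w => Z w - Z' w) := vsqB eP Zs Zs'.

Lemma fro_cov_le : dZ <= 1 -> fro (cov_mx P Z' - cov_mx P Z) <= kappa * dZ.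
Proof.
move=> dZ1; apply: (le_trans (fro_cov_sub Zs Zs')).
rewrite /kappa -mulrA ler_wpM2l ?sqrtr_ge0// ler_wpM2r ?vrms_ge0//.
have : erms Z' <= erms Z + dZ by exact: (vrms_sub_le eP Zs Zs').
by lra.
Qed.

Lemma analysis_pointwise_le w (k := ((vrms X * dZ + dX * erms Z') * r +
     vrms X' * erms Z' * (2 * r ^+ 2 * fro (cov_mx P Z' - cov_mx P Z)))) :
  cov_mx P Z \in unitmx -> fro (cov_mx P Z' - cov_mx P Z) * r <= 2^-1 ->
  nrm (analysis_variable P X Z z w - analysis_variable P X' Z' z w) <=
  nrm (X w - X' w) + (vrms X * erms Z * r * enorm (Z w - Z' w) + k * enorm (z - Z' w)).
Proof.
move=> Zu small.
have E : analysis_variable P X Z z w - analysis_variable P X' Z' z w =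
    (X w - X' w) + (- kalman_gain P X Z (Z w - Z' w) +
    (kalman_gain P X Z (z - Z' w) - kalman_gain P X' Z' (z - Z' w))).
  have K : kalman_gain P X Z (z - Z w) =
      - kalman_gain P X Z (Z w - Z' w) + kalman_gain P X Z (z - Z' w).
    apply: esym; rewrite addrC.
    apply: (etrans (esym (kalman_gain_sub ipP V_complete _ _ Xs Zs))).
    by congr kalman_gain; rewrite opprB addrA subrK.
  apply: (etrans (congr1 (fun v => X w + v - analysis_variable P X' Z' z w) K)).
  by rewrite opprD addrACA -[X in _ + X]addrA.
apply: (le_trans (eq_ler (congr1 nrm E))).
apply: (le_trans (nrmD ipP _ _)); apply: lerD; first exact: lexx.
apply: (le_trans (nrmD ipP _ _)); apply: lerD.
  apply: (le_trans (eq_ler (nrmN ipP _))).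
  exact: (nrm_kalman_gain_le ipP V_complete _ Xs Zs).
exact: (kalman_gain_perturb ipP V_complete _ Xs Xs' Zs Zs' Zu small).
Qed.

(** One summand for each term of the error decomposition: 1 for [X - X'], a bound on the gain for
    [Z - Z'], and a Lipschitz constant of the gain times a bound on [z - Z']. Only the unperturbed
    [X] and [Z] enter, so a single constant serves the whole sequence. *)
Definition analysis_bound : R := 1 + vrms X * erms Z * r +
  ((vrms X + (erms Z + 1)) * r + (vrms X + 1) * (erms Z + 1) * (2 * r ^+ 2 * kappa)) *
  (enorm z + (erms Z + 1)).

Lemma analysis_error_le : cov_mx P Z \in unitmx ->
  dX <= 1 -> dZ <= 1 -> kappa * dZ * r <= 2^-1 ->
  vrms (fun w => analysis_variable P X Z z w - analysis_variable P X' Z' z w) <=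
  analysis_bound * (dX + dZ).
Proof.
move=> Zu dX1 dZ1 dZk.
have r0 : 0 <= r := fro_ge0 _.
have frle := fro_cov_le dZ1.
have fr0 : 0 <= fro (cov_mx P Z' - cov_mx P Z) := fro_ge0 _.
have small : fro (cov_mx P Z' - cov_mx P Z) * r <= 2^-1.
  by apply: le_trans dZk; rewrite ler_wpM2r.
have vX'le : vrms X' <= vrms X + 1.
  by apply: le_trans (vrms_sub_le ipP Xs Xs') _; rewrite lerD2l.
have vZ'le : erms Z' <= erms Z + 1.
  by apply: le_trans (vrms_sub_le eP Zs Zs') _; rewrite lerD2l.
have zs : vsq (@edot R n) P (fun w => z - Z' w) := vsqB eP (vsq_cst _ _ z) Zs'.
have zle : erms (fun w => z - Z' w) <= enorm z + (erms Z + 1).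
  apply: (le_trans (vrmsB eP (vsq_cst _ _ z) Zs')); apply: lerD => //.
  by rewrite vrms_cst.
have A := vsqB ipP (vsq_analysis ipP V_complete Xs Zs z)
  (vsq_analysis ipP V_complete Xs' Zs' z).
pose m := vrms X * erms Z * r.
pose k := (vrms X * dZ + dX * erms Z') * r +
  vrms X' * erms Z' * (2 * r ^+ 2 * fro (cov_mx P Z' - cov_mx P Z)).
have m0 : 0 <= m by exact: (mulr_ge0 (mulr_ge0 (vrms_ge0 _ _ _) (vrms_ge0 _ _ _)) r0).
have k0 : 0 <= k.
  apply: addr_ge0.
    apply: mulr_ge0 r0; apply: addr_ge0; apply: mulr_ge0; exact: vrms_ge0.
  apply: mulr_ge0; first by apply: mulr_ge0; exact: vrms_ge0.
  by apply: mulr_ge0 fr0; rewrite mulr_ge0 ?sqr_ge0.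
have le1 := vrms_le_comb A.2 dXs.2 dZs.2 zs.2 m0 k0
  (fun w => analysis_pointwise_le w Zu small) (fun w => nrm_ge0 _ _).
apply: (le_trans le1); rewrite /analysis_bound /m /k.
by apply: analysis_bound_arith; rewrite ?vrms_ge0//; rewrite mulr_ge0 ?sqrtr_ge0// addr_ge0// mulr_ge0// vrms_ge0.
Qed.

End analysis_error.

(** * The filter as the analysis variable of the truncated pair *)

Section pckf_convergence.
Context (R : realType) (X : normedModType R) (ip : X -> X -> R) (c : R).
Hypothesis ipP : inner_product ip c.
Hypothesis X_complete : cauchy_complete X.
Context dT (T : measurableType dT) (P : probability T R) (d : nat).
Context (U : T -> X) (eps : T -> 'rV[R]_d) (G : X -> 'rV[R]_d).
Hypothesis G_cont : continuous G.
Hypotheses (Um : smeas U) (epsm : smeas eps).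
Hypothesis GUs : vsq (@edot R d) P (fun w => G (U w)).
Context (xi : nat -> {RV P >-> R}) (xi_indep : independent xi).
Context (p : nat -> nat -> {poly R}) (p_0 : forall m, p m 0%N = 1).
Context (p_cons : forall m, complete_orthonormal (distribution P (xi m)) (p m)).
Context (u_ : multi_index -> X) (eps_ : multi_index -> 'rV[R]_d).
Hypothesis U_chaos : chaos_expansion xi p (ipnorm ip) U u_.
Hypothesis eps_chaos : chaos_expansion xi p (@enorm R d) eps eps_.
Hypothesis pckf_UE : forall F, pckf_U xi p U F = chaos_sum xi p F u_.
Context (z : 'rV[R]_d) (J : nat -> {fset multi_index}).
Hypothesis J_mono : forall m n, (m <= n)%N -> (J m `<=` J n)%fset.
Hypothesis J_exhaustive : forall a, exists n, a \in J n.
Hypothesis J_0 : [fsfun] \in J 0%N.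
Context (delta C : R) (delta_gt0 : 0 < delta).
Hypothesis G_bound : forall n,
  (\int[P]_w ((enorm (G (chaos_sum xi p (J n) u_ w)) `^ (2 + delta))%:E) <= C%:E)%E.

Let eP := inner_product_edot R d.
Let Z w := G (U w) + eps w.
Let UJ n := chaos_sum xi p (J n) u_.
Let Y n w := G (UJ n w) + eps w.
Let ZJ n := chaos_sum xi p (J n) (rV_fcoef xi p (Y n)).
Local Notation evsq := (vsq (@edot R d) P).
Local Notation erms := (vrms (@edot R d) P).

Lemma vsq_U : vsq ip P U.
Proof. exact: (chaos_expansion_vsq ipP xi_indep p_0 p_cons Um U_chaos). Qed.

Lemma vsq_eps : evsq eps.
Proof. exact: (chaos_expansion_vsq eP xi_indep p_0 p_cons epsm eps_chaos). Qed.

Lemma vsq_UJ n : vsq ip P (UJ n).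
Proof. exact: (vsq_chaos_sum ipP xi_indep p_0 p_cons). Qed.

Lemma vsq_ZJ n : evsq (ZJ n).
Proof. exact: (vsq_chaos_sum eP xi_indep p_0 p_cons). Qed.

Lemma vrms_U_cvg0 : vrms ip P (fun w => U w - UJ n w) @[n --> \oo] --> (0 : R).
Proof.
exact: (chaos_expansion_vrms_cvg0 J_mono J_exhaustive ipP xi_indep p_0 p_cons Um U_chaos).
Qed.

Lemma vsq_GUJ n : evsq (fun w => G (UJ n w)).
Proof. exact: (vsq_comp_moment vsq_UJ G_cont delta_gt0 G_bound). Qed.

Lemma vsq_Y n : evsq (Y n).
Proof. exact: (vsqD eP (vsq_GUJ n) vsq_eps). Qed.

Lemma vsq_Z : evsq Z.
Proof. exact: (vsqD eP GUs vsq_eps). Qed.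

Lemma erms_Y_cvg0 : erms (fun w => Z w - Y n w) @[n --> \oo] --> (0 : R).
Proof.
have c0 := continuous_mapping_rms ipP vsq_U vsq_UJ vrms_U_cvg0 G_cont GUs delta_gt0 G_bound.
have E n : (fun w => Z w - Y n w) = (fun w => G (U w) - G (UJ n w)).
  by apply/funext => w; rewrite /Z /Y opprD addrACA subrr addr0.
have E' : (fun n => erms (fun w => Z w - Y n w)) =
    (fun n => erms (fun w => G (U w) - G (UJ n w))).
  by apply/funext => n; exact: congr1 (E n).
by rewrite E'.
Qed.

Lemma in_chaos_Y n i : in_chaos xi p (fun w => Y n w 0 i).
Proof.
have := in_chaosD xi_indep p_0 p_cons
  (in_chaos_comp_chaos_sum xi_indep p_0 p_cons G_cont i (vsq_GUJ n))
  (chaos_expansion_in_chaos xi_indep p_0 p_cons i epsm eps_chaos).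
by congr in_chaos; apply/funext => w; rewrite mxE.
Qed.

(** The closed span contains the coordinates of each [Y N], and these approximate those of [Z] in
    L^2. *)
Lemma in_chaos_Z i : in_chaos xi p (fun w => Z w 0 i).
Proof.
apply: (in_chaos_lim xi_indep p_0 p_cons); first exact: sqint_coord vsq_Z.
move=> e e0; have se0 : 0 < Num.sqrt e by rewrite sqrtr_gt0.
have /cvgr0_norm_lt/(_ _ se0)[N _ /(_ N (leqnn N)) /=] := erms_Y_cvg0.
rewrite ger0_norm ?vrms_ge0// => Ye.
exists (fun w => Y N w 0 i); first exact: in_chaos_Y.
have := msq_coord_le i (vsqB eP vsq_Z (vsq_Y N)).
have -> : (fun w => (Z w - Y N w) 0 i) = (fun w => Z w 0 i - Y N w 0 i).
  by apply/funext => w; rewrite mxE [X in _ + X]mxE.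
move=> /le_lt_trans; apply.
by rewrite -(sqr_sqrtr (ltW e0)) ltrXn2r// ?nnegrE ?vrms_ge0// ltW.
Qed.

Lemma pckf_ZE n : pckf_Z xi p G U eps (J n) = ZJ n.
Proof.
rewrite /pckf_Z pckf_UE /chaos_trunc.
have Yc := chaos_expansion_rV xi_indep p_0 p_cons (in_chaos_Y n).
by have -> := chaos_coefE eP xi_indep p_0 p_cons (vsq_Y n).1 Yc.
Qed.

Lemma erms_Z_cvg0 : erms (fun w => Z w - ZJ n w) @[n --> \oo] --> (0 : R).
Proof.
have Zc := chaos_expansion_rV xi_indep p_0 p_cons in_chaos_Z.
have c1 := chaos_expansion_vrms_cvg0 J_mono J_exhaustive eP xi_indep p_0 p_cons
  vsq_Z.1 Zc.
pose S n := chaos_sum xi p (J n) (rV_fcoef xi p Z).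
have Ss n : evsq (S n) by exact: (vsq_chaos_sum eP xi_indep p_0 p_cons).
apply: (@squeeze_cvgr _ _ _ _ (fun=> 0)
  (fun n => erms (fun w => Z w - S n w) + erms (fun w => Z w - Y n w))).
- apply: nearW => n; rewrite vrms_ge0/=.
  have E : (fun w => Z w - ZJ n w) = (fun w => (Z w - S n w) + (S n w - ZJ n w)).
    by apply/funext => w; rewrite subrKA.
  apply: (le_trans (eq_ler (congr1 erms E))).
  apply: (le_trans (vrmsD eP (vsqB eP vsq_Z (Ss n)) (vsqB eP (Ss n) (vsq_ZJ n)))).
  by rewrite lerD2l; exact: (vrms_chaos_sum_sub xi_indep p_0 p_cons _ vsq_Z (vsq_Y n)).
- exact: cvg_cst.
- by have := cvgD c1 erms_Y_cvg0; rewrite addr0; apply.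
Qed.

Lemma pckf_analysisE n :
  pckf_analysis xi p G U u_ eps (J n) z = analysis_variable P (UJ n) (ZJ n) z.
Proof.
have zc : chaos_coef xi p (@enorm R d) (ZJ n) =
    (fun a => if a \in J n then rV_fcoef xi p (Y n) a else 0).
  apply: (chaos_coefE eP xi_indep p_0 p_cons (vsq_ZJ n).1).
  by move=> e e0; have := chaos_expansion_sum eP xi p (J n) (rV_fcoef xi p (Y n)) e0.
apply/funext => w; rewrite /pckf_analysis /analysis_variable /pckf_analysis_coef.
rewrite pckf_ZE pckf_UE zc /chaos_sum.
under eq_bigr do rewrite scalerDr.
rewrite big_split/=; congr (_ + _).
rewrite -(kalman_gain_sum ipP X_complete (vsq_UJ n) (vsq_ZJ n)).
congr kalman_gain; under eq_bigr do rewrite scalerBr.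
rewrite sumrB; congr (_ - _); last first.
  by rewrite big_seq [RHS]big_seq; apply: eq_bigr => a ->.
(* The zero multi-index belongs to every [J n] and its polynomial is 1, so the Kronecker terms sum
   to the datum [z] itself. *)
have J0n : [fsfun] \in J n by apply: (fsubsetP (J_mono (leq0n n))).
rewrite (big_fsetD1 _ J0n)/= eqxx (chaos_poly0 xi p) !scale1r.
rewrite big_seq big1 ?addr0// => a.
by rewrite !inE => /andP[/negPf -> _]; rewrite scale0r scaler0.
Qed.

End pckf_convergence.

(** * Asymptotics of the analysis error *)

Section pckf_limits.
Context (R : realType) (X : normedModType R) (ip : X -> X -> R) (c : R).
Hypothesis ipP : inner_product ip c.
Hypothesis X_complete : cauchy_complete X.
Context dT (T : measurableType dT) (P : probability T R) (d : nat).
Context (U : T -> X) (Z : T -> 'rV[R]_d) (U_ : nat -> T -> X) (Z_ : nat -> T -> 'rV[R]_d).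
Hypothesis Us : vsq ip P U.
Hypothesis Zs : vsq (@edot R d) P Z.
Hypothesis U_s : forall n, vsq ip P (U_ n).
Hypothesis Z_s : forall n, vsq (@edot R d) P (Z_ n).
Hypothesis U_cvg : vrms ip P (fun w => U w - U_ n w) @[n --> \oo] --> (0 : R).
Hypothesis Z_cvg : vrms (@edot R d) P (fun w => Z w - Z_ n w) @[n --> \oo] --> (0 : R).
Hypothesis Z_unit : cov_mx P Z \in unitmx.
Variable z : 'rV[R]_d.

Lemma near_le_cvg0 (u : nat -> R) (e : R) : u n @[n --> \oo] --> (0 : R) -> 0 < e ->
  \forall n \near \oo, u n <= e.
Proof.
move=> u0 e0; have /cvgr0_norm_le/(_ _ e0) := u0.
by apply: filterS => n; apply: le_trans; exact: ler_norm.
Qed.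

Let r := fro (invmx (cov_mx P Z)).
Let k := Num.sqrt d%:R * (2 * vrms (@edot R d) P Z + 1).

Lemma near_perturb : \forall n \near \oo,
  vrms (@edot R d) P (fun w => Z w - Z_ n w) <= 1 /\
  k * vrms (@edot R d) P (fun w => Z w - Z_ n w) * r <= 2^-1.
Proof.
have kr0 : 0 <= k * r.
  rewrite mulr_ge0 ?fro_ge0// mulr_ge0 ?sqrtr_ge0//.
  by rewrite addr_ge0// mulr_ge0// vrms_ge0.
have kr1 : 0 < k * r + 1 by rewrite ltr_wpDl.
(* At this accuracy the relative perturbation is at most [k * r / (2 * (k * r + 1))], hence at most
   1/2; the added 1 covers [k * r = 0]. *)
have e0 : 0 < (2 * (k * r + 1))^-1 by rewrite invr_gt0 mulr_gt0.
have n1 := near_le_cvg0 Z_cvg ltr01.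
apply: filterS2 n1 (near_le_cvg0 Z_cvg e0) => n le1 le2; split=> //.
rewrite mulrAC.
apply: (le_trans (ler_wpM2l kr0 le2)).
rewrite ler_pdivrMr ?mulr_gt0// mulrA mulVf ?mul1r ?pnatr_eq0//.
by rewrite lerDl ler01.
Qed.

Lemma near_cov_mx_unit : \forall n \near \oo, cov_mx P (Z_ n) \in unitmx.
Proof.
apply: filterS near_perturb => n [dZ1 dZk].
have fl := fro_cov_le Zs (Z_s n) dZ1.
apply: (invmx_perturb Z_unit _).1; apply: le_trans dZk.
by rewrite ler_wpM2r ?fro_ge0.
Qed.

Lemma near_analysis_error : \forall n \near \oo,
  vrms ip P (fun w => analysis_variable P U Z z w - analysis_variable P (U_ n) (Z_ n) z w) <=
  analysis_bound ip P U Z z *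
    (vrms ip P (fun w => U w - U_ n w) + vrms (@edot R d) P (fun w => Z w - Z_ n w)).
Proof.
apply: filterS2 near_perturb (near_le_cvg0 U_cvg ltr01) => n [dZ1 dZk] dX1.
exact: (analysis_error_le ipP X_complete z Us (U_s n) Zs (Z_s n) Z_unit dX1 dZ1 dZk).
Qed.

Lemma analysis_error_cvg0 :
  vrms ip P (fun w => analysis_variable P U Z z w - analysis_variable P (U_ n) (Z_ n) z w)
    @[n --> \oo] --> (0 : R).
Proof.
apply: (@squeeze_cvgr _ _ _ _ (fun=> 0) (fun n => analysis_bound ip P U Z z *
    (vrms ip P (fun w => U w - U_ n w) + vrms (@edot R d) P (fun w => Z w - Z_ n w)))).
- by apply: filterS near_analysis_error => n ->; rewrite vrms_ge0.
- exact: cvg_cst.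
- have := cvgM (cvg_cst (analysis_bound ip P U Z z)) (cvgD U_cvg Z_cvg).
  by rewrite addr0 mulr0; apply.
Qed.

End pckf_limits.

(** The moment condition lives on [mu0] and is transported to [P] along the law of [U]. This calls
    for Borel measurability of the squared norm of [G], which follows coordinatewise from
    continuity. *)
Lemma vsq_comp_law (R : realType) dT (T : measurableType dT) (P : probability T R)
    (X : normedModType R) (d : nat) (mu0 : probability (borel X) R)
    (U : {RV P >-> borel X}) (G : X -> 'rV[R]_d)
    (law_U : forall A : set (borel X), measurable A -> distribution P U A = mu0 A)
    (G_cont : continuous G)
    (mu0_moment : (\int[mu0]_u ((`|u : X| ^+ 2 + enorm (G u) ^+ 2)%:E) < +oo)%E) :
  smeas (U : T -> X) -> vsq (@edot R d) P (fun w => G (U w)).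
Proof.
move=> Um; have eP := inner_product_edot R d.
have Gm : smeas (fun w => G (U w)) by exact: smeas_comp.
have mG := measurable_nrm eP Gm; split=> //; split=> //.
have mG2 : measurable_fun [set: borel X] (fun u : borel X => enorm (G u) ^+ 2).
  have -> : (fun u : borel X => enorm (G u) ^+ 2) =
      (fun u : borel X => \sum_(i < d) edot (G u) (delta_mx 0 i) ^+ 2).
    by apply/funext => u; rewrite sqr_enorm; apply: eq_bigr => i _; rewrite edot_delta.
  apply: measurable_sum => i; apply: measurable_funX.
  apply: (@continuous_borel_measurable R X (fun u => edot (G u) (delta_mx 0 i))).
  move=> u; apply: (@continuous_comp _ _ _ G (fun y => edot y (delta_mx 0 i))).
    exact: G_cont.
  exact: (@continuous_ip _ _ _ _ eP).
have mn2 : measurable_fun [set: borel X] (fun u : borel X => `|u : X| ^+ 2).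
  apply: measurable_funX; apply: (@continuous_borel_measurable R X (fun u => `|u|)).
  by move=> u; apply: cvg_norm; exact: cvg_id.
apply: ge0_intble => [|w|]; [exact: measurable_funX|exact: sqr_ge0|].
have mGe : measurable_fun [set: borel X] (fun u : borel X => (enorm (G u) ^+ 2)%:E).
  exact/measurable_EFinP.
have G0 (u : borel X) : (0 <= (enorm (G u) ^+ 2)%:E)%E by rewrite lee_fin sqr_ge0.
have E := ge0_integral_distribution U mGe G0.
apply: (le_lt_trans _ mu0_moment).
rewrite (_ : (\int[P]_w _)%E = (\int[distribution P U]_u (enorm (G u) ^+ 2)%:E)%E); last first.
  by rewrite E.
rewrite (eq_measure_integral mu0) => [|A mA _]; last exact: law_U.
apply: ge0_le_integral => //.
- by apply/measurable_EFinP; exact: measurable_funD.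
- by move=> u _; rewrite lee_fin lerDr sqr_ge0.
Qed.

(** The invertibility clauses accompany the error bounds because [invmx] is a true inverse only on
    [unitmx]. The errors are extended reals; each is first shown to be a finite root mean square. *)
Theorem theorem9 (R : realType)
    (dT : measure_display) (T : measurableType dT) (P : probability T R)
    (X : completeNormedModType R)
    (X_hilbert : hilbert_space X) (X_separable : separable_space X)
    (d : nat) (d_gt0 : (0 < d)%N)
    (mu0 : probability (borel X) R) (nu : probability (borel 'rV[R]_d) R)
    (U : {RV P >-> borel X}) (eps : {RV P >-> borel 'rV[R]_d})
    (G : X -> 'rV[R]_d)
    (* condition (1) *)
    (law_U : forall A : set (borel X), measurable A ->
      distribution P U A = mu0 A)
    (law_eps : forall B : set (borel 'rV[R]_d), measurable B ->
      distribution P eps B = nu B)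
    (law_U_eps : forall C : set (borel X * borel 'rV[R]_d), measurable C ->
      P ((fun w => (U w, eps w)) @^-1` C) = (mu0 \x nu)%E C)
    (* condition (2) *)
    (c : R) (c_gt0 : 0 < c) (l : 'rV[R]_d -> R)
    (l_ge0 : forall x, 0 <= l x)
    (l_meas : measurable_fun [set: borel 'rV[R]_d] (l : borel 'rV[R]_d -> R))
    (nu_density : forall B : set (borel 'rV[R]_d), measurable B ->
      nu B = (\int[@lebesgue_rV R d]_(x in B) (c * expR (- l x))%:E)%E)
    (* condition (3) *)
    (G_cont : continuous G)
    (* condition (4) *)
    (psi : R -> R)
    (psi_ge0 : forall s, 0 <= s -> 0 <= psi s)
    (psi_nd : forall s t, 0 <= s -> s <= t -> psi s <= psi t)
    (psi0 : psi 0 = 0) (psi_cvg0 : psi s @[s --> 0^'+] --> (0 : R))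
    (Phi_psi : forall z1 z2 : 'rV[R]_d,
      (\int[mu0]_u (`|l (z1 - G u) - l (z2 - G u)| ^+ 2)%:E
        <= (psi (enorm (z1 - z2)))%:E)%E)
    (* condition (5) *)
    (mu0_moment : (\int[mu0]_u ((`|u : X| ^+ 2 + enorm (G u) ^+ 2)%:E) < +oo)%E)
    (nu_moment : (\int[nu]_e ((enorm e ^+ 2)%:E) < +oo)%E)
    (* polynomial chaos setting *)
    (xi : nat -> {RV P >-> R}) (xi_indep : independent xi)
    (p : nat -> nat -> {poly R})
    (p_size : forall m a, size (p m a) = a.+1)
    (p_0 : forall m, p m 0%N = 1)
    (p_cons : forall m, complete_orthonormal (distribution P (xi m)) (p m))
    (u_ : multi_index -> X) (eps_ : multi_index -> 'rV[R]_d)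
    (u_summable : square_summable Num.norm u_)
    (eps_summable : square_summable (@enorm R d) eps_)
    (U_chaos : chaos_expansion xi p Num.norm (U : T -> X) u_)
    (eps_chaos : chaos_expansion xi p (@enorm R d) (eps : T -> 'rV[R]_d) eps_)
    (* data and truncations *)
    (z : 'rV[R]_d) (J : nat -> {fset multi_index})
    (J_mono : forall m n, (m <= n)%N -> (J m `<=` J n)%fset)
    (J_exhaustive : forall a, exists n, a \in J n)
    (J_0 : [fsfun] \in J 0%N)
    (delta C : R) (delta_gt0 : 0 < delta)
    (G_bound : forall n,
      (\int[P]_w ((enorm (G (pckf_U xi p U (J n) w)) `^ (2 + delta))%:E)
        <= C%:E)%E) :
  let Z := fun w => G (U w) + eps w in
  let UJ := fun n => pckf_U xi p U (J n) in
  let ZJ := fun n => pckf_Z xi p G U eps (J n) in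
  let Ua := analysis_variable P U Z z in
  let UaJ := fun n => pckf_analysis xi p G U u_ eps (J n) z in
  let err_U := fun n => L2norm P Num.norm (fun w => U w - UJ n w) in
  let err_Z := fun n => L2norm P (@enorm R d) (fun w => Z w - ZJ n w) in
  let err_Ua := fun n => L2norm P Num.norm (fun w => Ua w - UaJ n w) in
  [/\ err_Z n @[n --> \oo] --> 0%E,
      cov_mx P Z \in unitmx,
      \forall n \near \oo, cov_mx P (ZJ n) \in unitmx,
      exists K : R, \forall n \near \oo,
        (err_Ua n <= K%:E * (err_U n + err_Z n))%E
    & err_Ua n @[n --> \oo] --> 0%E].
Proof.
move=> Z UJ ZJ Ua UaJ err_U err_Z err_Ua.
have [ip [ipC ipl ipn]] := X_hilbert.
have ipP : inner_product ip 1.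
  by split=> // x; rewrite ipn// mul1r.
have eP := inner_product_edot R d.
have Xc := @cauchy_complete_normed R X.
have nrmE : (Num.norm : X -> R) = ipnorm ip.
  by apply/funext => x; rewrite /ipnorm ipn sqrtr_sqr normr_id.
have Um := separable_smeas_RV U X_separable.
have epsm := separable_smeas_RV eps (@separable_rV R d).
have GUs := vsq_comp_law law_U G_cont mu0_moment Um.
rewrite nrmE in U_chaos.
(* The truncation selects its coefficients by [chaos_coef]; uniqueness of expansions identifies them
   with [u_]. *)
have UJE F : pckf_U xi p U F = chaos_sum xi p F u_.
  rewrite /pckf_U /chaos_trunc nrmE.
  by rewrite (chaos_coefE ipP xi_indep p_0 p_cons Um U_chaos).
have GB n : (\int[P]_w ((enorm (G (chaos_sum xi p (J n) u_ w)) `^ (2 + delta))%:E) <= C%:E)%E.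
  by rewrite -UJE.
pose U_ n := chaos_sum xi p (J n) u_.
pose Z_ n := chaos_sum xi p (J n) (rV_fcoef xi p (fun w => G (U_ n w) + eps w)).
have ZJE n : ZJ n = Z_ n.
  exact: (pckf_ZE ipP G_cont epsm xi_indep p_0 p_cons eps_chaos UJE delta_gt0 GB n).
have UaJE n : UaJ n = analysis_variable P (U_ n) (Z_ n) z.
  exact: (pckf_analysisE ipP Xc G_cont epsm xi_indep p_0 p_cons eps_chaos UJE z J_mono J_0
    delta_gt0 GB n).
have Us : vsq ip P U := vsq_U ipP Um xi_indep p_0 p_cons U_chaos.
have Zs : vsq (@edot R d) P Z := vsq_Z epsm GUs xi_indep p_0 p_cons eps_chaos.
have U_s n : vsq ip P (U_ n) := vsq_chaos_sum ipP xi_indep p_0 p_cons (J n) u_.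
have Z_s n : vsq (@edot R d) P (Z_ n) := vsq_chaos_sum eP xi_indep p_0 p_cons (J n) _.
have U_cvg := vrms_U_cvg0 ipP Um xi_indep p_0 p_cons U_chaos J_mono J_exhaustive.
have Z_cvg := erms_Z_cvg0 ipP G_cont Um epsm GUs xi_indep p_0 p_cons U_chaos eps_chaos
  J_mono J_exhaustive delta_gt0 GB.
have Z_unit : cov_mx P Z \in unitmx.
  exact: (cov_mx_observation_unit law_U_eps l_meas nu_density G_cont Zs).
have eU n : err_U n = (vrms ip P (fun w => U w - U_ n w))%:E.
  rewrite /err_U /UJ nrmE UJE; exact: L2normE (vsqB ipP Us (U_s n)).
have eZ n : err_Z n = (vrms (@edot R d) P (fun w => Z w - Z_ n w))%:E.
  rewrite /err_Z ZJE; exact: L2normE (vsqB eP Zs (Z_s n)).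
have eUa n : err_Ua n = (vrms ip P (fun w => analysis_variable P U Z z w -
    analysis_variable P (U_ n) (Z_ n) z w))%:E.
  rewrite /err_Ua nrmE UaJE.
  exact: L2normE (vsqB ipP (vsq_analysis ipP Xc Us Zs z) (vsq_analysis ipP Xc (U_s n) (Z_s n) z)).
split.
- under eq_fun do rewrite eZ; apply/cvg_EFin; [exact: nearW|exact: Z_cvg].
- exact: Z_unit.
- apply: filterS (near_cov_mx_unit Zs Z_s Z_cvg Z_unit) => n; by rewrite ZJE.
- exists (analysis_bound ip P U Z z).
  apply: filterS (near_analysis_error ipP Xc Us Zs U_s Z_s U_cvg Z_cvg Z_unit z) => n.
  by rewrite eUa eU eZ -EFinD -EFinM lee_fin.
- under eq_fun do rewrite eUa; apply/cvg_EFin; first exact: nearW.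
  exact: (analysis_error_cvg0 ipP Xc Us Zs U_s Z_s U_cvg Z_cvg Z_unit z).
Qed.
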